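(* Let $a_0,\dots,a_{n-1}$ be complex numbers and let $c_0,c_1,\dots,c_n$ be given by $c_0=1$ and $$c_k=c_0a_{k-1}+c_1a_{k-2}+\cdots+c_{k-1}a_0,\qquad 1\le k\le n .$$ Then the Carathéodory–Fejér problem with data $a_0,\dots,a_{n-1}$ is solvable if and only if the trigonometric moment problem with data $c_0,\dots,c_n$ is solvable, in the following sense. For every integer $\kappa\ge0$: there is a function $S(z)\in\mathbf S_\kappa$ which is holomorphic at the origin and satisfies $S(z)=a_0+a_1z+\cdots+a_{n-1}z^{n-1}+O(z^n)$ near the origin if and only if there is a sequence $(c_j)_{j=0}^\infty$ in $\mathfrak P_\kappa$ extending $c_0,\dots,c_n$. For all integers $\nu,\pi\ge0$: there is such a function $S(z)$ in $\mathbf S_{\nu,\pi}$ if and only if there is a sequence $(c_j)_{j=0}^\infty$ in $\mathfrak P_{\nu,\pi+1}$ extending $c_0,\dots,c_n$.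
   Context: A Hermitian kernel $K(w,z)$ on a set has $\kappa$ negative (resp. positive) squares if every matrix $(K(w_j,w_i))_{i,j}$ built from finitely many points has at most $\kappa$ negative (resp. positive) eigenvalues and some such matrix has exactly $\kappa$. $\mathbf S_\kappa$ is the set of complex-valued functions $S$ holomorphic on some subregion of the open unit disk $\mathbf D$ such that the kernel $K_S(w,z)=\frac{1-S(z)\overline{S(w)}}{1-z\bar w}$ has $\kappa$ negative squares; such functions extend meromorphically to $\mathbf D$. $\mathbf S_{\nu,\pi}$ is the class of meromorphic functions $S$ on $\mathbf D$ for which $K_S$ has $\nu$ negative squares and $\pi$ positive squares. For a sequence $(c_j)_{j=0}^\infty$ of complex numbers with $\bar c_0=c_0$, $M_r$ is the $(r+1)\times(r+1)$ Hermitian Toeplitz matrix with $(M_r)_{ij}=c_{i-j}$ for $i\ge j$ and $(M_r)_{ij}=\bar c_{j-i}$ for $i<j$ ($0\le i,j\le r$). $\mathfrak P_\kappa$ (resp. $\mathfrak P_{\nu,\pi}$) is the set of all sequences $(c_j)_{j=0}^\infty$ with $\bar c_0=c_0$ such that $M_r$ has $\kappa$ negative eigenvalues (resp. $\nu$ negative and $\pi$ positive eigenvalues), counting multiplicity, for all sufficiently large $r$. *)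

(* Defs.v *)
From HB Require Import structures.
From mathcomp Require Import all_boot all_order all_algebra.
From mathcomp Require Import complex.
From mathcomp Require Import all_classical all_reals all_analysis.

Set Implicit Arguments.
Unset Strict Implicit.
Unset Printing Implicit Defensive.

Import Order.TTheory GRing.Theory Num.Theory.
Import numFieldNormedType.Exports.

Local Open Scope classical_set_scope.
Local Open Scope ring_scope.

Definition eigenvalues (C : numClosedFieldType) (m : nat) (A : 'M[C]_m) : seq C :=
  sval (closed_field_poly_normal (char_poly A)).

(* In a numClosedFieldType, [x < 0] and [0 < x] entail that [x] is real. *)
Definition neg_eigen (C : numClosedFieldType) (m : nat) (A : 'M[C]_m) : nat :=
  count (fun x => x < 0) (eigenvalues A).

Definition pos_eigen (C : numClosedFieldType) (m : nat) (A : 'M[C]_m) : nat :=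
  count (fun x => 0 < x) (eigenvalues A).

Definition gram (C : numClosedFieldType) (K : C -> C -> C) (m : nat)
    (w : 'I_m -> C) : 'M[C]_m :=
  \matrix_(i < m, j < m) K (w j) (w i).

Definition negative_squares (C : numClosedFieldType) (A : set C)
    (K : C -> C -> C) (k : nat) : Prop :=
  (forall (m : nat) (w : 'I_m -> C), (forall i, A (w i)) ->
     (neg_eigen (gram K w) <= k)%N) /\
  (exists (m : nat) (w : 'I_m -> C), (forall i, A (w i)) /\
     neg_eigen (gram K w) = k).

Definition positive_squares (C : numClosedFieldType) (A : set C)
    (K : C -> C -> C) (k : nat) : Prop :=
  (forall (m : nat) (w : 'I_m -> C), (forall i, A (w i)) ->
     (pos_eigen (gram K w) <= k)%N) /\
  (exists (m : nat) (w : 'I_m -> C), (forall i, A (w i)) /\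
     pos_eigen (gram K w) = k).

Definition unit_disk (C : numClosedFieldType) : set C := [set z | `|z| < 1].

Definition region (C : numClosedFieldType) (Om : set C) : Prop :=
  [/\ open Om, connected Om & Om !=set0].

(* [C^o] is [C] as a one-dimensional vector space over itself, so that the
   derivative in the direction 1 is the complex derivative. *)
Definition holomorphic_on (C : numClosedFieldType) (Om : set C) (S : C -> C) : Prop :=
  forall z, Om z -> derivable (S : C^o -> C^o) z 1.

Definition holomorphic_at (C : numClosedFieldType) (S : C -> C) (z : C) : Prop :=
  \forall w \near z, derivable (S : C^o -> C^o) w 1.

(* A meromorphic function is represented by a total function; the exponent [k]
   can be chosen larger than the order of the pole, so the value of [S] at a
   pole is irrelevant. *)
Definition meromorphic_on (C : numClosedFieldType) (Om : set C) (S : C -> C) : Prop :=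
  forall p, Om p ->
    exists k : nat, holomorphic_at (fun z => (z - p) ^+ k * S z) p.

Definition schur_kernel (C : numClosedFieldType) (S : C -> C) (w z : C) : C :=
  (1 - S z * (S w)^*) / (1 - z * w^*).

Definition schur_kappa (C : numClosedFieldType) (kappa : nat)
    (Om : set C) (S : C -> C) : Prop :=
  [/\ region Om, Om `<=` @unit_disk C, holomorphic_on Om S
    & negative_squares Om (schur_kernel S) kappa].

Definition schur_nu_pi (C : numClosedFieldType) (nu pi : nat) (S : C -> C) : Prop :=
  let dom := [set z | unit_disk z /\ holomorphic_at S z] in
  [/\ meromorphic_on (@unit_disk C) S,
      negative_squares dom (schur_kernel S) nu
    & positive_squares dom (schur_kernel S) pi].

Definition continuation (C : numClosedFieldType) (Om : set C) (S : C -> C)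
    (Om' : set C) (F : C -> C) : Prop :=
  [/\ region Om', Om `<=` Om', holomorphic_on Om' F
    & forall z, Om z -> F z = S z].

Definition taylor_data (C : numClosedFieldType) (n : nat) (a : nat -> C)
    (S : C -> C) : Prop :=
  ((fun z : C => S z - \sum_(k < n) a k * z ^+ k) : C -> C^o)
    =O_ (nbhs (0 : C)) ((fun z : C => z ^+ n) : C -> C^o).

(* An element of the first class is a function on a region [Om] which need not
   contain 0; "holomorphic at the origin" then refers to its (unique)
   meromorphic extension [F], which is holomorphic on some region of the disk
   containing [Om] and 0. *)
Definition cf_solvable_kappa (C : numClosedFieldType) (n : nat) (a : nat -> C)
    (kappa : nat) : Prop :=
  exists (Om : set C) (S : C -> C), schur_kappa kappa Om S /\
    exists (Om' : set C) (F : C -> C),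
      [/\ continuation Om S Om' F, Om' `<=` @unit_disk C, Om' 0
        & taylor_data n a F].

Definition cf_solvable_nu_pi (C : numClosedFieldType) (n : nat) (a : nat -> C)
    (nu pi : nat) : Prop :=
  exists S : C -> C,
    [/\ schur_nu_pi nu pi S, holomorphic_at S 0 & taylor_data n a S].

Definition toeplitz (C : numClosedFieldType) (c : nat -> C) (r : nat) : 'M[C]_r.+1 :=
  \matrix_(i < r.+1, j < r.+1)
    if (j <= i)%N then c (i - j)%N else (c (j - i)%N)^*.

Definition P_kappa (C : numClosedFieldType) (kappa : nat) (c : nat -> C) : Prop :=
  (c 0%N)^* = c 0%N /\
  exists r0 : nat, forall r, (r0 <= r)%N -> neg_eigen (toeplitz c r) = kappa.

Definition P_nu_pi (C : numClosedFieldType) (nu pi : nat) (c : nat -> C) : Prop :=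
  (c 0%N)^* = c 0%N /\
  exists r0 : nat, forall r, (r0 <= r)%N ->
    neg_eigen (toeplitz c r) = nu /\ pos_eigen (toeplitz c r) = pi.

Definition extends_data (C : numClosedFieldType) (n : nat) (c c' : nat -> C) : Prop :=
  forall k, (k <= n)%N -> c' k = c k.

(* Main.v *)
Require Import Defs.
From mathcomp Require Import all_boot all_order all_algebra.
From mathcomp Require Import spectral sesquilinear complex ring lra zify.
From mathcomp Require Import all_classical all_reals all_analysis.

(** Both problems are governed by one Hermitian kernel on the natural numbers,
    attached to a sequence [a] of Taylor coefficients:
      K(i, j) = delta_(ij) - sum_(l <= min i j) a_(i-l) * conj a_(j-l),
    the array of coefficients of (1 - S(z) conj S(w)) / (1 - z conj w) for
    S(z) = sum_j a_j z^j.  The problem on functions and the problem on moments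
    both turn out to ask for a sequence that begins with the given [a_k] and
    whose kernel K has the prescribed numbers of squares.

    On the side of moments, the relation between [a] and [c] says that the
    generating series of [c] is 1 / (1 - z S(z)).  Multiplying the Toeplitz
    matrix of [c] on both sides by the triangular Toeplitz matrix of 1 - z S(z)
    turns it into the direct sum of 1 and of a section of K
    ([toeplitz_congruence]); by Sylvester's law of inertia the negative squares
    agree and the positive ones differ by one ([P_kappaE], [P_nu_piE]).

    On the side of functions, one must see that the Schur kernel of S has on any
    nonempty open subset of a connected domain containing 0 as many squares as K
    ([squares_at_origin]).  Both kernels have the form
      B(s, t) = sum_l X_s(l) conj X_t(l) - Y_s(l) conj Y_t(l)
    with feature vectors X, Y attached to points or to orders of derivation.
    Being negative definite on a k-dimensional space is an open condition, so
    the number of negative squares cannot increase if the feature vectors of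
    one kernel are limits of combinations of those of the other
    ([negsq_approx]).  Point features are sums of Taylor series, hence limits of
    combinations of jet features; conversely Taylor coefficients, and values at
    other points of a disc of holomorphy, are limits of combinations of values
    at roots of unity on a small circle.  A chain of discs then reaches every
    point of a connected domain.  The analytic input is that a complex
    differentiable function has a convergent power series; it is obtained from
    Goursat's theorem by averaging over roots of unity ([power_series]).

    It remains to find the function when K is given.  If K has finitely many
    negative squares, a vector that is K-orthogonal to a maximal negative
    subspace has nonnegative square, and shifting indices can only decrease
    squares; comparing the two bounds the growth of [a_j] by a geometric
    sequence, so that S is holomorphic near 0 ([coefficients_geometric]).  If
    K also has finitely many positive squares, its rank is finite, and a nonzero
    vector in the kernel of K is, up to conjugation, the list of coefficients of
    a polynomial P such that P = Q S for another polynomial Q ([null_vector],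
    [formal_rational]).  So S is rational, and meromorphic on the disc.  Finally, removing poles does not disconnect
    the disc ([holo_dom_connected]), which makes the second point apply to
    meromorphic functions. *)

Set Implicit Arguments.
Unset Strict Implicit.
Unset Printing Implicit Defensive.

Import Order.TTheory GRing.Theory Num.Theory.
Local Open Scope ring_scope.
Local Open Scope sesquilinear_scope.

(** * Inertia of Hermitian matrices *)

Section Inertia.
Variable C : numClosedFieldType.

Definition hform (I : finType) (G : I -> I -> C) (u v : I -> C) : C :=
  \sum_a \sum_b u a * G a b * (v b)^*.

Definition herm_kernel (I : Type) (G : I -> I -> C) := forall a b, G b a = (G a b)^*.

(** The inequality is asked only of nonzero coefficient vectors, which makes
    the vectors W p linearly independent: k is a lower bound for the negative
    index of inertia of G. *)
Definition negsub (I : finType) (G : I -> I -> C) (k : nat) :=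
  exists W : 'I_k -> I -> C, forall x : 'I_k -> C, (exists p, x p != 0) ->
    let u := fun a => \sum_p x p * W p a in hform G u u < 0.

(** A normalized witness of the same property, whose Gram matrix is minus the
    identity. Being a finite list of equations it behaves well under limits.
    *)
Definition negframe (I : finType) (G : I -> I -> C) (k : nat) :=
  exists W : 'I_k -> I -> C, forall p q, hform G (W p) (W q) = - (p == q)%:R.

Lemma sum_norm2_gt0 (I : finType) (x : I -> C) :
  (exists p, x p != 0) -> 0 < \sum_p x p * (x p)^*.
Proof.
move=> [p xp]; rewrite (bigD1 p) //= ltr_pwDl //.
  by rewrite -normCK exprn_gt0 // normr_gt0.
by apply: sumr_ge0 => i _; rewrite -normCK exprn_ge0.
Qed.

Lemma hform_comb (I J : finType) (G : I -> I -> C) (W : J -> I -> C) (x y : J -> C) :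
  hform G (fun a => \sum_p x p * W p a) (fun a => \sum_p y p * W p a)
  = hform (fun p q => hform G (W p) (W q)) x y.
Proof.
pose T p q a b := x p * (W p a * G a b * (W q b)^*) * (y q)^*.
have -> : hform G (fun a => \sum_p x p * W p a) (fun a => \sum_p y p * W p a)
    = \sum_a \sum_b \sum_p \sum_q T p q a b.
  apply: eq_bigr => a _; apply: eq_bigr => b _.
  rewrite rmorph_sum /= -mulrA mulr_suml; apply: eq_bigr => p _.
  rewrite mulrA mulr_sumr; apply: eq_bigr => q _.
  by rewrite rmorphM /T /=; ring.
have -> : hform (fun p q => hform G (W p) (W q)) x y
    = \sum_p \sum_q \sum_a \sum_b T p q a b.
  apply: eq_bigr => p _; apply: eq_bigr => q _.
  rewrite mulr_sumr mulr_suml; apply: eq_bigr => a _.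
  by rewrite mulr_sumr mulr_suml; apply: eq_bigr.
under eq_bigr do rewrite exchange_big /=.
rewrite exchange_big /=; apply: eq_bigr => p _.
under eq_bigr do rewrite exchange_big /=.
by rewrite exchange_big.
Qed.

(** The eigenvalues were defined as roots of the characteristic polynomial;
    unitary diagonalization gives the same list, since similar matrices have
    the same characteristic polynomial. *)
Lemma eigenvalues_spectral n (A : 'M[C]_n) : A ^t* = A ->
  perm_eq (eigenvalues A) [seq spectral_diag A 0 i | i <- enum 'I_n].
Proof.
move=> hA.
have hN : A \is normalmx by apply/normalmxP; rewrite hA.
have /orthomx_spectralP hs := hN.
have hc : char_poly A = \prod_(i < n) ('X - (spectral_diag A 0 i)%:P).
  set P := spectralmx A in hs *; set D := diag_mx _ in hs.
  have uP : P \in unitmx by apply: spectral_unit.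
  have -> : char_poly A = char_poly D.
    rewrite /char_poly /char_poly_mx {1}hs.
    have -> : 'X%:M - map_mx polyC (invmx P *m D *m P) =
      map_mx polyC (invmx P) *m ('X%:M - map_mx polyC D) *m map_mx polyC P.
      rewrite mulmxBr mulmxBl -!map_mxM mul_mx_scalar -scalemxAl -map_mxM mulVmx //.
      by rewrite map_mx1 scalemx1.
    rewrite !det_mulmx mulrC mulrA -det_mulmx -map_mxM mulmxV // map_mx1 det1.
    by rewrite mul1r.
  rewrite char_poly_trig ?diag_mx_is_trig //.
  by apply: eq_bigr => i _; rewrite mxE eqxx mulr1n.
rewrite /eigenvalues; case: closed_field_poly_normal => /= s hs'.
apply/prod_XsubC_eq.
have := hs'; rewrite (monicP (char_poly_monic A)) scale1r => <-.
by rewrite hc big_map big_enum.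
Qed.

(** The sign s, equal to 1 or -1, lets one development serve for negative and
    for positive eigenvalues. *)
Definition sgn_eigen (s : C) n (A : 'M[C]_n) : nat :=
  count (fun x => s * x < 0) (eigenvalues A).

Lemma neg_eigenE n (A : 'M[C]_n) : neg_eigen A = sgn_eigen 1 A.
Proof. by apply: eq_count => x; rewrite mul1r. Qed.

Lemma pos_eigenE n (A : 'M[C]_n) : pos_eigen A = sgn_eigen (-1) A.
Proof. by apply: eq_count => x; rewrite mulN1r oppr_lt0. Qed.

Section Spectral.
Variables (n : nat) (A : 'M[C]_n) (s : C).
Hypotheses (hA : A ^t* = A) (hs : s \is Num.real).
Let d i := spectral_diag A 0 i.
Let P := spectralmx A.
Let N := [set i | s * d i < 0].
Let sA := fun i j => s * A i j.

Lemma sgn_eigen_card : sgn_eigen s A = #|N|.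
Proof.
rewrite /sgn_eigen (permP (eigenvalues_spectral hA)) count_map.
rewrite -sum1_count -sum1_card big_enum_cond /=.
by apply: eq_bigl => i; rewrite inE.
Qed.

Lemma spectral_real i : d i \is Num.real.
Proof.
have h : A \is hermsymmx by apply/is_hermitianmxP; rewrite expr0 scale1r.
by have /mxOverP := hermitian_spectral_diag_real h; apply.
Qed.

Let hat (u : 'I_n -> C) i := \sum_a u a * (P i a)^*.

(** In the coordinates given by an orthonormal eigenbasis the form is
    diagonal. *)
Lemma hform_spectral u v :
  hform sA u v = \sum_i s * d i * hat u i * (hat v i)^*.
Proof.
have hN : A \is normalmx by apply/normalmxP; rewrite hA.
have /orthomx_spectralP := hN; rewrite invmx_unitary ?spectral_unitarymx // => e.
have E a b : A a b = \sum_i (P i a)^* * d i * P i b.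
  rewrite {1}e !mxE; apply: eq_bigr => i _; rewrite mul_mx_diag !mxE //.
pose T a b i := s * d i * (u a * (P i a)^* ) * (v b * (P i b)^*)^*.
have -> : hform sA u v = \sum_a \sum_b \sum_i T a b i.
  apply: eq_bigr => a _; apply: eq_bigr => b _.
  rewrite /sA E !mulr_sumr mulr_suml; apply: eq_bigr => i _.
  by rewrite /T rmorphM /= conjCK; ring.
have -> : \sum_i s * d i * hat u i * (hat v i)^* = \sum_i \sum_a \sum_b T a b i.
  apply: eq_bigr => i _; rewrite mulr_sumr mulr_suml; apply: eq_bigr => a _.
  by rewrite rmorph_sum mulr_sumr.
under eq_bigr do rewrite exchange_big /=.
by rewrite exchange_big.
Qed.

(** If the negative definite space had larger dimension than the span of the
    eigenvectors with negative eigenvalue, it would contain a nonzero vector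
    with no component along them, on which the form is nonnegative. *)
Lemma negsub_eigen k : negsub sA k -> (k <= sgn_eigen s A)%N.
Proof.
move=> [W hW]; rewrite sgn_eigen_card leqNgt; apply/negP => ltk.
pose Q : 'M[C]_(k, #|N|) := \matrix_(p, j) hat (W p) (enum_val j).
have : kermx Q != 0.
  rewrite -mxrank_eq0 mxrank_ker -lt0n subn_gt0.
  by apply: leq_ltn_trans ltk; apply: rank_leq_col.
move=> /rowV0Pn [x /sub_kermxP xQ x0].
have /rV0Pn x0' := x0.
have := hW (fun p => x 0 p) x0'; rewrite /= hform_spectral.
pose u a := \sum_p x 0 p * W p a; rewrite -/u.
move=> hlt.
suff hge : 0 <= \sum_i s * d i * hat u i * (hat u i)^* by rewrite (lt_geF hlt) in hge.
have hu i : hat u i = \sum_p x 0 p * hat (W p) i.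
  rewrite /hat /u; under eq_bigr do rewrite mulr_suml.
  rewrite exchange_big /=; apply: eq_bigr => p _; rewrite mulr_sumr.
  by apply: eq_bigr => a _; rewrite mulrA.
apply: sumr_ge0 => i _.
have [iN|iN] := boolP (i \in N).
  suff -> : hat u i = 0 by rewrite mulr0 mul0r.
  have /rowP/(_ (enum_rank_in iN i)) := xQ; rewrite !mxE hu => h0; rewrite -[RHS]h0.
  by apply: eq_bigr => p _; rewrite mxE enum_rankK_in.
rewrite -mulrA -normCK mulr_ge0 ?exprn_ge0 //.
by move: iN; rewrite inE real_ltNge ?real0 ?realM ?spectral_real // negbK.
Qed.

(** The eigenvectors with negative eigenvalue, divided by the square root of
    the absolute value of the eigenvalue. *)
Lemma negframe_eigen k : (k <= sgn_eigen s A)%N -> negframe sA k.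
Proof.
rewrite sgn_eigen_card => lek.
pose f (p : 'I_k) : 'I_n := enum_val (widen_ord lek p).
have fN p : s * d (f p) < 0 by have := enum_valP (widen_ord lek p); rewrite inE.
have f_inj : injective f by move=> p q /enum_val_inj /(congr1 val)/= /val_inj.
pose t p := (sqrtC (- (s * d (f p))))^-1.
have tge p : 0 <= t p by rewrite invr_ge0 sqrtC_ge0 oppr_ge0 ltW.
exists (fun p a => t p * P (f p) a) => p q.
have hh r i : hat (fun a => t r * P (f r) a) i = t r * (f r == i)%:R.
  have /unitarymxP/matrixP/(_ (f r) i) := spectral_unitarymx A.
  rewrite !mxE => <-; rewrite mulr_sumr; apply: eq_bigr => a _.
  by rewrite !mxE mulrA.
rewrite hform_spectral; under eq_bigr do rewrite !hh.
have [<-|neq] := eqVneq p q.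
  rewrite (bigD1 (f p)) //= big1 ?addr0; last first.
    by move=> i; rewrite eq_sym => /negbTE ->; rewrite !(mulr0, mul0r).
  rewrite eqxx mulr1 conj_Creal ?ger0_real // -mulrA -expr2 exprVn sqrtCK.
  by rewrite invrN mulrN divff // lt_eqF.
rewrite mulr0n oppr0 big1 // => i _.
have [e|] := eqVneq (f p) i; last by rewrite !(mulr0, mul0r).
rewrite -e (inj_eq f_inj) eq_sym (negbTE neq) mulr0 rmorph0 mulr0 //.
Qed.

End Spectral.

Lemma negframe_negsub (I : finType) (G : I -> I -> C) k :
  negframe G k -> negsub G k.
Proof.
move=> [W hW]; exists W => x x0 /=; rewrite hform_comb.
suff -> : hform (fun p q => hform G (W p) (W q)) x x = - \sum_p x p * (x p)^*.
  by rewrite oppr_lt0 sum_norm2_gt0.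
rewrite -sumrN; apply: eq_bigr => p _; rewrite (bigD1 p) //= big1 ?addr0.
  by rewrite hW eqxx mulrN1 mulNr.
by move=> q qp; rewrite hW eq_sym (negbTE qp) oppr0 mulr0 mul0r.
Qed.

(** The passage through eigenvectors replaces an orthonormalization of the
    given family. *)
Lemma negsub_negframe (I : finType) (G : I -> I -> C) k :
  herm_kernel G -> negsub G k -> negframe G k.
Proof.
move=> hG [W hW].
pose A : 'M[C]_#|I| := \matrix_(i, j) G (enum_val i) (enum_val j).
have hA : A ^t* = A by apply/matrixP => i j; rewrite !mxE -hG.
have reidx u v : hform G u v
    = hform (fun i j => 1 * A i j) (u \o enum_val) (v \o enum_val).
  rewrite /hform (reindex (@enum_val I I)) /=; last by apply: onW_bij; exact: enum_val_bij.
  apply: eq_bigr => i _; rewrite (reindex (@enum_val I I)) /=; last by apply: onW_bij; exact: enum_val_bij.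
  by apply: eq_bigr => j _; rewrite mxE mul1r.
have [V hV] : negframe (fun i j => 1 * A i j) k.
  apply: (negframe_eigen hA); apply: (negsub_eigen hA (real1 C)).
  by exists (fun p => W p \o enum_val) => x x0; have := hW x x0; rewrite /= reidx.
exists (fun p => V p \o enum_rank) => p q; rewrite reidx -hV.
by apply: eq_bigr => i _; apply: eq_bigr => j _; rewrite /= !enum_valK.
Qed.

End Inertia.

(** * Negative squares of a kernel *)

Section Squares.
Variable C : numClosedFieldType.

(** Pushing vectors forward along f, by summing over fibres, preserves their
    values under the form. Repeated points therefore add no negative squares.
    *)
Lemma negsub_map (I J : finType) (G : J -> J -> C) (f : I -> J) k :
  negsub (fun a b => G (f a) (f b)) k -> negsub G k.
Proof.
move=> [W hW]; exists (fun p j => \sum_(a | f a == j) W p a) => x x0 /=.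
have := hW x x0; rewrite /=.
suff -> : hform (fun a b => G (f a) (f b)) (fun a => \sum_p x p * W p a)
   (fun a => \sum_p x p * W p a) =
  hform G (fun j => \sum_p x p * \sum_(a | f a == j) W p a)
    (fun j => \sum_p x p * \sum_(a | f a == j) W p a) by [].
pose u a := \sum_p x p * W p a.
have hu j : \sum_p x p * \sum_(a | f a == j) W p a = \sum_(a | f a == j) u a.
  by under eq_bigr do rewrite mulr_sumr; rewrite exchange_big.
rewrite /hform -/u.
under [RHS]eq_bigr do under eq_bigr do rewrite !hu.
rewrite (partition_big f predT) //=; apply: eq_bigr => j _.
under [RHS]eq_bigr do rewrite !mulr_suml.
rewrite [RHS]exchange_big /=; apply: eq_bigr => a /eqP fa.
rewrite (partition_big f predT) //=; apply: eq_bigr => i _.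
rewrite rmorph_sum mulr_sumr; apply: eq_bigr => b /eqP fb.
by rewrite fa fb.
Qed.

(** Negative squares counted from below. The points are indexed by an
    arbitrary finite type, so that families can be combined without
    renumbering. *)
Definition negsq (T : Type) (A : set T) (B : T -> T -> C) (k : nat) :=
  exists (I : finType) (w : I -> T), (forall a, A (w a)) /\
    negsub (fun a b => B (w a) (w b)) k.

Lemma leq_sgn_eigen n (A : 'M[C]_n) s k : A ^t* = A -> s \is Num.real ->
  negsub (fun i j => s * A i j) k <-> (k <= sgn_eigen s A)%N.
Proof.
move=> hA hs; split; first exact: negsub_eigen.
by move=> h; apply: negframe_negsub; apply: (negframe_eigen hA).
Qed.

(** The largest k for which [negsq] holds is the largest number of negative
    eigenvalues among the matrices of the kernel. *)
Lemma negsq_squares (T : Type) (A : set T) (B : T -> T -> C) (N : nat) :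
  herm_kernel B ->
  (forall k, negsq A B k <-> (k <= N)%N) <->
  ((forall (m : nat) (w : 'I_m -> T), (forall i, A (w i)) ->
     (sgn_eigen 1 (\matrix_(i < m, j < m) B (w i) (w j)) <= N)%N) /\
  (exists (m : nat) (w : 'I_m -> T), (forall i, A (w i)) /\
     sgn_eigen 1 (\matrix_(i < m, j < m) B (w i) (w j)) = N)).
Proof.
move=> hB.
have hM m (w : 'I_m -> T) : let M := \matrix_(i < m, j < m) B (w i) (w j) in
    M ^t* = M by apply/matrixP => i j; rewrite !mxE -hB.
have hE m (w : 'I_m -> T) k : negsub (fun i j => B (w i) (w j)) k <->
    (k <= sgn_eigen 1 (\matrix_(i < m, j < m) B (w i) (w j)))%N.
  rewrite -leq_sgn_eigen ?real1 //.
  suff -> : (fun i j => 1 * (\matrix_(i < m, j < m) B (w i) (w j)) i j) =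
     (fun i j => B (w i) (w j)) by [].
  by apply/funext => i; apply/funext => j; rewrite mxE mul1r.
split=> [h|[h1 [m [w [wA wN]]]] k].
- have h1 m (w : 'I_m -> T) : (forall i, A (w i)) ->
     (sgn_eigen 1 (\matrix_(i < m, j < m) B (w i) (w j)) <= N)%N.
    move=> wA; apply/h; exists ('I_m : finType), w; split=> //.
    exact/hE.
  split=> //; have [_ /(_ (leqnn N))] := h N.
  move=> [I [w [wA hw]]]; exists #|I|, (w \o enum_val); split=> [i|].
    exact: wA.
  apply/eqP; rewrite eqn_leq h1 /=; last by move=> i; apply: wA.
  apply/(hE #|I| (w \o enum_val)).
  apply: (@negsub_map _ _ _ enum_rank).
  suff -> : (fun a b => B ((w \o enum_val) (enum_rank a)) ((w \o enum_val) (enum_rank b)))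
    = (fun a b => B (w a) (w b)) by [].
  by apply/funext => a; apply/funext => b; rewrite /= !enum_rankK.
- split=> [[I [v [vA hv]]]|kN].
    apply: leq_trans (h1 #|I| (v \o enum_val) _); last by move=> i; apply: vA.
    apply/(hE #|I| (v \o enum_val)).
    apply: (@negsub_map _ _ _ enum_rank).
    suff -> : (fun a b => B ((v \o enum_val) (enum_rank a)) ((v \o enum_val) (enum_rank b)))
      = (fun a b => B (v a) (v b)) by [].
    by apply/funext => a; apply/funext => b; rewrite /= !enum_rankK.
  by exists ('I_m : finType), w; split=> //; apply/hE; rewrite wN.
Qed.

Lemma sgn_eigenN n (A : 'M[C]_n) : A ^t* = A ->
  sgn_eigen (-1) A = sgn_eigen 1 (- A).
Proof.
move=> hA; have hNA : (- A) ^t* = - A.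
  by apply/matrixP => i j; rewrite !mxE rmorphN -[in RHS]hA !mxE.
have e : (fun i j => 1 * (- A) i j) = (fun i j => -1 * A i j).
  by apply/funext => i; apply/funext => j; rewrite mxE mul1r mulN1r.
apply/eqP; rewrite eqn_leq; apply/andP; split.
  by apply/leq_sgn_eigen; rewrite ?real1 // e; apply/leq_sgn_eigen; rewrite ?realN ?real1.
by apply/leq_sgn_eigen; rewrite ?realN ?real1 // -e; apply/leq_sgn_eigen; rewrite ?real1.
Qed.

Lemma negative_squaresE (A : set C) (K : C -> C -> C) N : herm_kernel K ->
  negative_squares A K N <-> forall k, negsq A (fun s t => K t s) k <-> (k <= N)%N.
Proof.
move=> hK; have hB : herm_kernel (fun s t => K t s) by move=> a b; rewrite -hK.
rewrite negsq_squares // /negative_squares /gram.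
split=> -[h1 [m [w [h2 h3]]]]; split.
- by move=> m' w' h'; rewrite -neg_eigenE; apply: h1.
- by exists m, w; split=> //; rewrite -neg_eigenE.
- by move=> m' w' h'; rewrite neg_eigenE; apply: h1.
- by exists m, w; split=> //; rewrite neg_eigenE.
Qed.

Lemma positive_squaresE (A : set C) (K : C -> C -> C) N : herm_kernel K ->
  positive_squares A K N <-> forall k, negsq A (fun s t => - K t s) k <-> (k <= N)%N.
Proof.
move=> hK; have hB : herm_kernel (fun s t => - K t s) by move=> a b; rewrite hK rmorphN.
have e m (w : 'I_m -> C) : pos_eigen (gram K w) =
   sgn_eigen 1 (\matrix_(i < m, j < m) - K (w j) (w i)).
  rewrite pos_eigenE sgn_eigenN; last first.
    by apply/matrixP => i j; rewrite !mxE -hK.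
  by congr sgn_eigen; apply/matrixP => i j; rewrite !mxE.
rewrite negsq_squares // /positive_squares.
split=> -[h1 [m [w [h2 h3]]]]; split.
- by move=> m' w' h'; rewrite -e; apply: h1.
- by exists m, w; split=> //; rewrite -e.
- by move=> m' w' h'; rewrite e; apply: h1.
- by exists m, w; split=> //; rewrite e.
Qed.

Lemma schur_kernel_hermitian (S : C -> C) : herm_kernel (schur_kernel S).
Proof.
move=> w z; rewrite /schur_kernel rmorphM fmorphV !rmorphB !rmorphM !rmorph1 /= !conjCK.
by rewrite [S w * _]mulrC [w * _]mulrC.
Qed.

(** On the natural numbers it suffices to look at the leading sections of the
    kernel: every finite set of indices is contained in all large sections. *)
Lemma eventually_sgn_eigen (B : nat -> nat -> C) N : herm_kernel B ->
  (exists r0, forall r, (r0 <= r)%N ->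
     sgn_eigen 1 (\matrix_(i < r, j < r) B i j) = N)
  <-> forall k, negsq setT B k <-> (k <= N)%N.
Proof.
move=> hB.
have hE m k : negsub (fun i j : 'I_m => B i j) k <->
    (k <= sgn_eigen 1 (\matrix_(i < m, j < m) B i j))%N.
  rewrite -leq_sgn_eigen ?real1 //; last first.
    by apply/matrixP => i j; rewrite !mxE -hB.
  suff -> : (fun i j => 1 * (\matrix_(i < m, j < m) B i j) i j) =
     (fun i j : 'I_m => B i j) by [].
  by apply/funext => i; apply/funext => j; rewrite mxE mul1r.
have push (I : finType) (w : I -> nat) k r : (\max_a w a < r)%N ->
    negsub (fun a b => B (w a) (w b)) k -> negsub (fun i j : 'I_r => B i j) k.
  move=> hr; have wr a : (w a < r)%N by apply: leq_ltn_trans hr; apply: leq_bigmax.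
  exact: (@negsub_map _ _ _ (fun a => Ordinal (wr a))).
split=> [[r0 h] k|h].
  split=> [[I [w [_ hw]]]|kN].
    rewrite -(h (maxn r0 (\max_a w a).+1)) ?leq_maxl //.
    by apply/hE; apply: push hw; rewrite leq_max ltnSn orbT.
  exists ('I_r0 : finType), (fun i => val i); split=> //.
  by apply/hE; rewrite h.
have [_ /(_ (leqnn N)) [I [w [_ hw]]]] := h N.
exists (\max_a w a).+1 => r hr; apply/eqP; rewrite eqn_leq; apply/andP; split.
  apply/h; exists ('I_r : finType), (fun i => val i); split=> //.
  exact/hE.
by apply/hE; apply: push hw.
Qed.

End Squares.

(** * Toeplitz matrices and the kernel of Taylor coefficients *)

(** This is used to solve, for one sequence or for the other, the relation
    between moments and Taylor coefficients, in which each term depends on all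
    earlier ones. *)
Lemma course_of_values (C : Type) (x0 : C) (F : nat -> (nat -> C) -> C) :
  (forall n f g, (forall k, (k < n)%N -> f k = g k) -> F n f = F n g) ->
  exists f, forall n, f n = F n f.
Proof.
move=> hF.
pose g := fix g n := if n is m.+1 then fun k => if k == m then F m (g m) else g m k
  else fun=> x0.
have gS m k : (k < m)%N -> g m k = g k.+1 k.
  elim: m => // m IH; rewrite ltnS leq_eqVlt => /orP[/eqP -> //|km].
  by rewrite -IH //= ltn_eqF.
exists (fun n => g n.+1 n) => n; rewrite /= eqxx; apply: hF => k kn.
by rewrite (gS n k kn).
Qed.

Section Toeplitz.
Variable C : numClosedFieldType.

(** The coefficient of z^i conj(w)^j in (1 - S(z) conj S(w)) / (1 - z conj w)
    for S(z) = sum_j a_j z^j: the factor 1 / (1 - z conj w) spreads each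
    coefficient of the numerator along its diagonal. *)
Definition jet_kernel (a : nat -> C) (i j : nat) : C :=
  (i == j)%:R - \sum_(l < (minn i j).+1) a (i - l)%N * (a (j - l)%N)^*.

Lemma jet_kernel_herm a : herm_kernel (jet_kernel a).
Proof.
move=> i j; rewrite /jet_kernel rmorphB rmorph_nat rmorph_sum eq_sym minnC.
congr (_ - _); apply: eq_bigr => l _.
by rewrite rmorphM /= conjCK mulrC.
Qed.

Definition lower_toeplitz r (f : nat -> C) : 'M[C]_r :=
  \matrix_(i < r, j < r) if (j <= i)%N then f (i - j)%N else 0.

(** Multiplication of triangular Toeplitz matrices is multiplication of power
    series; inverse series give inverse matrices. *)
Lemma lower_toeplitz_mul1 r (f g : nat -> C) :
  (forall n, \sum_(k < n.+1) f (n - k)%N * g k = (n == 0%N)%:R) ->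
  lower_toeplitz r f *m lower_toeplitz r g = 1%:M.
Proof.
move=> h; apply/matrixP => i j; rewrite !mxE.
under eq_bigr do rewrite !mxE.
have [ji|ij] := leqP j i; last first.
  rewrite big1 => [|k _]; first by rewrite -val_eqE /= ltn_eqF.
  case: leqP => ki; last by rewrite mul0r.
  by case: leqP => jk; [lia|rewrite mulr0].
have := h (i - j)%N; rewrite subn_eq0 -[(i <= j)%N]andbT -{2}ji -eqn_leq val_eqE => <-.
rewrite (bigID (fun k : 'I_r => (k < i.+1)%N)) /= [X in _ + X]big1 ?addr0; last first.
  by move=> k; rewrite ltnS => /negbTE ->; rewrite mul0r.
rewrite (big_ord_narrow (ltn_ord i)) /=.
rewrite -(big_mkord xpredT (fun k => (if (k <= i)%N then f (i - k)%N else 0) *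
   (if (j <= k)%N then g (k - j)%N else 0))).
rewrite (@big_cat_nat _ _ _ j) //=; last by lia.
rewrite big1_seq ?add0r; last first.
  by move=> k; rewrite mem_index_iota => /= hk; rewrite [(j <= k)%N]leqNgt; case: ltnP; [rewrite mulr0|lia].
rewrite -{1}(add0n (j : nat)) big_addn big_mkord subSn //.
apply: eq_bigr => k _.
have -> : (k + j <= i)%N by have := ltn_ord k; lia.
by rewrite leq_addl addnK subnDA subnAC.
Qed.

(** A 1 by 1 identity block contributes exactly one eigenvalue, which is
    positive; this is where the difference between pi and pi + 1 comes from.
    *)
Lemma eigenvalues_block r (J : 'M[C]_r) :
  perm_eq (eigenvalues (block_mx 1%:M 0 0 J : 'M[C]_(1 + r))) (1 :: eigenvalues J).
Proof.
rewrite /eigenvalues; case: closed_field_poly_normal => /= s hs.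
case: closed_field_poly_normal => /= t ht.
move: hs ht; rewrite !(monicP (char_poly_monic _)) !scale1r => hs ht.
apply/prod_XsubC_eq; rewrite -hs big_cons -ht.
have -> : 'X - 1%:P = char_poly (1%:M : 'M[C]_1).
  by rewrite /char_poly /char_poly_mx det_mx11 !mxE eqxx.
rewrite /char_poly -(det_ublock _ 0); congr (\det _).
by rewrite /char_poly_mx map_block_mx !map_mx0 scalar_mx_block opp_block_mx add_block_mx !oppr0 !addr0.
Qed.

Section Congruence.
Variables (a c : nat -> C).
Hypothesis c0 : c 0%N = 1.
Hypothesis cS : forall k, c k.+1 = \sum_(j < k.+1) c j * a (k - j)%N.

Let p k : C := if k is k'.+1 then - a k' else 1.
Let b k : C := if k is k'.+1 then a k' else 0.

(** With p the coefficients of 1 - z S(z), the recursion defining c says that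
    the product of the two series is 1. *)
Lemma conv_p_c n : \sum_(k < n.+1) p (n - k)%N * c k = (n == 0%N)%:R.
Proof.
case: n => [|n]; first by rewrite big_ord_recr big_ord0 /= add0r c0 mulr1.
rewrite big_ord_recr /= subnn mul1r cS -big_split big1 //= => k _.
by rewrite subSn ?leq_ord //= mulNr mulrC addNr.
Qed.

(** Write L for the triangular Toeplitz matrix of c, so that the Hermitian
    matrix is L + L^* - 1, and P for the inverse of L. Then P (L + L^* - 1)
    P^* = P^* + P - P P^* = 1 - (1 - P) (1 - P)^*, and 1 - P is the triangular
    Toeplitz matrix of z S(z). As this series has no constant term, the first
    row of 1 - P vanishes, which splits off the block of order 1. *)
Lemma toeplitz_congruence r : exists2 P : 'M[C]_r.+1, P \in unitmx &
  P *m toeplitz c r *m P^t* =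
   (block_mx 1%:M 0 0 (\matrix_(i < r, j < r) jet_kernel a i j) : 'M[C]_(1 + r)).
Proof.
pose P := lower_toeplitz r.+1 p; pose L := lower_toeplitz r.+1 c.
have PL : P *m L = 1%:M := lower_toeplitz_mul1 r.+1 conv_p_c.
exists P; first by case/mulmx1_unit: PL.
have -> : toeplitz c r = L + L^t* - 1%:M.
  apply/matrixP => i j; rewrite !mxE -[i == j]val_eqE /=.
  case: (ltngtP j i) => ij; rewrite ?ij ?subnn ?c0 ?conjC0 ?conjC1 ?subr0 ?addr0 ?add0r //.
  by rewrite addrK.
have PL' : L^t* *m P^t* = 1%:M.
  by rewrite -map_mxM -trmx_mul PL trmx1 map_mx1.
rewrite mulmxBr mulmxDr PL mulmx1 mulmxBl mulmxDl mul1mx -mulmxA PL' mulmx1.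
have -> : P^t* + P - P *m P^t* = 1%:M - (1%:M - P) *m (1%:M - P)^t*.
  rewrite linearB /= map_mxB trmx1 map_mx1 mulmxBr mulmx1 mulmxBl mul1mx.
  set Q := P *m P^t*; set P' := P^t*.
  apply/matrixP => i j; rewrite !mxE; move: (P' i j) (P i j) (Q i j) => x y z.
  by ring.
have -> : 1%:M - P = lower_toeplitz r.+1 b.
  apply/matrixP => i j; rewrite !mxE -val_eqE /=.
  case: (ltngtP i j) => ij; rewrite ?subnn ?subrr ?oppr0 ?addr0 //.
    have : (0 < i - j)%N by rewrite subn_gt0.
    by case: (i - j)%N => // d _; rewrite /= opprK add0r.
  by rewrite (val_inj ij) subnn subrr.
set E := 1%:M - _.
have hE (i j : 'I_r.+1) : E i j =
    (i == j)%:R - \sum_(l < (minn i j).+1) b (i - l)%N * (b (j - l)%N)^*.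
  rewrite !mxE; congr (_ - _); rewrite (big_ord_widen r.+1 (fun l => b (i - l)%N * (b (j - l)%N)^* )); last first.
    by have := ltn_ord i; have := ltn_ord j; lia.
  rewrite [RHS]big_mkcond /=; apply: eq_bigr => l _; rewrite !mxE ltnS leq_min.
  by case: leqP => li; case: leqP => lj; rewrite ?(mul0r, conjC0, mulr0).
apply/(@matrixP C (1 + r) (1 + r)) => i j.
case: (split_ordP (i : 'I_(1 + r))) => i' ->; case: (split_ordP (j : 'I_(1 + r))) => j' ->.
- by rewrite block_mxEul hE !ord1 /= big_ord_recr big_ord0 /= mul0r !addr0 subr0 mxE.
- by rewrite block_mxEur hE !ord1 /= big_ord_recr big_ord0 /= mul0r !addr0 subr0 mxE.
- by rewrite block_mxEdl hE !ord1 /= big_ord_recr big_ord0 /= conjC0 mulr0 !addr0 subr0 mxE.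
rewrite block_mxEdr hE mxE /jet_kernel -!val_eqE /= !add1n eqSS minnSS; congr (_ - _).
rewrite big_ord_recr /= [X in _ + X](_ : _ = 0) ?addr0; last first.
  by rewrite /minn; case: ltnP => _; rewrite subnn /= ?conjC0 ?mul0r ?mulr0.
apply: eq_bigr => l _.
by rewrite !subSn //; have := ltn_ord l; lia.
Qed.

End Congruence.

(** A negative definite subspace for P A P^* is carried by P to one for A. *)
Lemma sgn_eigen_congr_le n (A P : 'M[C]_n) s : A^t* = A -> s \is Num.real ->
  (sgn_eigen s (P *m A *m P^t* ) <= sgn_eigen s A)%N.
Proof.
move=> hA hs.
have hB : (P *m A *m P^t* )^t* = P *m A *m P^t*.
  by rewrite !trmx_mul !map_mxM trmxCK hA mulmxA.
apply/(leq_sgn_eigen _ hA hs).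
have /(leq_sgn_eigen _ hB hs)[W hW] := leqnn (sgn_eigen s (P *m A *m P^t* )).
have e n' (D : 'M[C]_n') u v : hform (fun i j => s * D i j) u v =
   s * ((\row_i u i) *m D *m (\row_i v i)^t* ) 0 0.
  rewrite mxE mulr_sumr /hform exchange_big /=; apply: eq_bigr => j _.
  rewrite !mxE mulr_suml mulr_sumr; apply: eq_bigr => i _.
  by rewrite mxE; ring.
exists (fun p j => \sum_i W p i * P i j) => x x0 /=.
have := hW x x0; rewrite /= !e.
set U := \row_i _; set V := \row_i _.
have -> : V = U *m P.
  apply/rowP => j; rewrite !mxE.
  under eq_bigr do rewrite mulr_sumr.
  rewrite exchange_big /=; apply: eq_bigr => i _.
  by rewrite mxE mulr_suml; apply: eq_bigr => q _; rewrite mulrA.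
by rewrite trmx_mul map_mxM !mulmxA.
Qed.

(** Sylvester's law of inertia. *)
Lemma sgn_eigen_congr n (A P : 'M[C]_n) s : A^t* = A -> s \is Num.real ->
  P \in unitmx -> sgn_eigen s (P *m A *m P^t* ) = sgn_eigen s A.
Proof.
move=> hA hs uP; apply/eqP; rewrite eqn_leq sgn_eigen_congr_le //=.
have hB : (P *m A *m P^t* )^t* = P *m A *m P^t*.
  by rewrite !trmx_mul !map_mxM trmxCK hA mulmxA.
rewrite -[in X in (X <= _)%N](_ : invmx P *m (P *m A *m P^t* ) *m (invmx P)^t* = A).
  exact: sgn_eigen_congr_le.
have e : P^t* *m (invmx P)^t* = 1%:M.
  by rewrite -map_mxM -trmx_mul mulVmx // trmx1 map_mx1.
by rewrite !mulmxA mulVmx // mul1mx -mulmxA e mulmx1.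
Qed.

Section Inertia.
Variables (a c : nat -> C).
Hypothesis c0 : c 0%N = 1.
Hypothesis cS : forall k, c k.+1 = \sum_(j < k.+1) c j * a (k - j)%N.

Lemma sgn_eigen_toeplitz s r : s \is Num.real -> sgn_eigen s (toeplitz c r) =
  ((s * 1 < 0)%R + sgn_eigen s (\matrix_(i < r, j < r) jet_kernel a i j))%N.
Proof.
move=> hs; have [P uP e] := toeplitz_congruence c0 cS r.
have hT : (toeplitz c r)^t* = toeplitz c r.
  apply/matrixP => i j; rewrite !mxE.
  case: (ltngtP j i) => ij; rewrite ?ij ?conjCK //.
  by rewrite subnn c0 conjC1.
rewrite -(sgn_eigen_congr hT hs uP) e /sgn_eigen.
by rewrite (permP (eigenvalues_block _)).
Qed.

Lemma P_kappaE N : P_kappa N c <->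
  forall k, negsq setT (jet_kernel a) k <-> (k <= N)%N.
Proof.
rewrite -(eventually_sgn_eigen _ (jet_kernel_herm a)) /P_kappa c0 conjC1.
have e r : neg_eigen (toeplitz c r) =
     sgn_eigen 1 (\matrix_(i < r, j < r) jet_kernel a i j).
  by rewrite neg_eigenE sgn_eigen_toeplitz ?real1 // mulr1 ltr10.
by split=> [[_ [r0 h]]|[r0 h]]; [|split=> //]; exists r0 => r hr; have := h r hr; rewrite e.
Qed.

Lemma P_nu_piE nu pi : P_nu_pi nu pi.+1 c <->
  (forall k, negsq setT (jet_kernel a) k <-> (k <= nu)%N) /\
  (forall k, negsq setT (fun i j => - jet_kernel a i j) k <-> (k <= pi)%N).
Proof.
have hN : herm_kernel (fun i j => - jet_kernel a i j).
  by move=> i j; rewrite jet_kernel_herm rmorphN.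
rewrite -(eventually_sgn_eigen _ (jet_kernel_herm a)) -(eventually_sgn_eigen _ hN).
rewrite /P_nu_pi c0 conjC1.
have e r : neg_eigen (toeplitz c r) =
     sgn_eigen 1 (\matrix_(i < r, j < r) jet_kernel a i j).
  by rewrite neg_eigenE sgn_eigen_toeplitz ?real1 // mulr1 ltr10.
have e' r : pos_eigen (toeplitz c r) =
     (sgn_eigen 1 (\matrix_(i < r, j < r) - jet_kernel a i j)).+1.
  rewrite pos_eigenE sgn_eigen_toeplitz ?realN ?real1 // mulN1r ltrN10 add1n sgn_eigenN.
    by congr (sgn_eigen _ _).+1; apply/matrixP => i j; rewrite !mxE.
  by apply/matrixP => i j; rewrite !mxE -jet_kernel_herm.
split=> [[_ [r0 h]]|[[r0 h] [r1 h']]].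
  split; exists r0 => r hr; have [] := h r hr; first by rewrite e.
  by rewrite e' => _ [].
split=> //; exists (maxn r0 r1) => r; rewrite geq_max => /andP[h0 h1].
by rewrite e e' h ?h'.
Qed.

End Inertia.

End Toeplitz.

Local Close Scope sesquilinear_scope.
Import numFieldNormedType.Exports.
Local Open Scope classical_set_scope.
Local Open Scope ring_scope.

(** * Limits and series in the complex plane *)

(** All that the analysis below uses of the complex numbers: an algebraically
    closed field with conjugation whose absolute value takes values in a copy
    of R. The projection [nc] is the absolute value as an element of R. *)
Record complex_plane (R : realType) := ComplexPlane {
  plane_field :> numClosedFieldType;
  rinj : {rmorphism R -> plane_field};
  nc : plane_field -> R;
  normE : forall z, `|z| = rinj (nc z);
  rinj_ge0_imp : forall x, 0 <= x -> 0 <= rinj x }.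
Arguments rinj {R c}.
Arguments nc {R c}.

Section ComplexLimits.
Variables (R : realType) (C : complex_plane R).
Implicit Types (z w : C) (u v : nat -> C).

Lemma rinj_ge0 (x : R) : (0 <= rinj x :> C) = (0 <= x).
Proof.
apply/idP/idP => [h|]; last exact: rinj_ge0_imp.
have [//|x0] := lerP 0 x.
have h' : 0 <= - rinj x :> C by rewrite -rmorphN rinj_ge0_imp // oppr_ge0 ltW.
have /eqP : (rinj x : C) == 0 by rewrite eq_le h andbT -oppr_ge0.
by move=> /eqP; rewrite fmorph_eq0 => /eqP x00; rewrite x00 ltxx in x0.
Qed.
Lemma ler_rinj (x y : R) : (rinj x <= rinj y :> C) = (x <= y).
Proof. by rewrite -subr_ge0 -rmorphB rinj_ge0 subr_ge0. Qed.
Lemma ltr_rinj (x y : R) : (rinj x < rinj y :> C) = (x < y).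
Proof. by rewrite !lt_neqAle ler_rinj (inj_eq (fmorph_inj rinj)). Qed.
Lemma ltc0_real (e : R) : (0 < rinj e :> C) = (0 < e).
Proof. by rewrite -(rmorph0 (@rinj R C)) ltr_rinj. Qed.

Lemma nc_ge0 z : 0 <= nc z.
Proof. by rewrite -rinj_ge0 -normE. Qed.

Lemma pos_realc (e : C) : 0 < e -> exists2 r : R, 0 < r & e = rinj r.
Proof.
move=> e0; have E : e = rinj (nc e) by rewrite -normE gtr0_norm.
by exists (nc e) => //; rewrite -ltc0_real -E.
Qed.

Lemma cvgcP u (l : C) : u @ \oo --> l <->
  forall e : R, 0 < e -> exists N, forall n, (N <= n)%N -> nc (u n - l) < e.
Proof.
split.
  move=> /(@cvgrPdistC_lt C C^o) h e e0.
  have := h (rinj e); rewrite ltc0_real => /(_ e0)[N _ hN].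
  by exists N => n hn; have := hN n hn; rewrite /= normE ltr_rinj.
move=> h; apply/(@cvgrPdistC_lt C C^o) => e /pos_realc[r r0 ->].
have [N hN] := h r r0; exists N => // n hn /=.
by rewrite normE ltr_rinj; apply: hN.
Qed.

Lemma nc_eq z w : (nc z == nc w) = (`|z| == `|w|).
Proof. by rewrite !normE (inj_eq (fmorph_inj rinj)). Qed.
Lemma nc_inj_norm z (x : R) : `|z| = rinj x -> nc z = x.
Proof. by move=> h; apply: (fmorph_inj (@rinj R C)); rewrite -normE. Qed.
Lemma nc0 : nc (0 : C) = 0.
Proof. by apply: nc_inj_norm; rewrite normr0 rmorph0. Qed.
Lemma nc1 : nc (1 : C) = 1.
Proof. by apply: nc_inj_norm; rewrite normr1 rmorph1. Qed.
Lemma ncM z w : nc (z * w) = nc z * nc w.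
Proof. by apply: nc_inj_norm; rewrite normrM rmorphM !normE. Qed.
Lemma ncV z : nc z^-1 = (nc z)^-1.
Proof. by apply: nc_inj_norm; rewrite normfV fmorphV normE. Qed.
Lemma ncN z : nc (- z) = nc z.
Proof. by apply: nc_inj_norm; rewrite normrN normE. Qed.
Lemma ler_ncD z w : nc (z + w) <= nc z + nc w.
Proof. by rewrite -(@ler_rinj _) rmorphD /= -!normE ler_normD. Qed.
Lemma ler_ncB z w : nc (z - w) <= nc z + nc w. Proof. by rewrite -(ncN w) ler_ncD. Qed.
Lemma nc_eq0 z : (nc z == 0) = (z == 0).
Proof. by rewrite -nc0 nc_eq normr0 normr_eq0. Qed.
Lemma nc_gt0 z : (0 < nc z) = (z != 0).
Proof. by rewrite lt_neqAle nc_ge0 andbT eq_sym nc_eq0. Qed.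
Lemma ncX z n : nc (z ^+ n) = nc z ^+ n.
Proof. by elim: n => [|n IH]; rewrite ?expr0 ?nc1 // !exprS ncM IH. Qed.
Lemma rinj_norm (x : R) : `|rinj x : C| = rinj `|x|.
Proof.
have [x0|x0] := lerP 0 x; first by rewrite !ger0_norm ?rinj_ge0.
have h : rinj x < 0 :> C by rewrite -(rmorph0 (@rinj R C)) ltr_rinj.
by rewrite (ltr0_norm h) (ltr0_norm x0) rmorphN.
Qed.
Lemma nc_real (x : R) : nc (rinj x : C) = `|x|.
Proof. by apply: nc_inj_norm; rewrite rinj_norm. Qed.
Lemma nc_conj z : nc (z^* ) = nc z.
Proof. by apply: nc_inj_norm; rewrite norm_conjC normE. Qed.
Lemma nc_sym z w : nc (z - w) = nc (w - z).
Proof. by rewrite -ncN opprB. Qed.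
Lemma nc_nat n : nc (n%:R : C) = n%:R.
Proof. by rewrite -(rmorph_nat (@rinj R C)) nc_real ger0_norm. Qed.
Lemma nc_sum (I : Type) (r : seq I) (P : pred I) (F : I -> C) :
  nc (\sum_(i <- r | P i) F i) <= \sum_(i <- r | P i) nc (F i).
Proof.
elim/big_rec2: _ => [|i x y _ h]; first by rewrite nc0.
by apply: le_trans (ler_ncD _ _) _; rewrite lerD2l.
Qed.
Lemma lt_norm_nc z (r : R) : (`|z| < rinj r) = (nc z < r).
Proof. by rewrite normE ltr_rinj. Qed.
Lemma norm_lt1_nc z : (`|z| < 1) = (nc z < 1).
Proof. by rewrite -(rmorph1 (@rinj R C)) lt_norm_nc. Qed.
Lemma ler_ncD_sub z w : nc z - nc w <= nc (z - w).
Proof. by rewrite lerBlDr; apply: le_trans (ler_ncD _ _); rewrite subrK. Qed.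
Lemma mul_conj_nc z : z * z^* = rinj ((nc z) ^+ 2).
Proof. by rewrite -normCK normE rmorphXn. Qed.

Lemma cvgcD u v (l m : C) : u @ \oo --> l -> v @ \oo --> m ->
  (fun n => u n + v n) @ \oo --> l + m.
Proof. by move=> h1 h2; apply: (@cvgD C C^o); [exact: h1|exact: h2]. Qed.
Lemma cvgcB u v (l m : C) : u @ \oo --> l -> v @ \oo --> m ->
  (fun n => u n - v n) @ \oo --> l - m.
Proof. by move=> h1 h2; apply: (@cvgB C C^o); [exact: h1|exact: h2]. Qed.
Lemma cvgcM u v (l m : C) : u @ \oo --> l -> v @ \oo --> m ->
  (fun n => u n * v n) @ \oo --> l * m.
Proof. by move=> h1 h2; exact: (@cvgM C nat \oo _ u v l m h1 h2). Qed.
Lemma cvgc_cst (l : C) : (fun=> l : C) @ \oo --> l.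
Proof. by apply/cvgcP => e e0; exists 0%N => n _; rewrite subrr nc0. Qed.
Lemma cvgc_sum (I : Type) (r : seq I) (u : I -> nat -> C) (l : I -> C) :
  (forall i, u i @ \oo --> l i) ->
  (fun n => \sum_(i <- r) u i n) @ \oo --> \sum_(i <- r) l i.
Proof.
move=> h; elim: r => [|i r IH].
  by rewrite big_nil; under eq_fun do rewrite big_nil; exact: cvgc_cst.
rewrite big_cons; under eq_fun do rewrite big_cons.
exact: (cvgcD (u := u i) (v := fun n => \sum_(j <- r) u j n)).
Qed.
Lemma cvgc_conj u (l : C) : u @ \oo --> l -> (fun n => (u n)^* ) @ \oo --> l^*.
Proof.
move=> /cvgcP h; apply: (cvgcP (fun n => (u n)^* ) _).2 => e e0; have [N hN] := h e e0.
by exists N => n hn; have := hN n hn; rewrite -nc_conj rmorphB.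
Qed.
Lemma cvgc_unique u (l m : C) : u @ \oo --> l -> u @ \oo --> m -> l = m.
Proof.
move=> /cvgcP h /cvgcP h'; apply/eqP; rewrite -subr_eq0 -nc_eq0 -[_ == 0]negbK.
apply/negP; rewrite -[_ != _]andbT -(nc_ge0 (l - m)) -lt_def => p.
have p2 : 0 < nc (l - m) / 2 by lra.
have [N hN] := h _ p2; have [M hM] := h' _ p2.
have /= := hN (maxn N M); rewrite leq_maxl => /(_ isT) a.
have /= := hM (maxn N M); rewrite leq_maxr => /(_ isT) b.
have := ler_ncB (u (maxn N M) - m) (u (maxn N M) - l).
by rewrite opprB addrC addrA subrK; lra.
Qed.
Lemma cvgc_near u v (l : C) n0 : (forall n, (n0 <= n)%N -> u n = v n) ->
  u @ \oo --> l -> v @ \oo --> l.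
Proof.
move=> h /cvgcP hu; apply/cvgcP => e e0; have [N hN] := hu e e0.
exists (maxn n0 N) => n; rewrite geq_max => /andP[a b].
by rewrite -h //; apply: hN.
Qed.
Lemma cvgc_le u (l : C) (M : R) : u @ \oo --> l -> (forall n, nc (u n) <= M) ->
  nc l <= M.
Proof.
move=> /cvgcP h hM; rewrite leNgt; apply/negP => lt.
have p : 0 < nc l - M by lra.
have [N hN] := h _ p; have := hN N (leqnn N); have := hM N.
by have := ler_ncD_sub l (u N); rewrite nc_sym; lra.
Qed.
Lemma cvgc_shift u (l : C) k : u @ \oo --> l -> (fun n => u (n + k)%N) @ \oo --> l.
Proof.
move=> /cvgcP h; apply/cvgcP => e e0; have [N hN] := h e e0.
by exists N => n hn; apply: hN; rewrite (leq_trans hn) ?leq_addr.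
Qed.

Lemma geometric_small (K q e : R) : 0 <= q < 1 -> 0 < e ->
  exists N, forall n, (N <= n)%N -> K * q ^+ n < e.
Proof.
move=> /andP[q0 q1] e0.
have [K0|K0] := lerP K 0.
  by exists 0%N => n _; apply: le_lt_trans e0; rewrite mulr_le0_ge0 ?exprn_ge0.
have : `|q| < 1 by rewrite ger0_norm.
move=> /(@cvg_expr R) /(@cvgrPdistC_lt _ R^o) /(_ (e / K)).
rewrite divr_gt0 // => /(_ isT)[N _ hN]; exists N => n hn.
have := hN n hn; rewrite /= subr0 normrX ger0_norm // ltr_pdivlMr //.
by rewrite mulrC.
Qed.

Lemma cvgc_geometric (K q : R) u (l : C) : 0 <= q < 1 ->
  (forall n, nc (u n - l) <= K * q ^+ n) -> u @ \oo --> l.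
Proof.
move=> hq h; apply/cvgcP => e e0; have [N hN] := geometric_small K hq e0.
by exists N => n hn; apply: le_lt_trans (h n) _; apply: hN.
Qed.

Lemma cvgr_cauchy (u : nat -> R) :
  (forall e : R, 0 < e -> exists N, forall n, (N <= n)%N -> `|u n - u N| < e) ->
  exists l : R, forall e : R, 0 < e -> exists N, forall n, (N <= n)%N -> `|u n - l| < e.
Proof.
move=> h.
have /cauchy_cvg/cvg_ex[l hl] : cauchy (u @ \oo).
  apply: cauchy_exP => e e0; have [N hN] := h e e0; exists (u N).
  by exists N => // n hn /=; rewrite /ball /= distrC; apply: hN.
exists l => e e0; move: hl => /(@cvgrPdistC_lt _ R^o) /(_ e e0)[N _ hN].
by exists N => n; apply: hN.
Qed.

(** The real part as an element of R; it is recovered from the absolute value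
    and the sign of the real part taken in the field. *)
Definition real_part z : R := if 0 <= 'Re z then nc ('Re z) else - nc ('Re z).
Definition imag_part z : R := real_part (- 'i * z).
Lemma real_partE z : rinj (real_part z) = 'Re z.
Proof.
rewrite /real_part; have [h|h] := boolP (0 <= 'Re z).
  by rewrite -normE ger0_norm.
rewrite rmorphN -normE ltr0_norm ?opprK //.
by move: h; rewrite -real_ltNge // ?Creal_Re.
Qed.
Lemma imag_partE z : rinj (imag_part z) = 'Im z.
Proof.
by rewrite /imag_part real_partE mulNr -[- _]mulN1r ReMl ?realN ?real1 // ReMil mulN1r opprK.
Qed.
Lemma real_partB z w : real_part (z - w) = real_part z - real_part w.
Proof. by apply: (fmorph_inj (@rinj R C)); rewrite rmorphB /= !real_partE raddfB. Qed.
Lemma imag_partB z w : imag_part (z - w) = imag_part z - imag_part w.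
Proof. by rewrite /imag_part mulrBr real_partB. Qed.
Lemma Re_le_nc z : `|real_part z| <= nc z.
Proof.
by rewrite -(@ler_rinj _) -rinj_norm real_partE -normE; apply: leif_normC_Re_Creal.
Qed.
Lemma Im_le_nc z : `|imag_part z| <= nc z.
Proof.
apply: le_trans (Re_le_nc _) _; rewrite ncM ncN (_ : nc 'i = 1) ?mul1r //.
by apply: nc_inj_norm; rewrite normCi rmorph1.
Qed.

(** Completeness is inherited from the real numbers through real and imaginary
    parts. *)
Lemma cvgc_cauchy u :
  (forall e : R, 0 < e -> exists N, forall n, (N <= n)%N -> nc (u n - u N) < e) ->
  exists l : C, u @ \oo --> l.
Proof.
move=> h.
have [x hx] : exists l : R, forall e : R, 0 < e -> exists N, forall n, (N <= n)%N ->
    `|real_part (u n) - l| < e.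
  apply: cvgr_cauchy => e /h[N hN]; exists N => n /hN.
  by apply: le_lt_trans; rewrite -real_partB; apply: Re_le_nc.
have [y hy] : exists l : R, forall e : R, 0 < e -> exists N, forall n, (N <= n)%N ->
    `|imag_part (u n) - l| < e.
  apply: cvgr_cauchy => e /h[N hN]; exists N => n /hN.
  by apply: le_lt_trans; rewrite -imag_partB; apply: Im_le_nc.
exists (rinj x + 'i * rinj y); apply/cvgcP => e e0.
have e2 : 0 < e / 2 by lra.
have [N hN] := hx _ e2; have [M hM] := hy _ e2.
exists (maxn N M) => n; rewrite geq_max => /andP[/hN a /hM b].
have -> : u n - (rinj x + 'i * rinj y) =
   rinj (real_part (u n) - x) + 'i * rinj (imag_part (u n) - y).
  by rewrite {1}[u n]Crect !rmorphB /= real_partE imag_partE; ring.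
apply: le_lt_trans (ler_ncD _ _) _; rewrite ncM !nc_real (_ : nc 'i = 1) ?mul1r; first by lra.
by apply: nc_inj_norm; rewrite normCi rmorph1.
Qed.

Definition has_sum (f : nat -> C) (s : C) := (fun n => \sum_(i < n) f i) @ \oo --> s.

Lemma sum_geometric_le (q : R) n : 0 <= q < 1 -> \sum_(i < n) q ^+ i <= (1 - q)^-1.
Proof.
move=> /andP[q0 q1]; have h : 0 < 1 - q by lra.
rewrite -[leRHS]mul1r ler_pdivlMr // mulrC.
have -> : (1 - q) * (\sum_(i < n) q ^+ i) = 1 - q ^+ n.
  by rewrite -opprB mulNr -subrX1 opprB.
by rewrite lerBlDr lerDl exprn_ge0.
Qed.

Lemma sum_tail_le (f : nat -> C) (K q : R) m n : 0 <= q < 1 -> 0 <= K ->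
  (forall i, nc (f i) <= K * q ^+ i) -> (m <= n)%N ->
  nc (\sum_(i < n) f i - \sum_(i < m) f i) <= K / (1 - q) * q ^+ m.
Proof.
move=> hq K0 hf mn; have [q0 q1] := andP hq.
rewrite -!(big_mkord xpredT f) (@big_cat_nat _ _ _ m 0 n) //= [X in nc X]addrC addKr.
rewrite -{1}(add0n m) big_addn big_mkord; apply: le_trans (nc_sum _ _ _) _.
have h : forall i : 'I_(n - m), true -> nc (f (i + m)%N) <= K * q ^+ m * q ^+ i.
  by move=> i _; apply: le_trans (hf _) _; rewrite exprD mulrA mulrAC.
apply: le_trans (ler_sum _ h) _; rewrite -mulr_sumr [leRHS]mulrAC.
by apply: ler_wpM2l; [rewrite mulr_ge0 ?exprn_ge0|apply: sum_geometric_le].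
Qed.

(** All series below are dominated by geometric ones, and this explicit bound
    on the tails replaces absolute convergence. *)
Lemma has_sum_tail (f : nat -> C) (s : C) (K q : R) m : 0 <= q < 1 -> 0 <= K ->
  (forall i, nc (f i) <= K * q ^+ i) -> has_sum f s ->
  nc (s - \sum_(i < m) f i) <= K / (1 - q) * q ^+ m.
Proof.
move=> hq K0 hf hs.
have h : (fun n => \sum_(i < n + m) f i - \sum_(i < m) f i) @ \oo --> s - \sum_(i < m) f i.
  by apply: cvgcB; [exact: (cvgc_shift (u := fun n => \sum_(i < n) f i))|exact: cvgc_cst].
by apply: (cvgc_le h) => n; apply: sum_tail_le; rewrite ?leq_addl.
Qed.

Lemma has_sum_le (f : nat -> C) (s : C) (K q : R) : 0 <= q < 1 -> 0 <= K ->
  (forall i, nc (f i) <= K * q ^+ i) -> has_sum f s -> nc s <= K / (1 - q).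
Proof.
move=> hq K0 hf hs; have := has_sum_tail 0 hq K0 hf hs.
by rewrite big_ord0 subr0 expr0 mulr1.
Qed.

Lemma has_sum_ex (f : nat -> C) (K q : R) : 0 <= q < 1 -> 0 <= K ->
  (forall i, nc (f i) <= K * q ^+ i) -> exists s, has_sum f s.
Proof.
move=> hq K0 hf; apply: cvgc_cauchy => e e0.
have [N hN] := geometric_small (K / (1 - q)) hq e0.
exists N => n hn; apply: le_lt_trans (hN N (leqnn N)).
exact: sum_tail_le.
Qed.

Lemma has_sum_unique f (s t : C) : has_sum f s -> has_sum f t -> s = t.
Proof. exact: cvgc_unique. Qed.

Lemma has_sumM f (s c : C) : has_sum f s -> has_sum (fun i => c * f i) (c * s).
Proof.
move=> h; rewrite /has_sum; under eq_fun do rewrite -mulr_sumr.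
by apply: cvgcM => //; apply: cvgc_cst.
Qed.

Lemma has_sumB f g (s t : C) : has_sum f s -> has_sum g t ->
  has_sum (fun i => f i - g i) (s - t).
Proof.
move=> h h'; rewrite /has_sum; under eq_fun do rewrite sumrB.
exact: cvgcB.
Qed.

Lemma has_sum_sum (I : Type) (r : seq I) (f : I -> nat -> C) (s : I -> C) :
  (forall i, has_sum (f i) (s i)) ->
  has_sum (fun l => \sum_(i <- r) f i l) (\sum_(i <- r) s i).
Proof.
move=> h; rewrite /has_sum; under eq_fun do rewrite exchange_big /=.
exact: cvgc_sum.
Qed.

(** Tannery's theorem (dominated convergence for series) with a geometric
    majorant: cut all series at an index where the tails are small, and use
    termwise convergence on the remaining finite part. *)
Lemma tannery (f : nat -> nat -> C) (g : nat -> C) (s : nat -> C) (t : C) (K q : R) :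
  0 <= q < 1 -> 0 <= K -> (forall N i, nc (f N i) <= K * q ^+ i) ->
  (forall i, (fun N => f N i) @ \oo --> g i) ->
  (forall N, has_sum (f N) (s N)) -> has_sum g t -> s @ \oo --> t.
Proof.
move=> hq K0 hf hfg hs ht.
have hg i : nc (g i) <= K * q ^+ i by apply: (cvgc_le (hfg i)).
apply/cvgcP => e e0; have e3 : 0 < e / 3 by lra.
have [m hm] := geometric_small (K / (1 - q)) hq e3.
have /cvgcP/(_ _ e3)[N hN] : (fun N => \sum_(i < m) f N i) @ \oo --> \sum_(i < m) g i.
  exact: cvgc_sum.
exists N => n hn; have a := hN n hn.
have b := has_sum_tail m hq K0 (hf n) (hs n).
have c := has_sum_tail m hq K0 hg ht.
have d := hm m (leqnn m).
have -> : s n - t = (s n - \sum_(i < m) f n i) + ((\sum_(i < m) f n i - \sum_(i < m) g i)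
   - (t - \sum_(i < m) g i)) by ring.
apply: le_lt_trans (ler_ncD _ _) _.
by have := ler_ncB (\sum_(i < m) f n i - \sum_(i < m) g i) (t - \sum_(i < m) g i); lra.
Qed.

Lemma tannery_sum (f : nat -> nat -> C) (g : nat -> C) (s : nat -> C) (t : C) (K q : R) :
  0 <= q < 1 -> 0 <= K -> (forall N i, nc (f N i) <= K * q ^+ i) ->
  (forall i, (fun N => f N i) @ \oo --> g i) ->
  (forall N, has_sum (f N) (s N)) -> s @ \oo --> t -> has_sum g t.
Proof.
move=> hq K0 hf hfg hs ht.
have hg i : nc (g i) <= K * q ^+ i by apply: (cvgc_le (hfg i)).
have [t' ht'] := has_sum_ex hq K0 hg.
by rewrite (cvgc_unique ht (tannery hq K0 hf hfg hs ht')).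
Qed.

Lemma has_sum_geometric (z : C) : nc z < 1 -> has_sum (fun i => z ^+ i) (1 - z)^-1.
Proof.
move=> hz; have z1 : 1 - z != 0.
  by rewrite subr_eq0; apply/eqP => e; move: hz; rewrite -e nc1 ltxx.
have E n : \sum_(i < n) z ^+ i = (1 - z)^-1 - z ^+ n / (1 - z).
  by rewrite -[X in X - _]mul1r -mulrBl -opprB subrX1 -mulNr opprB mulrAC divff // mul1r.
apply: (@cvgc_geometric (nc (1 - z)^-1) (nc z)); first by rewrite nc_ge0.
move=> n; rewrite E addrC addrA addNr add0r ncN ncM ncX mulrC //.
Qed.

End ComplexLimits.

(** * Goursat's theorem on a deformed square *)

Section Goursat.
Variables (R : realType) (C : complex_plane R).

(** Stated without a quotient, so that no case w = z has to be excluded. *)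
Definition cdiff (f : C -> C) (z d : C) := forall e : R, 0 < e ->
  exists2 del : R, 0 < del & forall w, nc (w - z) < del ->
    nc (f w - f z - d * (w - z)) <= e * nc (w - z).

Variables (h : C -> C) (phi : R -> R -> C) (L : R).
Hypothesis L0 : 0 <= L.
Hypothesis phi_lip : forall x y x' y' : R, 0 <= x <= 1 -> 0 <= y <= 1 ->
  0 <= x' <= 1 -> 0 <= y' <= 1 ->
  nc (phi x y - phi x' y') <= L * (`|x - x'| + `|y - y'|).
Hypothesis h_diff : forall x y : R, 0 <= x <= 1 -> 0 <= y <= 1 ->
  exists d, cdiff h (phi x y) d.

(** Twice the contribution of the segment from a to b to the integral of h, by
    the trapezoidal rule. Unlike a rule that evaluates at one end, it is exact
    for affine functions, which is what Goursat's argument needs. *)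
Definition trap (a b : C) : C := (h a + h b) * (b - a).

Definition grid n i j := phi (i%:R / 2 ^+ n) (j%:R / 2 ^+ n).
Definition hsum n i j s := \sum_(k < s) trap (grid n (i + k) j) (grid n (i + k).+1 j).
Definition vsum n i j s := \sum_(k < s) trap (grid n i (j + k)) (grid n i (j + k).+1).
(** The discrete integral around the block of s by s cells with lower left
    corner (i, j) in the subdivision of the square into 2^n by 2^n cells,
    transported by phi. *)
Definition boundary n i j s :=
  hsum n i j s + vsum n (i + s) j s - hsum n i (j + s) s - vsum n i j s.

Lemma hsum_split n i j s t : hsum n i j (s + t) = hsum n i j s + hsum n (i + s) j t.
Proof. by rewrite /hsum big_split_ord /=; congr (_ + _); apply: eq_bigr => k _; rewrite addnA. Qed.

Lemma vsum_split n i j s t : vsum n i j (s + t) = vsum n i j s + vsum n i (j + s) t.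
Proof. by rewrite /vsum big_split_ord /=; congr (_ + _); apply: eq_bigr => k _; rewrite addnA. Qed.

(** The contributions of the interior edges cancel. *)
Lemma boundary_split n i j s : boundary n i j (s + s) =
  boundary n i j s + boundary n (i + s) j s + boundary n i (j + s) s
  + boundary n (i + s) (j + s) s.
Proof. by rewrite /boundary !hsum_split !vsum_split !addnA; ring. Qed.

(** The affine function with value h p and slope d at p has a primitive, Q /
    2, and the trapezoidal rule integrates it exactly; so only the deviation
    of h from this function, at most E, contributes. *)
Lemma trap_sum_approx (p d : C) (E l : R) (g : nat -> C) s :
  let Q z := (h p - d * p) * z *+ 2 + d * z ^+ 2 in
  0 <= E -> (forall k, (k <= s)%N -> nc (h (g k) - h p - d * (g k - p)) <= E) ->
  (forall k, (k < s)%N -> nc (g k.+1 - g k) <= l) ->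
  nc (\sum_(k < s) trap (g k) (g k.+1) - (Q (g s) - Q (g 0%N))) <= s%:R * (2 * E * l).
Proof.
move=> Q E0 hE hl.
have -> : Q (g s) - Q (g 0%N) = \sum_(k < s) (Q (g k.+1) - Q (g k)).
  by rewrite -(big_mkord xpredT (fun k => Q (g k.+1) - Q (g k))) telescope_sumr.
rewrite -sumrB; apply: le_trans (nc_sum _ _ _) _.
rewrite -[s in s%:R]card_ord mulr_natl -sumr_const; apply: ler_sum => k _.
set a := g k; set b := g k.+1.
have -> : trap a b - (Q b - Q a) =
   ((h a - h p - d * (a - p)) + (h b - h p - d * (b - p))) * (b - a).
  by rewrite /trap /Q; ring.
rewrite ncM; apply: ler_pM; rewrite ?nc_ge0 //; last exact: hl.
apply: le_trans (ler_ncD _ _) _; rewrite mulr_natl mulr2n.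
by apply: lerD; apply: hE; rewrite // ltnW.
Qed.

Lemma boundary_approx (p d : C) (E l : R) n i j s : 0 <= E ->
  (forall a b, (i <= a <= i + s)%N -> (j <= b <= j + s)%N ->
    nc (h (grid n a b) - h p - d * (grid n a b - p)) <= E) ->
  (forall a b, (i <= a <= i + s)%N -> (j <= b < j + s)%N ->
    nc (grid n a b.+1 - grid n a b) <= l) ->
  (forall a b, (i <= a < i + s)%N -> (j <= b <= j + s)%N ->
    nc (grid n a.+1 b - grid n a b) <= l) ->
  nc (boundary n i j s) <= 4 * (s%:R * (2 * E * l)).
Proof.
move=> E0 hE hv hh.
have hE1 b (hb : (j <= b <= j + s)%N) k : (k <= s)%N ->
    nc (h (grid n (i + k) b) - h p - d * (grid n (i + k) b - p)) <= E.
  by move=> ks; apply: hE => //; rewrite leq_addr leq_add2l.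
have hE2 a (ha : (i <= a <= i + s)%N) k : (k <= s)%N ->
    nc (h (grid n a (j + k)) - h p - d * (grid n a (j + k) - p)) <= E.
  by move=> ks; apply: hE => //; rewrite leq_addr leq_add2l.
have hl1 b (hb : (j <= b <= j + s)%N) k : (k < s)%N ->
    nc (grid n (i + k.+1) b - grid n (i + k) b) <= l.
  by move=> ks; rewrite addnS; apply: hh => //; rewrite leq_addr ltn_add2l.
have hl2 a (ha : (i <= a <= i + s)%N) k : (k < s)%N ->
    nc (grid n a (j + k.+1) - grid n a (j + k)) <= l.
  by move=> ks; rewrite addnS; apply: hv => //; rewrite leq_addr ltn_add2l.
have b0 : (j <= j <= j + s)%N by rewrite leqnn leq_addr.
have b1 : (j <= j + s <= j + s)%N by rewrite leqnn leq_addr.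
have a0 : (i <= i <= i + s)%N by rewrite leqnn leq_addr.
have a1 : (i <= i + s <= i + s)%N by rewrite leqnn leq_addr.
have H0 := @trap_sum_approx p d E l (fun k => grid n (i + k) j) s E0 (hE1 _ b0) (hl1 _ b0).
have H1 := @trap_sum_approx p d E l (fun k => grid n (i + k) (j + s)) s E0 (hE1 _ b1) (hl1 _ b1).
have V0 := @trap_sum_approx p d E l (fun k => grid n i (j + k)) s E0 (hE2 _ a0) (hl2 _ a0).
have V1 := @trap_sum_approx p d E l (fun k => grid n (i + s) (j + k)) s E0 (hE2 _ a1) (hl2 _ a1).
move: H0 H1 V0 V1; rewrite /= !addn0.
set Q := fun z => (h p - d * p) * z *+ 2 + d * z ^+ 2.
rewrite -/(Q (grid n i j)) -/(Q (grid n (i + s) j)) -/(Q (grid n i (j + s)))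
  -/(Q (grid n (i + s) (j + s))).
have e1 b : \sum_(k < s) trap (grid n (i + k) b) (grid n (i + k.+1) b) = hsum n i b s.
  by apply: eq_bigr => k _; rewrite addnS.
have e2 a : \sum_(k < s) trap (grid n a (j + k)) (grid n a (j + k.+1)) = vsum n a j s.
  by apply: eq_bigr => k _; rewrite addnS.
rewrite !e1 !e2.
set q00 := Q (grid n i j); set q10 := Q (grid n (i + s) j); set q01 := Q (grid n i (j + s)); set q11 := Q _.
set M := s%:R * _.
move=> H0 H1 V0 V1.
have -> : boundary n i j s = (hsum n i j s - (q10 - q00)) - (hsum n i (j + s) s - (q11 - q01))
   - (vsum n i j s - (q01 - q00)) + (vsum n (i + s) j s - (q11 - q10)).
  by rewrite /boundary; ring.
apply: le_trans (ler_ncD _ _) _.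
have := ler_ncB (hsum n i j s - (q10 - q00) - (hsum n i (j + s) s - (q11 - q01)))
   (vsum n i j s - (q01 - q00)).
have := ler_ncB (hsum n i j s - (q10 - q00)) (hsum n i (j + s) s - (q11 - q01)).
lra.
Qed.

(** The point where the successive bad squares of Goursat's bisection meet. *)
Lemma nested_intervals (u v : nat -> R) : (forall n, u n <= u n.+1) ->
  (forall n, v n.+1 <= v n) -> (forall n, u n <= v n) ->
  exists x, forall n, u n <= x <= v n.
Proof.
move=> hu hv huv.
have um : {homo u : m n / (m <= n)%N >-> m <= n} by apply: homo_leq => // x y z; apply: le_trans.
have vm : {homo v : m n / (m <= n)%N >-> n <= m}.
  by apply: (homo_leq (r := fun x y => y <= x)) => // x y z /[swap]; apply: le_trans.
have uv m n : u m <= v n.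
  apply: le_trans (um m (maxn m n) _) _; first exact: leq_maxl.
  by apply: le_trans (huv _) _; apply: vm; apply: leq_maxr.
exists (sup (range u)) => n; apply/andP; split.
  by apply: ub_le_sup; [exists (v 0%N) => _ [m _ <-]|exists n].
by apply: ge_sup; [exists (u 0%N), 0%N|move=> _ [m _ <-]].
Qed.

(** Call a square of the m-th subdivision good if its discrete boundary
    integral is eventually at most e / 4^m for finer and finer meshes. If four
    squares are good, so is their union. Hence if the whole square were bad
    there would be a nested sequence of bad squares, shrinking to a point (x,
    y). But h is differentiable at phi x y, and near this point h differs from
    an affine function by a small multiple of the distance, which makes small
    squares good. *)
Lemma goursat (e : R) : 0 < e -> exists n0, forall n, (n0 <= n)%N ->
  nc (boundary n 0 0 (2 ^ n)) <= e.
Proof.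
move=> e0.
pose good (p : nat * (nat * nat)) := exists t0, forall t, (t0 <= t)%N ->
  nc (boundary (p.1 + t) (p.2.1 * 2 ^ t) (p.2.2 * 2 ^ t) (2 ^ t)) <= e / 4 ^+ p.1.
have [[t0 ht0]|bad0] := pselect (good (0, (0, 0))%N).
  by exists t0 => t /ht0; rewrite /= add0n !mul0n expr0 divr1.
have goodS m i j : good (m.+1, (i.*2, j.*2)) -> good (m.+1, (i.*2.+1, j.*2)) ->
   good (m.+1, (i.*2, j.*2.+1)) -> good (m.+1, (i.*2.+1, j.*2.+1)) -> good (m, (i, j)).
  move=> [t1 h1] [t2 h2] [t3 h3] [t4 h4].
  exists (maxn (maxn t1 t2) (maxn t3 t4)).+1 => -[//|t]; rewrite ltnS !geq_max.
  move=> /andP[/andP[/h1 {}h1 /h2 {}h2] /andP[/h3 {}h3 /h4 {}h4]].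
  move: h1 h2 h3 h4; rewrite /= !addSn -!addnS.
  (* Corners of the four subsquares, in units of the finest mesh. *)
  have E k : (k.*2 * 2 ^ t = k * 2 ^ t.+1)%N by rewrite expnS mulnA muln2.
  have E' k : (k.*2.+1 * 2 ^ t = k * 2 ^ t.+1 + 2 ^ t)%N by rewrite mulSn E addnC.
  rewrite !E !E' expnS mul2n -addnn boundary_split => h1 h2 h3 h4.
  have -> : e / 4 ^+ m = e / 4 ^+ m.+1 *+ 4.
    by rewrite exprS invfM -mulr_natl; field; rewrite ?expf_neq0 ?pnatr_eq0.
  set a := boundary _ _ _ _ in h1 *.
  set b := boundary _ (_ + _) _ _ in h2 *; set c := boundary _ _ (_ + _) _ in h3 *.
  set d := boundary _ _ _ _ in h4 *.
  have := ler_ncD (a + b + c) d; have := ler_ncD (a + b) c; have := ler_ncD a b.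
  by move: h1 h2 h3 h4; lra.
have next p : exists q : nat * (nat * nat), ~ good p -> ~ good q /\
    exists x y : bool, q = (p.1.+1, (p.2.1.*2 + x, p.2.2.*2 + y)%N).
  case: p => m [i j]; apply: contrapT => hn.
  have H x y : good (m.+1, (i.*2 + nat_of_bool x, j.*2 + nat_of_bool y)%N).
    apply: contrapT => hb; apply: hn.
    by exists (m.+1, (i.*2 + nat_of_bool x, j.*2 + nat_of_bool y)%N) => _; split=> //; exists x, y.
  apply: hn; exists (0, (0, 0))%N => hb; exfalso; apply: hb; apply: goodS.
  - by have := H false false; rewrite !addn0.
  - by have := H true false; rewrite addn0 addn1.
  - by have := H false true; rewrite addn0 addn1.
  - by have := H true true; rewrite !addn1.
have [f hf] := choice next.
pose P k := iter k f (0, (0, 0))%N.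
have Pbad k : ~ good (P k) by elim: k => // k /hf[].
have Pstep k := (hf _ (Pbad k)).2.
have P1 k : (P k).1 = k.
  by elim: k => // k IH; have [x [y e1]] := Pstep k; rewrite /P iterS e1 /= IH.
pose X k : R := (P k).2.1%:R / 2 ^+ k; pose Y k : R := (P k).2.2%:R / 2 ^+ k.
have nest (u : nat -> nat) : u 0%N = 0%N ->
   (forall k, exists x : bool, u k.+1 = ((u k).*2 + x)%N) ->
   exists z : R, forall k, (u k)%:R / 2 ^+ k <= z <= (u k)%:R / 2 ^+ k + (2 ^+ k)^-1 /\
      0 <= (u k)%:R / 2 ^+ k :> R /\ (u k)%:R / 2 ^+ k + (2 ^+ k)^-1 <= 1 :> R.
  move=> u0 uS.
  have p2 k : 0 < (2 ^+ k : R)^-1 by rewrite invr_gt0 exprn_gt0.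
  have E k (x : bool) : ((u k).*2 + x)%:R / 2 ^+ k.+1 = (u k)%:R / 2 ^+ k + x%:R / 2 * (2 ^+ k)^-1 :> R.
    by rewrite exprS invfM natrD -muln2 natrM; field; rewrite expf_neq0 ?pnatr_eq0.
  have E2 k : (2 ^+ k.+1 : R)^-1 = (2 ^+ k)^-1 / 2 by rewrite exprS invfM mulrC.
  have vm k : (u k.+1)%:R / 2 ^+ k.+1 + (2 ^+ k.+1)^-1 <= (u k)%:R / 2 ^+ k + (2 ^+ k)^-1 :> R.
    by have [x ->] := uS k; rewrite E E2; have := p2 k; case: x; rewrite /=; lra.
  have [z hz] : exists z : R, forall k, (u k)%:R / 2 ^+ k <= z <= (u k)%:R / 2 ^+ k + (2 ^+ k)^-1.
    apply: nested_intervals => // k; last by rewrite lerDl ltW.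
    by have [x ->] := uS k; rewrite E lerDl mulr_ge0 ?divr_ge0 ?ler0n ?ltW.
  exists z => k; split=> //; split; first by rewrite divr_ge0 ?ler0n ?exprn_ge0.
  by elim: k => [|k IH]; [rewrite u0 expr0 invr1 mul0r add0r|move: (vm k) IH; lra].
have [x hx] : exists z : R, forall k, X k <= z <= X k + (2 ^+ k)^-1 /\
      0 <= X k /\ X k + (2 ^+ k)^-1 <= 1.
  apply: (nest (fun k => (P k).2.1)) => // k; have [a [b e1]] := Pstep k.
  by exists a; rewrite [X in X.2.1]/P iterS e1.
have [y hy] : exists z : R, forall k, Y k <= z <= Y k + (2 ^+ k)^-1 /\
      0 <= Y k /\ Y k + (2 ^+ k)^-1 <= 1.
  apply: (nest (fun k => (P k).2.2)) => // k; have [a [b e1]] := Pstep k.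
  by exists b; rewrite [X in X.2.2]/P iterS e1.
have hx01 : 0 <= x <= 1 by have := hx 0%N; lra.
have hy01 : 0 <= y <= 1 by have := hy 0%N; lra.
have [d hd] := h_diff hx01 hy01.
(* The tolerance e / (16 L^2 + 1) is chosen so that the four sides of a square
   of side 2^-m, whose image has diameter at most 2 L 2^-m, give less than e /
   4^m in total. *)
have K0 : 0 < 16 * L ^+ 2 + 1 :> R by have := sqr_ge0 L; lra.
have [del del0 hdel] := hd (e / (16 * L ^+ 2 + 1)) (divr_gt0 e0 K0).
have [m hm] : exists m, L * 2 * (2^-1) ^+ m < del.
  have h2 : 0 <= (2^-1 : R) < 1 by lra.
  have [m hm] := geometric_small (L * 2) h2 del0.
  by exists m; apply: hm.
case: (Pbad m); exists 0%N => t _; rewrite P1.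
have [hxm [X0 X1]] := hx m; have [hym [Y0 Y1]] := hy m.
set I := (P m).2.1; set J := (P m).2.2.
have p2 k : 0 < (2 ^+ k : R) by rewrite exprn_gt0.
have coord (u : nat) a : (u * 2 ^ t <= a <= u * 2 ^ t + 2 ^ t)%N ->
   u%:R / 2 ^+ m <= (a%:R / 2 ^+ (m + t) : R) <= u%:R / 2 ^+ m + (2 ^+ m)^-1.
  have E : (u%:R / 2 ^+ m : R) = (u * 2 ^ t)%:R / 2 ^+ (m + t).
    by rewrite natrM natrX exprD invfM mulrACA (divff (lt0r_neq0 (p2 t))) mulr1.
  have E' : (2 ^+ m : R)^-1 = (2 ^ t)%:R / 2 ^+ (m + t).
    by rewrite natrX exprD invfM mulrCA (divff (lt0r_neq0 (p2 t))) mulr1.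
  rewrite E E' -mulrDl -natrD => /andP[h1 h2].
  by rewrite !ler_pM2r ?invr_gt0 // !ler_nat h1.
have step a : ((a.+1)%:R / 2 ^+ (m + t) - a%:R / 2 ^+ (m + t) = (2 ^+ (m + t))^-1 :> R).
  by rewrite -mulrBl -natrB // subSnn mul1r.
set D := L * 2 * 2^-1 ^+ m in hm.
have D0 : 0 <= D by rewrite /D !mulr_ge0 ?exprn_ge0.
set ee := e / _ in hdel.
have ee0 : 0 <= ee by rewrite ltW // divr_gt0.
have gridin a b : (I * 2 ^ t <= a <= I * 2 ^ t + 2 ^ t)%N ->
   (J * 2 ^ t <= b <= J * 2 ^ t + 2 ^ t)%N ->
   nc (grid (m + t) a b - phi x y) <= D.
  move=> /coord ha /coord hb; move: ha hb; rewrite -/(X m) -/(Y m).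
  set xa := a%:R / _; set yb := b%:R / _ => ha hb.
  have ha1 : 0 <= xa <= 1 by lra.
  have hb1 : 0 <= yb <= 1 by lra.
  apply: le_trans (phi_lip ha1 hb1 hx01 hy01) _.
  rewrite /D -mulrA exprVn; apply: ler_wpM2l => //.
  have h1 : `|xa - x| <= (2 ^+ m)^-1 by rewrite ler_norml; lra.
  have h2 : `|yb - y| <= (2 ^+ m)^-1 by rewrite ler_norml; lra.
  by lra.
have -> : e / 4 ^+ m = 4 * ((2 ^ t)%:R * (2 * (ee * D) * (L * (2 ^+ (m + t))^-1))) + ee / 4 ^+ m.
  rewrite /ee /D exprVn natrX exprD (_ : 4 = 2 ^+ 2) -?exprM; last by rewrite -natrX.
  rewrite mulnC exprM expr2; field.
  by rewrite !gt_eqF // addrC.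
apply: le_trans (_ : _ <= 4 * ((2 ^ t)%:R * (2 * (ee * D) * (L * (2 ^+ (m + t))^-1)))) _; last first.
  by rewrite lerDl divr_ge0 // exprn_ge0.
apply: (@boundary_approx (phi x y) d); first by rewrite mulr_ge0.
- move=> a b ha hb; have hg := gridin a b ha hb.
  apply: le_trans (hdel _ _) _; first by apply: le_lt_trans hm.
  exact: ler_wpM2l.
- move=> a b ha /andP[b1 b2].
  have hb : (J * 2 ^ t <= b <= J * 2 ^ t + 2 ^ t)%N by rewrite b1 ltnW.
  have hb' : (J * 2 ^ t <= b.+1 <= J * 2 ^ t + 2 ^ t)%N by rewrite b2 leqW.
  move: (coord _ _ ha) (coord _ _ hb) (coord _ _ hb'); rewrite -/(X m) -/(Y m) => h1 h2 h3.
  have k1 : 0 <= (a%:R / 2 ^+ (m + t) : R) <= 1 by lra.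
  have k2 : 0 <= (b%:R / 2 ^+ (m + t) : R) <= 1 by lra.
  have k3 : 0 <= ((b.+1)%:R / 2 ^+ (m + t) : R) <= 1 by lra.
  apply: le_trans (phi_lip k1 k3 k1 k2) _.
  by rewrite subrr normr0 add0r step ger0_norm // invr_ge0 ltW.
- move=> a b /andP[a1 a2] hb.
  have ha : (I * 2 ^ t <= a <= I * 2 ^ t + 2 ^ t)%N by rewrite a1 ltnW.
  have ha' : (I * 2 ^ t <= a.+1 <= I * 2 ^ t + 2 ^ t)%N by rewrite a2 leqW.
  move: (coord _ _ ha) (coord _ _ ha') (coord _ _ hb); rewrite -/(X m) -/(Y m) => h1 h2 h3.
  have k1 : 0 <= (a%:R / 2 ^+ (m + t) : R) <= 1 by lra.
  have k2 : 0 <= (b%:R / 2 ^+ (m + t) : R) <= 1 by lra.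
  have k3 : 0 <= ((a.+1)%:R / 2 ^+ (m + t) : R) <= 1 by lra.
  apply: le_trans (phi_lip k3 k2 k1 k2) _.
  by rewrite subrr normr0 addr0 step ger0_norm // invr_ge0 ltW.
Qed.

End Goursat.

(** * Complex differentiability *)

Section Diff.
Variables (R : realType) (C : complex_plane R).

Lemma nbhscP (z : C) (A : set C) : nbhs z A <->
  exists2 e : R, 0 < e & forall w, nc (w - z) < e -> A w.
Proof.
split.
  move=> /(@nbhs_ballP _ C^o)[e /pos_realc[r r0 ->] h]; exists r => // w hw.
  by apply: h; rewrite /ball /= distrC lt_norm_nc.
move=> [e e0 h]; apply/(@nbhs_ballP _ C^o); exists (rinj e) => /=.
  by rewrite ltc0_real.
by move=> w; rewrite /ball /= distrC lt_norm_nc; apply: h.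
Qed.

Lemma cdiff_derivable (f : C -> C) (z : C) :
  (exists d, cdiff f z d) <-> derivable (f : C^o -> C^o) z 1.
Proof.
split.
  move=> [d hd]; apply/cvg_ex; exists d.
  apply/(@cvgrPdistC_le C C^o) => e /pos_realc[r r0 ->].
  have [del del0 h] := hd r r0.
  apply/(@nbhs_ballP _ C^o); exists (rinj del); first by rewrite /= ltc0_real.
  move=> t; rewrite /ball /= sub0r normrN lt_norm_nc => ht t0.
  rewrite [t *: (1 : C^o)]mulr1 normE ler_rinj.
  have := h (t + z); rewrite addrK => /(_ ht) h1.
  have -> : t^-1 *: (f (t + z) - f z : C^o) - d = t^-1 * (f (t + z) - f z - d * t).
    by rewrite mulrBr [X in _ = _ - X]mulrCA mulVf // mulr1.
  by rewrite ncM ncV ler_pdivrMl ?nc_gt0 // [_ * r]mulrC; exact: h1.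
move=> /cvg_ex[d /(@cvgrPdistC_le C C^o) hd]; exists d => e e0.
have e0' : 0 < rinj e :> C by rewrite ltc0_real.
have /(@nbhs_ballP _ C^o)[r /= /pos_realc[del del0 ->] h] := hd _ e0'.
exists del => // w hw.
have [->|wz] := eqVneq w z; first by rewrite !subrr mulr0 subrr nc0 mulr0.
have wz0 : w - z != 0 by rewrite subr_eq0.
have := h (w - z); rewrite /ball /= sub0r normrN lt_norm_nc => /(_ hw wz0).
rewrite [(w - z) *: (1 : C^o)]mulr1 subrK normE ler_rinj.
have -> : (w - z)^-1 *: (f w - f z : C^o) - d = (w - z)^-1 * (f w - f z - d * (w - z)).
  by rewrite mulrBr [X in _ = _ - X]mulrCA mulVf // mulr1.
by rewrite ncM ncV ler_pdivrMl ?nc_gt0 // [_ * e]mulrC.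
Qed.

Definition cdiffable (f : C -> C) (z : C) := exists d, cdiff f z d.

Lemma cdiffable_cst (a z : C) : cdiffable (fun=> a) z.
Proof. by exists 0 => e e0; exists 1 => // w _; rewrite subrr mul0r subrr nc0 mulr_ge0 ?nc_ge0 ?ltW. Qed.
Lemma cdiffable_id (z : C) : cdiffable id z.
Proof. by exists 1 => e e0; exists 1 => // w _; rewrite mul1r subrr nc0 mulr_ge0 ?nc_ge0 ?ltW. Qed.
Lemma cdiffableB (f g : C -> C) z : cdiffable f z -> cdiffable g z ->
  cdiffable (fun w => f w - g w) z.
Proof. by rewrite /cdiffable !cdiff_derivable; apply: derivableB. Qed.
Lemma cdiffableM (f g : C -> C) z : cdiffable f z -> cdiffable g z ->
  cdiffable (fun w => f w * g w) z.
Proof. by rewrite /cdiffable !cdiff_derivable; apply: derivableM. Qed.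
Lemma cdiffableV (f : C -> C) z : f z != 0 -> cdiffable f z ->
  cdiffable (fun w => (f w)^-1) z.
Proof. by rewrite /cdiffable !cdiff_derivable; apply: derivableV. Qed.
Lemma cdiffableX (f : C -> C) z n : cdiffable f z ->
  cdiffable (fun w => f w ^+ n) z.
Proof.
move=> hf; elim: n => [|n IH].
  by under eq_fun do rewrite expr0; apply: cdiffable_cst.
by under eq_fun do rewrite exprS; apply: cdiffableM.
Qed.
Lemma cdiffable_near (f g : C -> C) z (e : R) : 0 < e ->
  (forall w, nc (w - z) < e -> f w = g w) -> cdiffable f z -> cdiffable g z.
Proof.
move=> e0 h [d hd]; exists d => r /hd[del del0 hdel].
exists (Num.min e del); first by rewrite lt_min e0.
move=> w; rewrite lt_min => /andP[h1 h2].
by rewrite -!h // ?subrr ?nc0 //; apply: hdel.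
Qed.
Lemma cdiffable_shift (f : C -> C) (a z : C) : cdiffable f (a + z) ->
  cdiffable (fun w => f (a + w)) z.
Proof.
move=> [d hd]; exists d => r /hd[del del0 hdel]; exists del => // w hw.
have e : a + w - (a + z) = w - z by ring.
by have := hdel (a + w); rewrite e; apply.
Qed.
Lemma cdiffable_bounded (f : C -> C) z : cdiffable f z -> exists2 e : R, 0 < e &
  exists2 K : R, 0 <= K & forall w, nc (w - z) < e -> nc (f w - f z) <= K * nc (w - z).
Proof.
move=> [d hd]; have [del del0 h] := hd 1 ltr01; exists del => //.
exists (nc d + 1); first by rewrite addr_ge0 ?nc_ge0.
move=> w hw; have := h w hw; rewrite mulrDl -ncM.
have := ler_ncD (f w - f z - d * (w - z)) (d * (w - z)); rewrite subrK; lra.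
Qed.

End Diff.

(** * Roots of unity of order a power of two *)

Section Circle.
Variables (R : realType) (C : complex_plane R).

Lemma sin_lip (x y : R) : `|sin x - sin y| <= `|x - y|.
Proof.
wlog xy : x y / x <= y => [h|].
  have [/h//|/ltW/h] := leP x y.
  by move=> h'; rewrite distrC [leRHS]distrC.
have [c _] := @MVT_segment R sin cos x y xy (fun z _ => is_derive_sin z)
   (continuous_subspaceT (@continuous_sin R)).
rewrite distrC => ->; rewrite normrM distrC; apply: ler_piMl => //; exact: cos_max.
Qed.
Lemma cos_lip (x y : R) : `|cos x - cos y| <= `|x - y|.
Proof.
have e (z : R) : cos z = - sin (z - pi / 2) by rewrite -cosDpihalf subrK.
have -> : x - y = (x - pi / 2) - (y - pi / 2) by ring.
by rewrite !e opprK addrC distrC; apply: sin_lip.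
Qed.

(** The exponential of 2 i pi x: one turn of the circle is parametrized by the
    unit interval. *)
Definition cis (x : R) : C := rinj (cos (x * (pi *+ 2))) + 'i * rinj (sin (x * (pi *+ 2))).

Lemma cisD x y : cis (x + y) = cis x * cis y.
Proof.
rewrite /cis mulrDl cosD sinD rmorphB rmorphD !rmorphM /=.
have := sqrCi C; move: ('i : C) => i hi.
have -> : forall a b c d : C, (a + i * b) * (c + i * d) = a * c + i ^+ 2 * (b * d) + i * (b * c + a * d).
  by move=> a b c d; ring.
by rewrite hi; ring.
Qed.
Lemma cis0 : cis 0 = 1.
Proof. by rewrite /cis mul0r cos0 sin0 rmorph1 rmorph0 mulr0 addr0. Qed.
Lemma cis_half : cis (2^-1) = -1.
Proof.
have h : 2^-1 * (pi *+ 2) = pi :> R by rewrite mulr2n; field.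
by rewrite /cis h cospi sinpi rmorphN1 rmorph0 mulr0 addr0.
Qed.
Lemma cis1 : cis 1 = 1.
Proof.
have -> : (1 : R) = 2^-1 + 2^-1 by lra.
by rewrite cisD cis_half mulrN1 opprK.
Qed.
Lemma nc_i : nc ('i : C) = 1.
Proof. by apply: nc_inj_norm; rewrite normCi rmorph1. Qed.
Lemma nc_cis x : nc (cis x) = 1.
Proof.
apply: nc_inj_norm; rewrite rmorph1; apply/eqP; rewrite -sqrp_eq1 //.
rewrite /cis normC2_rect ?realE; last 2 first.
- by rewrite -(rmorph0 (@rinj R C)) !ler_rinj; exact: (num_real (cos _)).
- by rewrite -(rmorph0 (@rinj R C)) !ler_rinj; exact: (num_real (sin _)).
by rewrite -!rmorphXn -rmorphD /= cos2Dsin2 rmorph1.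
Qed.
Lemma cis_lip x y : nc (cis x - cis y) <= (pi * 4) * `|x - y|.
Proof.
have -> : cis x - cis y = rinj (cos (x * (pi *+ 2)) - cos (y * (pi *+ 2))) +
   'i * rinj (sin (x * (pi *+ 2)) - sin (y * (pi *+ 2))).
  by rewrite /cis !rmorphB /=; ring.
apply: le_trans (ler_ncD _ _) _; rewrite ncM nc_i mul1r !nc_real.
have := cos_lip (x * (pi *+ 2)) (y * (pi *+ 2)).
have := sin_lip (x * (pi *+ 2)) (y * (pi *+ 2)).
have p0 : 0 <= (pi : R) *+ 2 by rewrite mulrn_wge0 // pi_ge0.
have -> : pi * 4 = pi *+ 2 * 2 :> R by rewrite mulr2n; ring.
rewrite -mulrBl normrM (ger0_norm p0).
by lra.
Qed.
Lemma cisX x n : cis x ^+ n = cis (n%:R * x).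
Proof.
elim: n => [|n IH]; first by rewrite expr0 mul0r cis0.
by rewrite exprSr IH -cisD -natr1 mulrDl mul1r.
Qed.
Lemma cis_neq0 x : cis x != 0.
Proof. by rewrite -nc_gt0 nc_cis. Qed.

(** A primitive root of unity of order 2^n. Powers of two make the
    subdivisions of the circle compatible with the bisections in Goursat's
    theorem. *)
Definition omega n : C := cis ((2 ^+ n)^-1).

Lemma omegaX n k : omega n ^+ k = cis (k%:R / 2 ^+ n).
Proof. exact: cisX. Qed.
Lemma omega_neq0 n : omega n != 0. Proof. exact: cis_neq0. Qed.
Lemma nc_omega n : nc (omega n) = 1. Proof. exact: nc_cis. Qed.
Lemma omegaS n : omega n.+1 ^+ 2 = omega n.
Proof.
rewrite omegaX /omega exprS invfM mulrA divff ?mul1r // pnatr_eq0 //.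
Qed.
Lemma omega_exp n m : omega (n + m) ^+ (2 ^ m) = omega n.
Proof.
elim: m => [|m IH]; first by rewrite addn0 expr1.
by rewrite addnS expnS exprM omegaS IH.
Qed.
Lemma omega0 : omega 0 = 1. Proof. by rewrite /omega expr0 invr1 cis1. Qed.
Lemma omega1 : omega 1 = -1. Proof. by rewrite /omega expr1 cis_half. Qed.
Lemma omega_order n : omega n ^+ (2 ^ n) = 1.
Proof. by rewrite -omega0 -(omega_exp 0 n) add0n. Qed.

(** If 2^v is the exact power of two dividing i and v < n, raising to the
    power 2^(n-v-1) sends the i-th power of omega to an odd power of -1. *)
Lemma omega_neq1 n i : ~~ (2 ^ n %| i)%N -> omega n ^+ i != 1.
Proof.
move=> ni; apply/negP => /eqP e.
have i0 : (0 < i)%N by case: i ni {e} => //; rewrite dvdn0.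
pose v := logn 2 i; have vn : (v < n)%N.
  by rewrite ltnNge; apply: contra ni; rewrite -pfactor_dvdn.
have [j] := pfactor_coprime (isT : prime 2) i0; rewrite coprime2n -/v => jodd ij.
have /eqP := e; rewrite ij.
have nE : n = (v.+1 + (n - v.+1))%N by lia.
have := congr1 (fun z => z ^+ (2 ^ (n - v.+1))) e; rewrite /= expr1n ij.
rewrite exprAC {1}nE omega_exp mulnC exprM -[v.+1]add1n omega_exp omega1 -signr_odd jodd expr1.
move=> /eqP; rewrite eq_sym -subr_eq0 opprK -[1 + 1]/(2%:R) pnatr_eq0 //.
Qed.

(** Orthogonality of the characters of a cyclic group. *)
Lemma omega_sum n i : \sum_(k < 2 ^ n) (omega n ^+ i) ^+ k =
  if (2 ^ n %| i)%N then (2 ^ n)%:R else 0.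
Proof.
case: ifP => h.
  have -> : omega n ^+ i = 1.
    by rewrite -(divnK h) mulnC exprM omega_order expr1n.
  by under eq_bigr do rewrite expr1n; rewrite sumr_const card_ord.
apply/eqP; have := subrX1 (omega n ^+ i) (2 ^ n).
rewrite exprAC omega_order expr1n subrr => /eqP.
by rewrite eq_sym mulf_eq0 subr_eq0 (negbTE (omega_neq1 (negbT h))).
Qed.

(** The factor 2^n |omega - 1/omega| tends to 4 pi; only a positive lower
    bound is needed, and 8 is its value at n = 2. It increases because z^2 -
    z^-2 = (z + z^-1) (z - z^-1) with |z + z^-1| <= 2. *)
Lemma omega_gap n : 8 <= 2 ^+ n.+2 * nc (omega n.+2 - (omega n.+2)^-1).
Proof.
elim: n => [|n IH].
  have e : (omega 2)^-1 = - omega 2.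
    have h : omega 2 * (- omega 2) = 1 by rewrite mulrN -expr2 omegaS omega1 opprK.
    by rewrite -[LHS]mulr1 -h mulKf // omega_neq0.
  have -> : omega 2 - (omega 2)^-1 = 2%:R * omega 2 by rewrite e; ring.
  by rewrite ncM nc_nat nc_omega; lra.
apply: le_trans IH _; rewrite [2 ^+ n.+3]exprS -mulrA mulrCA ler_wpM2l ?exprn_ge0 //.
rewrite -(omegaS n.+2); set z := omega n.+3.
have -> : z ^+ 2 - (z ^+ 2)^-1 = (z + z^-1) * (z - z^-1) by rewrite -exprVn subr_sqr mulrC.
rewrite ncM ler_wpM2r ?nc_ge0 //; apply: le_trans (ler_ncD _ _) _.
by rewrite ncV nc_omega invr1.
Qed.

End Circle.

(** * Expansion of a differentiable function in a power series *)

Section PowerSeries.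
Variables (R : realType) (C : complex_plane R).
Local Notation omega := (@omega R C).
Local Notation cis := (@cis R C).

Section Disc.
Variables (f : C -> C) (R0 r M : R).
Hypotheses (r0 : 0 < r) (rR : r < R0).
Hypothesis f_diff : forall z, nc z < R0 -> cdiffable f z.
Hypothesis f_bound : forall x : R, 0 <= x <= 1 -> nc (f (rinj r * cis x)) <= M.

Let zeta n k : C := rinj r * omega n ^+ k.

Let M0 : 0 <= M.
Proof.
have h : 0 <= (0 : R) <= 1 by rewrite lexx ler01.
exact: le_trans (nc_ge0 _) (f_bound h).
Qed.

Lemma nc_zeta n k : nc (zeta n k) = r.
Proof. by rewrite ncM ncX nc_omega expr1n mulr1 nc_real gtr0_norm. Qed.

Lemma f_zeta n (k : 'I_(2 ^ n)) : nc (f (zeta n k)) <= M.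
Proof.
rewrite /zeta omegaX; apply: f_bound.
rewrite divr_ge0 ?ler0n ?exprn_ge0 //= ler_pdivrMr ?exprn_gt0 // mul1r -natrX ler_nat.
exact/ltnW/ltn_ord.
Qed.

Let quot (w z : C) := (f z - f w) / (z - w).

(** The annulus between the circle of radius r about 0 and a small circle
    about w is the image of a square under phi, and the two radial edges of
    the square have the same image. The difference quotient of f is
    differentiable on the annulus, so Goursat's theorem compares the sums over
    the two circles. The sum over the small one is small because the quotient
    is bounded near w. *)
Lemma circle_deform w e : nc w < r -> 0 < e -> exists n0, forall n, (n0 <= n)%N ->
  nc (\sum_(k < 2 ^ n) trap (quot w) (zeta n k) (zeta n k.+1)) <= e.
Proof.
move=> wr e0; have hr0 := r0; have hrR := rR.
have wR : nc w < R0 by apply: lt_trans rR.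
have [del del0 [K K0 hK]] := cdiffable_bounded (f_diff wR).
have [L L0 cisL] : exists2 L : R, 0 < L & forall x y, nc (cis x - cis y) <= L * `|x - y|.
  by exists (pi * 4); [rewrite mulr_gt0 ?pi_gt0|apply: cis_lip].
(* The radius of the small circle: inside the neighbourhood where the quotient
   is bounded by K, inside the large disc, and small enough for 2 K L rho,
   which bounds the sum over it, to be at most e / 2. *)
pose rho := Num.min (del / 2) (Num.min ((r - nc w) / 2) (e / (4 * K * L + 1))).
have KL0 : 0 <= K * L by rewrite mulr_ge0 // ltW.
have KL : 0 < 4 * K * L + 1 by rewrite -mulrA; lra.
have rho0 : 0 < rho by rewrite !lt_min !divr_gt0 // subr_gt0.
have rho1 : rho < del.
  by apply: le_lt_trans (_ : del / 2 < del); [rewrite /rho ge_min lexx|lra].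
have rho2 : rho <= (r - nc w) / 2 by rewrite /rho !ge_min lexx /= orbT.
have rho3 : rho <= e / (4 * K * L + 1) by rewrite /rho !ge_min lexx /= !orbT.
pose c (x : R) := (1 - x) * rho + x * r.
pose phi (x y : R) : C := rinj (1 - x) * w + rinj (c x) * cis y.
have c0 x : 0 <= x <= 1 -> 0 <= c x.
  by move=> /andP[x0 x1]; rewrite addr_ge0 // mulr_ge0 ?subr_ge0 // ltW.
have cr x : 0 <= x <= 1 -> c x + (1 - x) * nc w <= r.
  move=> /andP[x0 x1]; rewrite /c addrAC -mulrDr.
  have h : (1 - x) * (rho + nc w) <= (1 - x) * r by apply: ler_wpM2l; lra.
  by apply: le_trans (lerD h (lexx _)) _; rewrite -mulrDl subrK mul1r.
have cw x : 0 <= x <= 1 -> x * nc w < c x.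
  move=> /andP[x0 x1]; rewrite /c.
  have [->|x00] := eqVneq x 0; first by rewrite !mul0r subr0 mul1r addr0.
  have xp : 0 < x by rewrite lt_neqAle eq_sym x00.
  have : x * nc w < x * r by rewrite ltr_pM2l.
  have h1 : 0 <= (1 - x) * rho by rewrite mulr_ge0 ?subr_ge0 // ltW.
  by lra.
have nc_w1 x : 0 <= x <= 1 -> nc (rinj (1 - x) * w) = (1 - x) * nc w.
  by move=> /andP[x0 x1]; rewrite ncM nc_real ger0_norm // subr_ge0.
have nc_c x y : 0 <= x <= 1 -> nc (rinj (c x) * cis y) = c x.
  by move=> hx; rewrite ncM nc_cis mulr1 nc_real ger0_norm // c0.
have phi_w x y : phi x y - w = rinj (c x) * cis y - rinj x * w.
  by rewrite /phi rmorphB rmorph1; ring.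
have phi_neq x y : 0 <= x <= 1 -> phi x y - w != 0.
  move=> hx; rewrite -nc_gt0 phi_w; apply: lt_le_trans (ler_ncD_sub _ _).
  rewrite nc_c // ncM nc_real ger0_norm ?subr_gt0 ?cw //; by case/andP: hx.
have phi_R x y : 0 <= x <= 1 -> nc (phi x y) < R0.
  move=> hx; apply: le_lt_trans rR; apply: le_trans (cr x hx).
  by apply: le_trans (ler_ncD _ _) _; rewrite nc_w1 // nc_c // addrC.
have phi_lip x y x' y' : 0 <= x <= 1 -> 0 <= y <= 1 -> 0 <= x' <= 1 -> 0 <= y' <= 1 ->
    nc (phi x y - phi x' y') <= (r * (2 + L)) * (`|x - x'| + `|y - y'|).
  move=> hx _ hx' _.
  have -> : phi x y - phi x' y' = rinj (x' - x) * w + rinj ((x - x') * (r - rho)) * cis y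
     + rinj (c x') * (cis y - cis y').
    by rewrite /phi /c !(rmorphB, rmorphD, rmorphM, rmorph1) /=; ring.
  apply: le_trans (ler_ncD _ _) _.
  have h1 : nc (rinj (x' - x) * w + rinj ((x - x') * (r - rho)) * cis y) <= `|x - x'| * (2 * r).
    apply: le_trans (ler_ncD _ _) _; rewrite !ncM nc_cis mulr1 !nc_real distrC normrM -mulrDr.
    apply: ler_wpM2l => //; rewrite ger0_norm; last by have := nc_ge0 w; lra.
    by lra.
  have h2 : nc (rinj (c x') * (cis y - cis y')) <= r * (L * `|y - y'|).
    rewrite ncM nc_real ger0_norm ?c0 //; apply: ler_pM; rewrite ?nc_ge0 ?c0 ?cisL //.
    have h3 := cr x' hx'.
    have h4 : 0 <= (1 - x') * nc w by rewrite mulr_ge0 ?nc_ge0 //; lra.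
    by lra.
  have h3 : 0 <= r * L * `|x - x'| by rewrite !mulr_ge0 ?(ltW L0) ?(ltW hr0).
  have h4 : 0 <= r * `|y - y'| by rewrite mulr_ge0 // ltW.
  by move: h1 h2 h3 h4; rewrite -!mulrA; lra.
have quot_diff x y : 0 <= x <= 1 -> 0 <= y <= 1 -> exists d, cdiff (quot w) (phi x y) d.
  move=> hx hy; apply: cdiffableM.
    by apply: cdiffableB; [apply: f_diff; apply: phi_R|apply: cdiffable_cst].
  apply: cdiffableV; first exact: phi_neq.
  by apply: cdiffableB; [apply: cdiffable_id|apply: cdiffable_cst].
have L1 : 0 <= r * (2 + L) by rewrite mulr_ge0 ?ltW // addr_gt0.
have e2 : 0 < e / 2 by lra.
have [n0 hn0] := goursat L1 phi_lip quot_diff e2.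
exists n0 => n hn; have {hn0 hn} := hn0 n hn.
pose N := (2 ^ n)%N; have N0 : 0 < N%:R :> R by rewrite ltr0n expn_gt0.
have NE : (2 ^+ n : R) = N%:R by rewrite natrX.
have hE : hsum (quot w) phi n 0 0 N = hsum (quot w) phi n 0 (0 + N) N.
  apply: eq_bigr => k _; rewrite /grid !add0n NE mul0r divff ?gt_eqF //.
  by rewrite /phi cis0 cis1.
rewrite /boundary -/N -hE add0n.
have -> : forall a b d : C, a + b - a - d = b - d by move=> a b d; ring.
have -> : vsum (quot w) phi n N 0 N = \sum_(k < 2 ^ n) trap (quot w) (zeta n k) (zeta n k.+1).
  have g1 k : grid phi n N (0 + k) = zeta n k.
    rewrite /grid NE divff ?gt_eqF // /phi /c subrr rmorph0 !mul0r !add0r mul1r.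
    by rewrite /zeta omegaX -NE.
  by apply: eq_bigr => k _; rewrite -addnS !g1.
set S := \sum_(k < _) _.
have hin : nc (vsum (quot w) phi n 0 0 N) <= e / 2.
  have g0 k : grid phi n 0 (0 + k) = w + rinj rho * omega n ^+ k.
    rewrite /grid mul0r /phi /c subr0 rmorph1 !mul1r mul0r addr0.
    by rewrite omegaX.
  have gK k : nc (quot w (w + rinj rho * omega n ^+ k)) <= K.
    rewrite /quot ncM ncV ler_pdivrMr ?hK //.
      by rewrite addrC addKr ncM ncX nc_omega expr1n mulr1 nc_real gtr0_norm.
    by rewrite addrC addKr ncM ncX nc_omega expr1n mulr1 nc_real gtr0_norm.
  have step k : nc (w + rinj rho * omega n ^+ k.+1 - (w + rinj rho * omega n ^+ k)) <= rho * (L / N%:R).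
    have -> : w + rinj rho * omega n ^+ k.+1 - (w + rinj rho * omega n ^+ k) =
       rinj rho * (omega n ^+ k.+1 - omega n ^+ k) by ring.
    rewrite ncM nc_real gtr0_norm //; apply: ler_wpM2l; first exact: ltW.
    rewrite !omegaX; apply: le_trans (cisL _ _) _; rewrite ler_wpM2l ?(ltW L0) //.
    by rewrite -mulrBl -natrB // subSnn mul1r NE ger0_norm // invr_ge0 ltW.
  apply: le_trans (nc_sum _ _ _) _.
  apply: le_trans (_ : _ <= \sum_(k < N) (2 * K) * (rho * (L / N%:R))) _.
    apply: ler_sum => k _; rewrite -addnS !g0 ncM; apply: ler_pM; rewrite ?nc_ge0 //.
    by apply: le_trans (ler_ncD _ _) _; rewrite mulr_natl mulr2n lerD.
  rewrite sumr_const card_ord -[_ *+ N]mulr_natl.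
  have -> : N%:R * (2 * K * (rho * (L / N%:R))) = 2 * (K * L) * rho.
    by field; rewrite gt_eqF.
  apply: le_trans (_ : _ <= 2 * (K * L) * (e / (4 * K * L + 1))) _.
    by apply: ler_wpM2l => //; rewrite mulr_ge0.
  by rewrite [_ * (e / _)]mulrA ler_pdivrMr //; lra.
move=> h; have := ler_ncD_sub S (vsum (quot w) phi n 0 0 N); lra.
Qed.

Lemma zeta_neq0 n k : zeta n k != 0.
Proof. by rewrite -nc_gt0 nc_zeta. Qed.
Lemma zeta_order n : zeta n (2 ^ n) = zeta n 0.
Proof. by rewrite /zeta omega_order expr0. Qed.

(** On a regular polygon the trapezoidal sums are, up to a common factor, the
    sums of z g(z): a summation by parts, without boundary term because the
    polygon is closed. *)
Lemma trap_circle (g : C -> C) n :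
  \sum_(k < 2 ^ n) trap g (zeta n k) (zeta n k.+1) =
  (omega n - (omega n)^-1) * \sum_(k < 2 ^ n) g (zeta n k) * zeta n k.
Proof.
have shift (u : nat -> C) N : u N = u 0%N -> \sum_(k < N) u k.+1 = \sum_(k < N) u k.
  case: N => [|N] h; first by rewrite !big_ord0.
  by rewrite big_ord_recr [RHS]big_ord_recl /= h addrC.
pose u k := g (zeta n k) * zeta n k.
transitivity ((omega n - 1) * \sum_(k < 2 ^ n) u k +
    (1 - (omega n)^-1) * \sum_(k < 2 ^ n) u k.+1); last first.
  by rewrite shift; [rewrite -mulrDl; congr (_ * _); ring|rewrite /u zeta_order].
rewrite !mulr_sumr -big_split; apply: eq_bigr => k _; rewrite /trap /u /=.
have -> : zeta n k.+1 = omega n * zeta n k by rewrite /zeta exprS; ring.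
set x := g _; set y := g _; set z := zeta n k.
have -> : (1 - (omega n)^-1) * (y * (omega n * z)) =
    y * z * (omega n - (omega n)^-1 * omega n) by ring.
by rewrite mulVf ?omega_neq0 //; ring.
Qed.

Let mean n (g : C -> C) : C := ((2 ^ n)%:R)^-1 * \sum_(k < 2 ^ n) g (zeta n k).

Lemma N_neq0 n : ((2 ^ n)%:R : C) != 0.
Proof. by rewrite pnatr_eq0 -lt0n expn_gt0. Qed.

Lemma nc_mean n g (K : R) : (forall k : 'I_(2 ^ n), nc (g (zeta n k)) <= K) ->
  nc (mean n g) <= K.
Proof.
move=> h; have N0 : 0 < (2 ^ n)%:R :> R by rewrite ltr0n expn_gt0.
rewrite ncM ncV nc_nat ler_pdivrMl //; apply: le_trans (nc_sum _ _ _) _.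
apply: le_trans (ler_sum _ (fun k _ => h k)) _.
by rewrite sumr_const card_ord mulr_natl.
Qed.

Lemma mean_quot_lim w : nc w < r -> (fun n => mean n (fun z => quot w z * z)) @ \oo --> (0 : C).
Proof.
move=> wr; apply: (cvgcP _ _).2 => e e0.
have e4 : 0 < 4 * e by lra.
have [n0 hn0] := circle_deform wr e4.
exists n0.+2 => -[//|[//|n]]; rewrite !ltnS => hn.
have := hn0 n.+2; rewrite trap_circle ncM (leq_trans hn) ?leqW // => /(_ isT).
rewrite subr0 ncM ncV nc_nat natrX; have := @omega_gap R C n.
set g := nc (_ - _); set S := nc _; set N := 2 ^+ n.+2 => h1 h2.
have N0 : 0 < N :> R by rewrite exprn_gt0.
rewrite ltr_pdivrMl //.
have S0 : 0 <= S by apply: nc_ge0.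
have h3 : 8 * S <= N * g * S by apply: ler_wpM2r.
have h4 : N * (g * S) <= N * (4 * e) by rewrite ler_wpM2l // ltW.
have h5 : 0 < N * e by rewrite mulr_gt0.
by move: h3 h4; rewrite -mulrA; lra.
Qed.

Let coef n j : C := mean n (fun z => f z * (rinj r / z) ^+ j).
Let kern n w : C := mean n (fun z => f z * (1 - w / z)^-1).

Lemma nc_coef n j : nc (coef n j) <= M.
Proof.
apply: nc_mean => k; rewrite ncM ncX ncM ncV nc_zeta nc_real gtr0_norm //.
by rewrite divff ?gt_eqF // expr1n mulr1 f_zeta.
Qed.

(** Expansion of the Cauchy kernel in a geometric series, for each mean over a
    polygon. *)
Lemma mean_has_sum n (g : C -> C) w : nc w < r ->
  has_sum (fun j => mean n (fun z => g z * (rinj r / z) ^+ j) * (w / rinj r) ^+ j)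
     (mean n (fun z => g z * (1 - w / z)^-1)).
Proof.
move=> wr; have hr0 := r0.
have h (k : 'I_(2 ^ n)) : has_sum (fun j => g (zeta n k) * (w / zeta n k) ^+ j)
    (g (zeta n k) * (1 - w / zeta n k)^-1).
  apply: has_sumM; apply: has_sum_geometric.
  by rewrite ncM ncV nc_zeta ltr_pdivrMr // mul1r.
have := has_sumM (c := ((2 ^ n)%:R)^-1) (has_sum_sum (r := index_enum _) h).
rewrite /mean; congr has_sum; apply/funext => j.
rewrite -[RHS]mulrA; congr (_ * _); rewrite mulr_suml; apply: eq_bigr => k _.
rewrite -mulrA -exprMn; congr (_ * _ ^+ _).
have rr : rinj r != 0 :> C by rewrite fmorph_eq0 gt_eqF.
by rewrite mulrACA [_^-1 * _]mulrC mulrACA divff // mul1r.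
Qed.

Lemma mean_root n j : mean n (fun z => 1 * (rinj r / z) ^+ j) = ((2 ^ n %| j)%N)%:R.
Proof.
rewrite /mean.
have -> : \sum_(k < 2 ^ n) 1 * (rinj r / zeta n k) ^+ j =
    \sum_(k < 2 ^ n) ((omega n ^+ j)^-1) ^+ k.
  apply: eq_bigr => k _; rewrite mul1r /zeta invfM mulrA divff; last by rewrite fmorph_eq0 gt_eqF.
  by rewrite mul1r !exprVn exprAC.
case: ifP (@omega_sum R C n j) => h _.
  have -> : omega n ^+ j = 1 by rewrite -(divnK h) mulnC exprM omega_order expr1n.
  rewrite invr1; under eq_bigr do rewrite expr1n.
  by rewrite sumr_const card_ord mulVf ?N_neq0.
suff -> : \sum_(k < 2 ^ n) ((omega n ^+ j)^-1) ^+ k = 0 by rewrite mulr0.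
apply/eqP; have := subrX1 ((omega n ^+ j)^-1) (2 ^ n).
rewrite exprVn exprAC omega_order expr1n invr1 subrr => /eqP.
by rewrite eq_sym mulf_eq0 subr_eq0 invr_eq1 (negbTE (omega_neq1 C (negbT h))).
Qed.

(** Cauchy's integral formula as a limit of means. Split f(z) into f(w) and
    (f(z) - f(w)); the first part is explicit since the means of powers of z
    vanish unless 2^n divides the exponent, the second is the sum handled by
    [mean_quot_lim]. *)
Lemma kern_lim w : nc w < r -> (fun n => kern n w) @ \oo --> f w.
Proof.
move=> wr; have hr0 := r0.
pose D n : C := mean n (fun z => 1 * (1 - w / z)^-1).
have hq : 0 <= nc w / r < 1 by rewrite divr_ge0 ?nc_ge0 ?(ltW r0) //= ltr_pdivrMr // mul1r.
have hD : D @ \oo --> (1 : C).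
  apply: (@tannery R C (fun n j => ((2 ^ n %| j)%N)%:R * (w / rinj r) ^+ j)
     (fun j => (j == 0%N)%:R) D 1 1 (nc w / r)) => //.
  - move=> n j; rewrite ncM ncX ncM ncV nc_real gtr0_norm //.
    rewrite ler_wpM2r ?exprn_ge0 //; first by case/andP: hq.
    by case: (_ %| _)%N; rewrite ?nc1 ?nc0 ?ler01.
  - move=> j; have [->|j0] := posnP j.
      by under eq_fun do rewrite dvdn0 expr0 mulr1; apply: cvgc_cst.
    apply: (@cvgc_near R C (fun=> 0) _ _ j); last exact: cvgc_cst.
    move=> n jn; rewrite gtnNdvd ?mul0r //.
    by apply: leq_ltn_trans jn _; apply: ltn_expl.
  - by move=> n; have := mean_has_sum (n := n) (g := fun=> 1) wr; under eq_fun do rewrite mean_root.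
  - apply: (@cvgc_near R C (fun=> 1) _ _ 1%N); last exact: cvgc_cst.
    by move=> [//|n] _; rewrite big_ord_recl /= big1 ?addr0.
have hE n : kern n w = f w * D n + mean n (fun z => quot w z * z).
  rewrite /kern /D /mean mulrCA -mulrDr; congr (_ * _); rewrite mulr_sumr -big_split.
  apply: eq_bigr => k _; rewrite /quot /=.
  have z0 := zeta_neq0 n k; have zw : zeta n k - w != 0.
    rewrite -nc_gt0; apply: lt_le_trans (ler_ncD_sub _ _).
    by rewrite nc_zeta subr_gt0.
  have -> : 1 - w / zeta n k = (zeta n k - w) / zeta n k by rewrite mulrBl divff.
  by field; rewrite zw z0.
rewrite (funext hE) -[X in _ --> X]addr0 -[X in _ --> X + _]mulr1.
by apply: cvgcD; [apply: cvgcM => //; apply: cvgc_cst|apply: mean_quot_lim].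
Qed.

Lemma cvgc_cauchyE (u : nat -> C) (l : C) : u @ \oo --> l ->
  forall e : R, 0 < e -> exists N, forall n, (N <= n)%N -> nc (u n - u N) < e.
Proof.
move=> /cvgcP h e e0; have e2 : 0 < e / 2 by lra.
have [N hN] := h _ e2; exists N => n hn.
have -> : u n - u N = (u n - l) - (u N - l) by ring.
apply: le_lt_trans (ler_ncB _ _) _.
by have := hN n hn; have := hN N (leqnn N); lra.
Qed.

(** Convergence of the means that define the Taylor coefficients follows from
    that of the Cauchy means at nonzero points, by induction on j: evaluate at
    w = r q for a small q, subtract the terms of lower order, whose limits are
    known, and divide by q^j. The terms of higher order are O(q). *)
Lemma coef_cvg j : exists l : C, (fun n => coef n j) @ \oo --> l.
Proof.
have hr0 := r0; have hM0 := M0.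
elim/ltn_ind: j => j IH.
have [l hl] : exists l : nat -> C, forall i, (i < j)%N -> (fun n => coef n i) @ \oo --> l i.
  have /choice[l hl] : forall i, exists l : C, (i < j)%N -> (fun n => coef n i) @ \oo --> l.
    move=> i; have [/IH[l hl]|//] := boolP (i < j)%N; first by exists l.
    by exists 0.
  by exists l.
apply: cvgc_cauchy => e e0.
(* Small enough for the two remainders, each at most 2 M q after division by
   q^j, to add up to e / 2. *)
pose q : R := e / (8 * M + 2 * e + 1).
have den : 0 < 8 * M + 2 * e + 1 by lra.
have q0 : 0 < q by rewrite divr_gt0.
have q2 : q <= 1 / 2 by rewrite ler_pdivrMr //; lra.
have Mq : 8 * M * q <= e.
  by rewrite mulrA ler_pdivrMr // mulrC ler_wpM2l ?(ltW e0) //; lra.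
pose w : C := rinj (r * q).
have wr : nc w < r.
  rewrite nc_real ger0_norm; last by rewrite mulr_ge0 // ltW.
  by rewrite gtr_pMr //; lra.
have wE : w / rinj r = rinj q.
  by rewrite /w rmorphM mulrAC divff ?mul1r // fmorph_eq0 gt_eqF.
have hsum n : has_sum (fun i => coef n i * rinj q ^+ i) (kern n w).
  by have := mean_has_sum (n := n) (g := f) wr; rewrite wE.
pose E n := kern n w - \sum_(i < j) coef n i * rinj q ^+ i.
have hE : E @ \oo --> f w - \sum_(i < j) l i * rinj q ^+ i.
  apply: cvgcB; first exact: kern_lim.
  apply: (@cvgc_sum R C _ _ (fun (i : 'I_j) n => coef n i * rinj q ^+ i)) => i.
  by apply: cvgcM; [apply: hl|apply: cvgc_cst].
have qj0 : 0 < q ^+ j by rewrite exprn_gt0.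
have hq1 : 0 <= q < 1 by apply/andP; split; lra.
have dist n : nc (coef n j * rinj q ^+ j - E n) <= 2 * M * q * q ^+ j.
  have -> : coef n j * rinj q ^+ j - E n =
     - (kern n w - \sum_(i < j.+1) coef n i * rinj q ^+ i).
    by rewrite /E big_ord_recr /=; ring.
  rewrite ncN.
  have hb i : nc (coef n i * rinj q ^+ i) <= M * q ^+ i.
    rewrite ncM ncX nc_real gtr0_norm // ler_wpM2r ?exprn_ge0 ?(ltW q0) //.
    exact: nc_coef.
  apply: le_trans (has_sum_tail j.+1 hq1 hM0 hb (hsum n)) _.
  rewrite exprS mulrA; apply: ler_wpM2r; first exact: ltW.
  apply: ler_wpM2r; first exact: ltW.
  by rewrite ler_pdivrMr; [nra|lra].
have e2 : 0 < e / 2 * q ^+ j by rewrite mulr_gt0 //; lra.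
have [N hN] := cvgc_cauchyE hE e2.
exists N => n hn.
have : nc ((coef n j - coef N j) * rinj q ^+ j) < e * q ^+ j.
  have -> : (coef n j - coef N j) * rinj q ^+ j = (coef n j * rinj q ^+ j - E n)
     - (coef N j * rinj q ^+ j - E N) + (E n - E N) by ring.
  apply: le_lt_trans (ler_ncD _ _) _.
  have := ler_ncB (coef n j * rinj q ^+ j - E n) (coef N j * rinj q ^+ j - E N).
  have := hN n hn; have := dist n; have := dist N.
  have : 8 * M * q * q ^+ j <= e * q ^+ j by rewrite ler_wpM2r // ltW.
  by lra.
by rewrite ncM ncX nc_real gtr0_norm // ltr_pM2r.
Qed.

Lemma power_series_center0 : exists b : nat -> C, (forall j, nc (b j) <= M) /\
  forall w, nc w < r -> has_sum (fun j => b j * (w / rinj r) ^+ j) (f w).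
Proof.
have /choice[b hb] := coef_cvg; exists b; split=> [j|w wr].
  by apply: (cvgc_le (hb j)) => n; apply: nc_coef.
have hq : 0 <= nc w / r < 1 by rewrite divr_ge0 ?nc_ge0 ?(ltW r0) //= ltr_pdivrMr // mul1r.
apply: (@tannery_sum R C (fun n j => coef n j * (w / rinj r) ^+ j) _ (fun n => kern n w) _ M (nc w / r)) => //.
- move=> n j; rewrite ncM ncX ncM ncV nc_real gtr0_norm // ler_wpM2r ?nc_coef //.
  by rewrite exprn_ge0 //; case/andP: hq.
- by move=> j; apply: cvgcM => //; apply: cvgc_cst.
- by move=> n; apply: mean_has_sum.
- exact: kern_lim.
Qed.

End Disc.

Lemma power_series (f : C -> C) (z0 : C) (R0 r M : R) : 0 < r -> r < R0 ->
  (forall z, nc (z - z0) < R0 -> cdiffable f z) ->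
  (forall x : R, 0 <= x <= 1 -> nc (f (z0 + rinj r * cis x)) <= M) ->
  exists b : nat -> C, (forall j, nc (b j) <= M) /\
    forall t, nc t < r -> has_sum (fun j => b j * (t / rinj r) ^+ j) (f (z0 + t)).
Proof.
move=> r0 rR fd fb.
apply: (@power_series_center0 (fun t => f (z0 + t)) R0) => // z hz.
by apply: cdiffable_shift; apply: fd; rewrite addrC addKr.
Qed.

(** A differentiable function is continuous, hence bounded on a circle. *)
Lemma circle_bounded (f : C -> C) (z0 : C) (r : R) :
  (forall x : R, cdiffable f (z0 + rinj r * cis x)) ->
  exists M : R, forall x : R, 0 <= x <= 1 -> nc (f (z0 + rinj r * cis x)) <= M.
Proof.
move=> fd; pose g (x : R) : R := nc (f (z0 + rinj r * cis x)).
have gc : continuous (g : R^o -> R^o).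
  move=> x; apply/(@cvgrPdistC_le R R^o) => e e0.
  have [del del0 [K K0 hK]] := cdiffable_bounded (fd x).
  have [L L0 cisL] : exists2 L : R, 0 < L & forall x y, nc (cis x - cis y) <= L * `|x - y|.
    by exists (pi * 4); [rewrite mulr_gt0 ?pi_gt0|apply: cis_lip].
  pose c := `|r| * L + 1; have c0 : 0 < c by rewrite ltr_wpDl // mulr_ge0 // ltW.
  pose d := Num.min (del / c) (e / (c * K + 1)).
  have cK : 0 < c * K + 1 by rewrite ltr_wpDl // mulr_ge0 // ltW.
  have d0 : 0 < d by rewrite lt_min !divr_gt0.
  apply/(@nbhs_ballP _ R^o); exists d => //= y; rewrite /ball /= => hy.
  have hz : nc (z0 + rinj r * cis y - (z0 + rinj r * cis x)) <= c * `|x - y|.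
    have -> : z0 + rinj r * cis y - (z0 + rinj r * cis x) = rinj r * (cis y - cis x) by ring.
    rewrite ncM nc_real; have := cisL y x; rewrite distrC => h.
    have h2 := ler_wpM2l (normr_ge0 r) h; apply: le_trans h2 _.
    by rewrite /c mulrDl mul1r mulrA lerDl.
  have hd1 : c * `|x - y| < del.
    rewrite mulrC -ltr_pdivlMr //; apply: lt_le_trans hy _.
    by rewrite /d ge_min lexx.
  have hd2 : (c * K + 1) * `|x - y| <= e.
    rewrite mulrC -ler_pdivlMr //; apply: le_trans (ltW hy) _.
    by rewrite /d ge_min lexx orbT.
  have h1 := hK _ (le_lt_trans hz hd1).
  have h2 : K * nc (z0 + rinj r * cis y - (z0 + rinj r * cis x)) <= K * (c * `|x - y|).
    exact: ler_wpM2l.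
  have h3 := ler_ncD_sub (f (z0 + rinj r * cis y)) (f (z0 + rinj r * cis x)).
  have h4 := ler_ncD_sub (f (z0 + rinj r * cis x)) (f (z0 + rinj r * cis y)).
  rewrite nc_sym in h4; have h5 : 0 <= `|x - y| by [].
  rewrite ler_norml /g; apply/andP; split; lra.
have [c _ hc] := @EVT_max R g 0 1 ler01 (continuous_subspaceT gc).
by exists (g c) => x hx; apply: hc; rewrite in_itv.
Qed.

End PowerSeries.

(** * Transfer of negative squares by approximation *)

Section Approx.
Variables (R : realType) (C : complex_plane R).

Lemma hform_conj (I : finType) (G : I -> I -> C) (u v : I -> C) :
  herm_kernel G -> (hform G u v)^* = hform G v u.
Proof.
move=> hG; rewrite /hform rmorph_sum exchange_big /=; apply: eq_bigr => a _.
rewrite rmorph_sum; apply: eq_bigr => b _.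
by rewrite !rmorphM /= conjCK -hG; ring.
Qed.

(** A case of the Cauchy-Schwarz inequality. *)
Lemma sqr_sum_le k (x : 'I_k -> R) :
  (\sum_p x p) ^+ 2 <= k%:R * \sum_p x p ^+ 2.
Proof.
have -> : (\sum_p x p) ^+ 2 = \sum_p \sum_q x p * x q.
  by rewrite expr2 mulr_suml; apply: eq_bigr => p _; rewrite mulr_sumr.
pose S := \sum_p x p ^+ 2; rewrite -/S.
have <- : \sum_(p < k) \sum_(q < k) (x p ^+ 2 / 2 + x q ^+ 2 / 2) = k%:R * S.
  under eq_bigr do rewrite big_split /= sumr_const card_ord.
  rewrite big_split /= sumr_const card_ord.
  under eq_bigr do rewrite -mulrnAl -mulr_natl -mulrA.
  rewrite -[X in _ + X]mulr_natl -mulr_sumr -mulrDr; congr (_ * _).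
  by rewrite -mulr_suml /S; lra.
apply: ler_sum => p _; apply: ler_sum => q _.
have := sqr_ge0 (x p - x q); rewrite sqrrB; lra.
Qed.

(** If all entries of H + 1 have absolute value at most 1 / (k + 1), then the
    form of H + 1 is at most k / (k + 1) times the square of the norm, by
    Cauchy-Schwarz. *)
Lemma near_neg_identity k (H : 'I_k -> 'I_k -> C) (x : 'I_k -> C) :
  herm_kernel H ->
  (forall p q, nc (H p q + (p == q)%:R) <= (k.+1%:R)^-1) ->
  (exists p, x p != 0) -> hform H x x < 0.
Proof.
move=> hH hn hx.
pose S : R := \sum_p nc (x p) ^+ 2.
have SE : \sum_p x p * (x p)^* = rinj S.
  by rewrite rmorph_sum; apply: eq_bigr => p _; rewrite mul_conj_nc.
have S0 : 0 < S by rewrite -(@ltc0_real R C) -SE; apply: sum_norm2_gt0.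
pose e : C := \sum_p \sum_q x p * (H p q + (p == q)%:R) * (x q)^*.
have eE : hform H x x = e - rinj S.
  rewrite -SE -sumrB; apply: eq_bigr => p _.
  have -> : x p * (x p)^* = \sum_q (p == q)%:R * (x p * (x q)^* ).
    rewrite (bigD1 p) //= eqxx mul1r big1 ?addr0 // => q.
    by rewrite eq_sym => /negbTE ->; rewrite mul0r.
  by rewrite -sumrB; apply: eq_bigr => q _; ring.
have ereal : e \is Num.real.
  have -> : e = hform H x x + rinj S by rewrite eE subrK.
  rewrite CrealE rmorphD /= hform_conj //; apply/eqP; congr (_ + _).
  by rewrite -SE rmorph_sum; apply: eq_bigr => p _; rewrite rmorphM /= conjCK mulrC.
rewrite eE subr_lt0; apply: le_lt_trans (real_ler_norm ereal) _.
rewrite normE ltr_rinj.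
have k0 : 0 < k.+1%:R :> R by rewrite ltr0n.
have h1 : nc e <= (k.+1%:R)^-1 * \sum_(p < k) \sum_(q < k) nc (x p) * nc (x q).
  rewrite mulr_sumr; apply: le_trans (nc_sum _ _ _) _; apply: ler_sum => p _.
  rewrite mulr_sumr; apply: le_trans (nc_sum _ _ _) _; apply: ler_sum => q _.
  rewrite !ncM nc_conj mulrAC mulrC ler_wpM2r ?mulr_ge0 ?nc_ge0 //.
apply: le_lt_trans h1 _; rewrite ltr_pdivrMl //.
have h2 : \sum_(p < k) \sum_(q < k) nc (x p) * nc (x q) <= k%:R * S.
  have := sqr_sum_le (fun p => nc (x p)); rewrite expr2 mulr_suml.
  by under eq_bigr do rewrite mulr_sumr.
apply: le_lt_trans h2 _.
by rewrite ltr_pM2r // ltr_nat.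
Qed.

(** A frame whose Gram matrix is minus the identity for the limit has a Gram
    matrix close to it for large N. *)
Lemma negsub_lim (I : finType) (G : nat -> I -> I -> C) (G' : I -> I -> C) k :
  herm_kernel G' -> (forall N, herm_kernel (G N)) ->
  (forall a b, (fun N => G N a b) @ \oo --> G' a b) ->
  negsub G' k -> exists N, negsub (G N) k.
Proof.
move=> hG' hG hlim /(negsub_negframe hG')[W hW].
have hl p q : (fun N => hform (G N) (W p) (W q) + (p == q)%:R) @ \oo --> (0 : C).
  rewrite -(addNr ((p == q)%:R : C)) -hW; apply: cvgcD; last exact: cvgc_cst.
  apply: cvgc_sum => a.
  apply: (@cvgc_sum R C _ _ (fun b N => W p a * G N a b * (W q b)^* )) => b.
  by apply: cvgcM; [apply: cvgcM => //; apply: cvgc_cst|apply: cvgc_cst].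
have e0 : 0 < (k.+1%:R)^-1 :> R by rewrite invr_gt0 ltr0n.
have /choice[n hn] : forall pq : 'I_k * 'I_k, exists n, forall N, (n <= N)%N ->
    nc (hform (G N) (W pq.1) (W pq.2) + (pq.1 == pq.2)%:R) < (k.+1%:R)^-1.
  move=> [p q]; have /cvgcP/(_ _ e0)[n hn] := hl p q.
  by exists n => N /hn /=; rewrite subr0.
pose N := \max_pq n pq; exists N, W => x hx /=; rewrite hform_comb.
apply: near_neg_identity => // [p q|p q].
  by rewrite hform_conj.
by apply/ltW; apply: (hn (p, q)); apply: (leq_bigmax (p, q)).
Qed.

(** B is the Gram kernel of the pairs of feature vectors (X t, Y t) for the
    indefinite inner product X . X - Y . Y. *)
Definition has_form (T : Type) (A : set T) (X Y : T -> nat -> C) (B : T -> T -> C) :=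
  forall s t, A s -> A t -> has_sum (fun l => X s l * (X t l)^* - Y s l * (Y t l)^* ) (B s t).

(** The pair of feature vectors (x, y) is a limit of combinations of those at
    points of A. The convergence is termwise with a common geometric majorant,
    which is what dominated convergence of the Gram series asks for. *)
Definition approximable (T : Type) (A : set T) (X Y : T -> nat -> C) (x y : nat -> C) :=
  exists (K q : R) (n : nat -> nat) (c : nat -> nat -> C) (u : nat -> nat -> T),
   [/\ 0 <= q < 1, 0 <= K,
     (forall N k, (k < n N)%N -> A (u N k)),
     (forall l, (forall N, nc (\sum_(k < n N) c N k * X (u N k) l) <= K * q ^+ l) /\
                (fun N => \sum_(k < n N) c N k * X (u N k) l) @ \oo --> x l) &
     (forall l, (forall N, nc (\sum_(k < n N) c N k * Y (u N k) l) <= K * q ^+ l) /\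
                (fun N => \sum_(k < n N) c N k * Y (u N k) l) @ \oo --> y l)].

Lemma approximableC (T : Type) (A : set T) X Y x y :
  @approximable T A X Y x y -> @approximable T A Y X y x.
Proof. by move=> [K [q [n [c [u [h1 h2 h3 h4 h5]]]]]]; exists K, q, n, c, u; split. Qed.

Lemma has_formN (T : Type) (A : set T) X Y B :
  @has_form T A X Y B -> has_form A Y X (fun s t => - B s t).
Proof.
move=> h s t hs ht; have := has_sumM (c := -1) (h s t hs ht).
by rewrite mulN1r; under eq_fun do rewrite mulN1r opprB.
Qed.

Section Transfer.
Variables (T T' : Type) (A : set T) (A' : set T').
Variables (X Y : T -> nat -> C) (X' Y' : T' -> nat -> C).
Variables (B : T -> T -> C) (B' : T' -> T' -> C).
Hypotheses (hB : herm_kernel B) (hB' : herm_kernel B').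
Hypotheses (fB : has_form A X Y B) (fB' : has_form A' X' Y' B').
Hypothesis approx : forall t, A' t -> approximable A X Y (X' t) (Y' t).

(** Replace the points of A' by approximating combinations of points of A. The
    Gram matrix of the combinations converges to the given one, hence has as
    many negative squares for large N; its vectors are combinations of points
    of A. *)
Lemma negsq_approx k : negsq A' B' k -> negsq A B k.
Proof.
move=> [I [w [wA hw]]].
have /choice[K hap1] := fun a => approx (wA a).
have /choice[q hap2] := hap1; have /choice[n hap3] := hap2.
have /choice[c hap4] := hap3; have /choice[u hap] := hap4 => {hap1 hap2 hap3 hap4}.
pose Z (V : T -> nat -> C) a N l := \sum_(i < n a N) c a N i * V (u a N i) l.
pose G N a b := \sum_(i < n a N) \sum_(j < n b N)
  c a N i * B (u a N i) (u b N j) * (c b N j)^*.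
have hG N : herm_kernel (G N).
  move=> a b; rewrite /G rmorph_sum exchange_big /=; apply: eq_bigr => i _.
  rewrite rmorph_sum; apply: eq_bigr => j _.
  by rewrite !rmorphM /= conjCK -hB; ring.
have Gsum N a b : has_sum (fun l => Z X a N l * (Z X b N l)^* - Z Y a N l * (Z Y b N l)^* ) (G N a b).
  have -> : (fun l => Z X a N l * (Z X b N l)^* - Z Y a N l * (Z Y b N l)^* ) =
     (fun l => \sum_(i < n a N) \sum_(j < n b N) c a N i * (c b N j)^* *
       (X (u a N i) l * (X (u b N j) l)^* - Y (u a N i) l * (Y (u b N j) l)^* )).
    apply/funext => l; rewrite /Z !rmorph_sum !mulr_suml -sumrB; apply: eq_bigr => i _.
    rewrite !mulr_sumr -sumrB; apply: eq_bigr => j _.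
    by rewrite !rmorphM /=; ring.
  have -> : G N a b = \sum_(i < n a N) \sum_(j < n b N) c a N i * (c b N j)^* * B (u a N i) (u b N j).
    by apply: eq_bigr => i _; apply: eq_bigr => j _; ring.
  apply: has_sum_sum => i; apply: has_sum_sum => j; apply: has_sumM.
  by apply: fB; [case: (hap a) => _ _ h _ _|case: (hap b) => _ _ h _ _]; apply: h.
have Glim a b : (fun N => G N a b) @ \oo --> B' (w a) (w b).
  have [qa Ka _ Xa Ya] := hap a; have [qb Kb _ Xb Yb] := hap b.
  have qab : 0 <= q a * q b < 1.
    move: qa qb => /andP[a1 a2] /andP[b1 b2]; rewrite mulr_ge0 //=.
    by apply: le_lt_trans b2; apply: ler_piMl => //; apply: ltW.
  apply: (@tannery R C _ _ _ _ (2 * (K a * K b)) (q a * q b) qab _ _ _ (fun N => Gsum N a b)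
     (fB' (wA a) (wA b))).
  - by rewrite mulr_ge0 ?mulr_ge0.
  - move=> N l; apply: le_trans (ler_ncB _ _) _; rewrite !ncM !nc_conj exprMn.
    have h1 : nc (Z X a N l) * nc (Z X b N l) <= (K a * q a ^+ l) * (K b * q b ^+ l).
      by apply: ler_pM; rewrite ?nc_ge0 //; [apply: (Xa l).1|apply: (Xb l).1].
    have h2 : nc (Z Y a N l) * nc (Z Y b N l) <= (K a * q a ^+ l) * (K b * q b ^+ l).
      by apply: ler_pM; rewrite ?nc_ge0 //; [apply: (Ya l).1|apply: (Yb l).1].
    by apply: le_trans (lerD h1 h2) _; rewrite le_eqVlt; apply/orP; left; apply/eqP; ring.
  - move=> l; apply: cvgcB; apply: cvgcM; try apply: cvgc_conj.
    + exact: (Xa l).2.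
    + exact: (Xb l).2.
    + exact: (Ya l).2.
    + exact: (Yb l).2.
have hBw : herm_kernel (fun a b => B' (w a) (w b)) by move=> a b; apply: hB'.
have [N hN] := negsub_lim hBw hG Glim hw.
(* The points used for all indices a, put together in a disjoint union. *)
exists {a : I & 'I_(n a N)}, (fun p => u (tag p) N (tagged p : 'I_(n (tag p) N))); split.
  by move=> [a i] /=; case: (hap a) => _ _ h _ _; apply: h.
move: hN => [W hW]; exists (fun p s => W p (tag s) * c (tag s) N (tagged s : 'I_(n (tag s) N))) => x hx /=.
have := hW x hx; rewrite /=; congr (_ < _).
pose U a := \sum_p x p * W p a.
have hU (s : {a : I & 'I_(n a N)}) :
   \sum_p x p * (W p (tag s) * c (tag s) N (tagged s : 'I_(n (tag s) N))) = U (tag s) * c (tag s) N (tagged s : 'I_(n (tag s) N)).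
  by rewrite /U mulr_suml; apply: eq_bigr => p _; rewrite mulrA.
rewrite /hform.
transitivity (\sum_a \sum_b U a * G N a b * (U b)^* ); first by [].
transitivity (\sum_a \sum_(i < n a N) \sum_b \sum_(j < n b N)
   (U a * c a N i) * B (u a N i) (u b N j) * (U b * c b N j)^* ).
  apply: eq_bigr => a _; rewrite [RHS]exchange_big /=; apply: eq_bigr => b _.
  rewrite /G mulr_sumr mulr_suml; apply: eq_bigr => i _.
  rewrite mulr_sumr mulr_suml; apply: eq_bigr => j _.
  by rewrite rmorphM /=; ring.
rewrite sig_big_dep /=; apply: eq_bigr => s _; rewrite sig_big_dep /=.
by apply: eq_bigr => t _; rewrite !hU.
Qed.

End Transfer.

Lemma negsq_approxN (T T' : Type) (A : set T) (A' : set T') X Y X' Y' B B' :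
  herm_kernel B -> herm_kernel B' ->
  @has_form T A X Y B -> @has_form T' A' X' Y' B' ->
  (forall t, A' t -> approximable A X Y (X' t) (Y' t)) ->
  forall k, negsq A' (fun s t => - B' s t) k -> negsq A (fun s t => - B s t) k.
Proof.
move=> hB hB' fB fB' ap; apply: (negsq_approx (X := Y) (Y := X) (X' := Y') (Y' := X')).
- by move=> a b; rewrite hB rmorphN.
- by move=> a b; rewrite hB' rmorphN.
- exact: has_formN.
- exact: has_formN.
- by move=> t /ap /approximableC.
Qed.

End Approx.

(** * Feature vectors of points and of jets *)

Section Feature.
Variables (R : realType) (C : complex_plane R).
Local Notation omega := (@omega R C).
Local Notation cis := (@cis R C).

(** Features of points, from 1 / (1 - s conj t) = sum_l s^l conj(t)^l. *)
Definition pt_x (w : C) (l : nat) : C := w ^+ l.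
Definition pt_y (F : C -> C) (w : C) (l : nat) : C := w ^+ l * F w.
(** Features of the orders of derivation: the Taylor coefficients of order i
    of z^l and, for [jet_y], of z^l S(z). *)
Definition jet_x (i l : nat) : C := (i == l)%:R.
Definition jet_y (a : nat -> C) (i l : nat) : C := if (l <= i)%N then a (i - l)%N else 0.

Lemma points_form (F : C -> C) :
  has_form [set w : C | nc w < 1] pt_x (pt_y F) (fun s t => schur_kernel F t s).
Proof.
move=> s t /= hs ht; rewrite /schur_kernel.
have h : nc (s * t^* ) < 1.
  rewrite ncM nc_conj; apply: le_lt_trans ht; apply: ler_piMl; rewrite ?nc_ge0 //.
  exact: ltW.
have := has_sumM (c := 1 - F s * (F t)^* ) (has_sum_geometric h).
congr has_sum; apply/funext => l; rewrite /pt_x /pt_y !rmorphM !rmorphXn exprMn /=.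
by ring.
Qed.

Lemma has_sum_near (f : nat -> C) (s : C) n0 :
  (forall n, (n0 <= n)%N -> \sum_(i < n) f i = s) -> has_sum f s.
Proof.
move=> h; apply: (@cvgc_near R C (fun=> s) _ _ n0); last exact: cvgc_cst.
by move=> n hn; rewrite h.
Qed.

Lemma jets_form (a : nat -> C) : has_form setT jet_x (jet_y a) (jet_kernel a).
Proof.
move=> i j _ _; apply: (@has_sum_near _ _ (i + j).+1) => n hn.
rewrite sumrB /jet_kernel; congr (_ - _).
  have hi : (i < n)%N by lia.
  rewrite (bigD1 (Ordinal hi)) //= big1 ?addr0.
    by rewrite /jet_x eqxx mul1r rmorph_nat eq_sym.
  move=> k; rewrite -val_eqE /= => ki; by rewrite /jet_x eq_sym (negbTE ki) mul0r.
have hm : ((minn i j).+1 <= n)%N by lia.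
rewrite [RHS](big_ord_widen n (fun l => a (i - l)%N * (a (j - l)%N)^* )) //.
rewrite [RHS]big_mkcond; apply: eq_bigr => l _; rewrite /jet_y ltnS leq_min.
by case: leqP => _; case: leqP => _; rewrite ?(mul0r, conjC0, mulr0).
Qed.

Lemma has_sum_shift (g : nat -> C) (s : C) l : has_sum g s ->
  has_sum (fun i => if (l <= i)%N then g (i - l)%N else 0) s.
Proof.
move=> h; apply: (cvgcP _ _).2 => e e0; have [N hN] := (cvgcP _ _).1 h e e0.
exists (N + l)%N => n hn; rewrite (_ : \sum_(i < n) _ = \sum_(i < n - l) g i).
  by apply: hN; lia.
rewrite -(big_mkord xpredT (fun i => if (l <= i)%N then g (i - l)%N else 0)).
rewrite (@big_cat_nat _ _ _ l) //=; last by lia.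
rewrite big_nat big1 ?add0r; last by move=> i /andP[_ il]; rewrite leqNgt il.
rewrite -{1}(add0n l) big_addn big_mkord; apply: eq_bigr => i _.
by rewrite leq_addl addnK.
Qed.

(** The limit of the linear functionals lam N applied to a power series with
    coefficients b, computed from the limit of their moments m N. *)
Lemma weights (b : nat -> C) (M K q : R) (m : nat -> nat -> C) (m' : nat -> C)
    (lam : nat -> C) (lam' : C) : 0 <= q < 1 -> 0 <= K -> 0 <= M ->
  (forall j, nc (b j) <= M) -> (forall N i, nc (m N i) <= K * q ^+ i) ->
  (forall i, (fun N => m N i) @ \oo --> m' i) ->
  (forall N, has_sum (fun i => b i * m N i) (lam N)) ->
  has_sum (fun i => b i * m' i) lam' ->
  (forall N, nc (lam N) <= M * K / (1 - q)) /\ lam @ \oo --> lam'.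
Proof.
move=> hq K0 M0 hb hm hlim hlam hlam'.
have MK : 0 <= M * K by rewrite mulr_ge0.
have hbm N i : nc (b i * m N i) <= M * K * q ^+ i.
  by rewrite ncM -mulrA; apply: ler_pM; rewrite ?nc_ge0.
split=> [N|].
  exact: (has_sum_le hq MK (hbm N)).
apply: (@tannery R C _ _ _ _ (M * K) q hq MK hbm _ hlam hlam') => i.
by apply: cvgcM => //; apply: cvgc_cst.
Qed.

(** Weights at the 2^N-th roots of unity for which the moments are g, up to
    the periodicity modulo 2^N: the inverse discrete Fourier transform. The
    exponent 2^N - j stands for -j. *)
Definition fourier N (g : nat -> C) k : C :=
  ((2 ^ N)%:R)^-1 * \sum_(j < 2 ^ N) g j * (omega N ^+ (2 ^ N - j)) ^+ k.

Lemma fourier_sum N g i :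
  \sum_(k < 2 ^ N) fourier N g k * (omega N ^+ k) ^+ i = g (i %% 2 ^ N)%N.
Proof.
have N0 : (0 < 2 ^ N)%N by rewrite expn_gt0.
transitivity (((2 ^ N)%:R)^-1 * \sum_(j < 2 ^ N) g j *
    \sum_(k < 2 ^ N) (omega N ^+ (2 ^ N - j + i)) ^+ k).
  rewrite mulr_sumr; under [RHS]eq_bigr do rewrite !mulr_sumr.
  rewrite [RHS]exchange_big /=; apply: eq_bigr => k _.
  rewrite /fourier mulr_sumr mulr_suml; apply: eq_bigr => j _.
  by rewrite exprD exprMn [(omega N ^+ i) ^+ k]exprAC; ring.
have hi : (i %% 2 ^ N < 2 ^ N)%N by rewrite ltn_mod.
rewrite (bigD1 (Ordinal hi)) //= [X in _ * (_ + X)]big1 ?addr0.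
  rewrite omega_sum.
  have -> : (2 ^ N %| 2 ^ N - i %% 2 ^ N + i)%N.
    rewrite {2}(divn_eq i (2 ^ N)) addnCA subnK; last exact: ltnW.
    by rewrite dvdn_add ?dvdn_mull.
  by rewrite mulrCA mulVf ?mulr1 // pnatr_eq0 -lt0n.
move=> j; rewrite -val_eqE /= => ji; rewrite omega_sum ifN ?mulr0 //.
apply: contra ji => /eqP h; apply/eqP.
have hj := ltn_ord j.
have : (2 ^ N - j + i + j = j %[mod 2 ^ N])%N by rewrite -modnDml h.
rewrite addnAC subnK; last exact: ltnW.
by rewrite modnDl [in RHS]modn_small // => ->.
Qed.

(** A power series about z1, normalized to the radius r, with the bound that
    Cauchy's estimates give for its coefficients. *)
Definition disc_rep (f : C -> C) (z1 : C) (r M : R) (b : nat -> C) :=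
  (forall j, nc (b j) <= M) /\
  forall t, nc t < r -> has_sum (fun j => b j * (t / rinj r) ^+ j) (f (z1 + t)).

(** A weighted sum of values on the circle of radius rho acts on the
    coefficients through the moments of the weights. *)
Lemma circle_functional f z1 r M b rho (g : nat -> nat -> C) N :
  0 < rho < r -> disc_rep f z1 r M b ->
  has_sum (fun i => b i * (rinj (rho / r) ^+ i * g N (i %% 2 ^ N)%N))
    (\sum_(k < 2 ^ N) fourier N (g N) k * f (z1 + rinj rho * omega N ^+ k)).
Proof.
move=> /andP[rho0 rhor] [_ h].
have ht k : nc (rinj rho * omega N ^+ k) < r.
  by rewrite ncM ncX nc_omega expr1n mulr1 nc_real gtr0_norm.
have hs (k : 'I_(2 ^ N)) := has_sumM (c := fourier N (g N) k) (h _ (ht k)).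
have := has_sum_sum (r := index_enum _) hs; congr has_sum; apply/funext => i.
rewrite -fourier_sum !mulr_sumr; apply: eq_bigr => k _.
rewrite rmorphM fmorphV /=.
have -> : rinj rho * omega N ^+ k / rinj r = rinj rho / rinj r * omega N ^+ k by rewrite mulrAC.
by rewrite exprMn; ring.
Qed.

Section Functional.
Variables (f : nat -> C -> C) (z1 : C) (r rho : R) (M : nat -> R) (b : nat -> nat -> C).
Hypotheses (hrho : 0 < rho < r) (hM : forall l, 0 <= M l).
Hypothesis hf : forall l, disc_rep (f l) z1 r (M l) (b l).

(** Weights with moments (t / rho)^i evaluate at z1 + t, in the limit where
    the periodicity modulo 2^N disappears. This holds even when t is outside
    the small circle: the moments grow like (|t| / rho)^i, but the
    coefficients on the circle decay like (rho / r)^i. *)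
Lemma evaluation_limit t l : nc t < r ->
  let q := Num.max rho (nc t) / r in
  let g N j := (t / rinj rho) ^+ j in
  let lam N := \sum_(k < 2 ^ N) fourier N (g N) k * f l (z1 + rinj rho * omega N ^+ k) in
  0 <= q < 1 /\ (forall N, nc (lam N) <= M l / (1 - q)) /\ lam @ \oo --> f l (z1 + t).
Proof.
move=> tr q g lam; have [rho0 rhor] := andP hrho.
have r0 : 0 < r by apply: lt_trans rhor.
have hq : 0 <= q < 1.
  rewrite divr_ge0 ?(ltW r0) ?le_max ?(ltW rho0) //=.
  by rewrite ltr_pdivrMr // mul1r gt_max rhor.
split=> //.
have rr : rinj rho != 0 :> C by rewrite fmorph_eq0 gt_eqF.
rewrite -{1}[M l]mulr1.
apply: (@weights (b l) (M l) 1 q (fun N i => rinj (rho / r) ^+ i * g N (i %% 2 ^ N)%N)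
   (fun i => (t / rinj r) ^+ i)) => //.
- by case: (hf l).
- move=> N i; rewrite mul1r ncM !ncX ncM ncV !nc_real !ger0_norm ?divr_ge0 ?(ltW rho0) ?(ltW r0) //.
  have [h|h] := lerP (nc t) rho.
    have q1 : q = rho / r by rewrite /q max_l.
    rewrite q1; apply: ler_piMr; first by rewrite exprn_ge0 // divr_ge0 ?(ltW rho0) ?(ltW r0).
    by rewrite exprn_ile1 ?divr_ge0 ?nc_ge0 ?(ltW rho0) // ler_pdivrMr // mul1r.
  have q1 : q = nc t / r by rewrite /q max_r // ltW.
  have -> : q ^+ i = (rho / r) ^+ i * (nc t / rho) ^+ i.
    by rewrite -exprMn q1; congr (_ ^+ _); field; rewrite !gt_eqF.
  apply: ler_wpM2l; first by rewrite exprn_ge0 // divr_ge0 ?(ltW rho0) ?(ltW r0).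
  by apply: ler_weXn2l; [rewrite ler_pdivlMr // mul1r ltW|apply: leq_mod].
- move=> i; apply: (@cvgc_near R C (fun=> (t / rinj r) ^+ i) _ _ i); last exact: cvgc_cst.
  move=> N hN; rewrite modn_small; last by apply: leq_ltn_trans hN _; apply: ltn_expl.
  by rewrite /g -exprMn rmorphM fmorphV /=; congr (_ ^+ _); rewrite [RHS]mulrC [RHS]mulrA divfK.
- by move=> N; apply: (circle_functional (g := g) (N := N) hrho (hf l)).
- by case: (hf l) => _; apply.
Qed.

(** With moments concentrated at i = j the same functionals extract the j-th
    coefficient. *)
Lemma jet_limit j l :
  let g (N i : nat) := (i == j)%:R * rinj (rho ^- j) : C in
  let lam N := \sum_(k < 2 ^ N) fourier N (g N) k * f l (z1 + rinj rho * omega N ^+ k) in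
  0 <= rho / r < 1 /\ (forall N, nc (lam N) <= M l * rho ^- j / (1 - rho / r))
  /\ lam @ \oo --> b l j * rinj (r ^- j).
Proof.
move=> g lam; have [rho0 rhor] := andP hrho.
have r0 : 0 < r by apply: lt_trans rhor.
have hq : 0 <= rho / r < 1.
  by rewrite divr_ge0 ?(ltW r0) ?(ltW rho0) //= ltr_pdivrMr // mul1r.
split=> //.
have rj : 0 <= rho ^- j by rewrite invr_ge0 exprn_ge0 // ltW.
apply: (@weights (b l) (M l) (rho ^- j) (rho / r) (fun N i => rinj (rho / r) ^+ i * g N (i %% 2 ^ N)%N)
   (fun i => (i == j)%:R * rinj (r ^- j))) => //.
- by case: (hf l).
- move=> N i; rewrite /g !ncM ncX !nc_real ger0_norm ?divr_ge0 ?(ltW rho0) ?(ltW r0) //.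
  rewrite ger0_norm // mulrC; apply: ler_wpM2r; first by rewrite exprn_ge0 // divr_ge0 ?(ltW rho0) ?(ltW r0).
  by case: eqP => _; rewrite ?nc1 ?mul1r ?nc0 ?mul0r.
- move=> i; apply: (@cvgc_near R C (fun=> (i == j)%:R * rinj (r ^- j)) _ _ i); last exact: cvgc_cst.
  move=> N hN; rewrite modn_small; last by apply: leq_ltn_trans hN _; apply: ltn_expl.
  rewrite /g; case: eqP => [->|_]; last by rewrite !mul0r mulr0.
  rewrite !mul1r -rmorphXn -rmorphM /=; congr (rinj _).
  by rewrite expr_div_n mulrAC divff ?mul1r // expf_neq0 // gt_eqF.
- by move=> N; apply: (circle_functional (g := g) (N := N) hrho (hf l)).
apply: (@has_sum_near _ _ j.+1) => n hn.
rewrite (bigD1 (Ordinal hn)) //= eqxx mul1r big1 ?addr0 //.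
by move=> k; rewrite -val_eqE /= => /negbTE ->; rewrite mul0r mulr0.
Qed.

End Functional.

Lemma nc_circle (z1 : C) (r x : R) : 0 <= r -> nc (z1 + rinj r * cis x) <= nc z1 + r.
Proof.
move=> r0; apply: le_trans (ler_ncD _ _) _.
by rewrite ncM nc_cis mulr1 nc_real ger0_norm.
Qed.

(** The features of a point of the disc of radius R1 about z1 are obtained
    from those of points in a small disc with the same centre. The condition
    that the large disc lies in the unit disc provides the geometric factor:
    the coefficients of z^l are bounded by s^l with s < 1. *)
Lemma ext_approx (F : C -> C) (A : set C) (z1 t : C) (R1 rho0 : R) :
  nc z1 + R1 <= 1 -> 0 < rho0 -> (forall z, nc (z - z1) < rho0 -> A z) ->
  (forall z, nc (z - z1) < R1 -> cdiffable F z) -> nc t < R1 ->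
  approximable A pt_x (pt_y F) (pt_x (z1 + t)) (pt_y F (z1 + t)).
Proof.
move=> hz1 rho00 hA hF tR.
pose r := (nc t + R1) / 2.
have tr : nc t < r by rewrite /r; lra.
have r0 : 0 < r by apply: le_lt_trans tr; apply: nc_ge0.
have rR : r < R1 by rewrite /r; lra.
pose rho := Num.min rho0 r / 2.
have min0 : 0 < Num.min rho0 r by rewrite lt_min rho00.
have rho_0 : 0 < rho by rewrite divr_gt0.
have rho1 : rho < rho0.
  by apply: lt_le_trans (_ : Num.min rho0 r <= _); [rewrite /rho; lra|rewrite ge_min lexx].
have rho2 : rho < r.
  by apply: lt_le_trans (_ : Num.min rho0 r <= _); [rewrite /rho; lra|rewrite ge_min lexx orbT].
have hrho : 0 < rho < r by rewrite rho_0.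
have on_circle x : nc (z1 + rinj r * cis x - z1) < R1.
  by rewrite addrC addKr ncM nc_cis mulr1 nc_real gtr0_norm.
have [MF hMF] := circle_bounded (fun x => hF _ (on_circle x)).
have MF0 : 0 <= MF.
  have h01 : 0 <= (0 : R) <= 1 by rewrite lexx ler01.
  exact: le_trans (nc_ge0 _) (hMF 0 h01).
pose s := nc z1 + r; have s0 : 0 <= s by rewrite addr_ge0 ?nc_ge0 // ltW.
have hs : 0 <= s < 1 by rewrite s0 /s /=; lra.
have hX l : exists b, disc_rep (fun z => z ^+ l) z1 r (s ^+ l) b.
  have [||||b [hb1 hb2]] := @power_series R C (fun z => z ^+ l) z1 R1 r (s ^+ l) => //.
  - by move=> z _; apply: cdiffableX; apply: cdiffable_id.
  - move=> x _; rewrite ncX; apply: lerXn2r; rewrite ?nnegrE ?nc_ge0 //.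
    by apply: nc_circle; apply: ltW.
  - by exists b.
have hY l : exists b, disc_rep (fun z => z ^+ l * F z) z1 r (s ^+ l * MF) b.
  have [||||b [hb1 hb2]] := @power_series R C (fun z => z ^+ l * F z) z1 R1 r (s ^+ l * MF) => //.
  - move=> z hz; apply: cdiffableM; last exact: hF.
    by apply: cdiffableX; apply: cdiffable_id.
  - move=> x hx; rewrite ncM ncX; apply: ler_pM; rewrite ?nc_ge0 ?exprn_ge0 ?nc_ge0 ?hMF //.
    apply: lerXn2r; rewrite ?nnegrE ?nc_ge0 //.
    by apply: nc_circle; apply: ltW.
  - by exists b.
have /choice[bX hbX] := hX; have /choice[bY hbY] := hY.
have sl l : 0 <= s ^+ l by rewrite exprn_ge0.
have slM l : 0 <= s ^+ l * MF by rewrite mulr_ge0.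
pose q := Num.max rho (nc t) / r.
have [hq _] := evaluation_limit hrho sl hbX 0 tr.
have q1 : 0 < 1 - q by case/andP: hq => _; rewrite subr_gt0.
exists ((1 + MF) / (1 - q)), s, (fun N => 2 ^ N)%N,
   (fun N k => fourier N (fun j => (t / rinj rho) ^+ j) k), (fun N k => z1 + rinj rho * omega N ^+ k).
split=> //.
- by rewrite divr_ge0 ?(ltW q1) // addr_ge0.
- move=> N k _; apply: hA; rewrite addrC addKr ncM ncX nc_omega expr1n mulr1.
  by rewrite nc_real gtr0_norm.
- move=> l; have [_ [h1 h2]] := evaluation_limit hrho sl hbX l tr; split=> // N.
  apply: le_trans (h1 N) _; rewrite [leRHS]mulrAC ler_wpM2r ?invr_ge0 ?(ltW q1) //.
  by rewrite mulrDl mul1r lerDl mulr_ge0.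
- move=> l; have [_ [h1 h2]] := evaluation_limit hrho slM hbY l tr; split=> // N.
  apply: le_trans (h1 N) _; rewrite [leRHS]mulrAC ler_wpM2r ?invr_ge0 ?(ltW q1) //.
  by rewrite mulrDl mul1r mulrC lerDr.
Qed.

Section Jets.
Variables (F : C -> C) (a : nat -> C) (r M : R).
Hypotheses (r0 : 0 < r) (r1 : r < 1) (M0 : 0 <= M).
Hypothesis a_bound : forall j, nc (a j) <= M / r ^+ j.
Hypothesis a_sum : forall t, nc t < r -> has_sum (fun j => a j * t ^+ j) (F t).

Lemma a_rep_X l : disc_rep (fun z => z ^+ l) 0 r (r ^+ l) (fun i => (i == l)%:R * rinj (r ^+ l)).
Proof.
have hr0 := r0; split=> [i|t tr].
  rewrite ncM nc_real ger0_norm; last by rewrite exprn_ge0 // ltW.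
  by case: eqP => _; rewrite ?nc1 ?mul1r // nc0 mul0r exprn_ge0 // ltW.
rewrite add0r; apply: (@has_sum_near _ _ l.+1) => n hn.
rewrite (bigD1 (Ordinal hn)) //= eqxx mul1r big1 ?addr0.
  rewrite rmorphXn -exprMn mulrCA divff ?mulr1 //.
  by rewrite fmorph_eq0 gt_eqF.
by move=> k; rewrite -val_eqE /= => /negbTE ->; rewrite !mul0r.
Qed.

Lemma a_rep_Y l : disc_rep (fun z => z ^+ l * F z) 0 r (r ^+ l * M)
  (fun i => if (l <= i)%N then a (i - l)%N * rinj (r ^+ i) else 0).
Proof.
have hr0 := r0; split=> [i|t tr].
  have rl : 0 <= r ^+ l by rewrite exprn_ge0 // ltW.
  case: leqP => [li|_]; last by rewrite nc0 mulr_ge0.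
  rewrite ncM nc_real ger0_norm; last by rewrite exprn_ge0 // ltW.
  have ri : 0 <= r ^+ i by rewrite exprn_ge0 // ltW.
  apply: le_trans (ler_wpM2r ri (a_bound _)) _.
  rewrite -{2}(subnK li) exprD mulrA divfK ?expf_neq0 ?gt_eqF // mulrC //.
rewrite add0r; have := has_sum_shift l (has_sumM (c := t ^+ l) (a_sum tr)).
congr has_sum; apply/funext => i; case: leqP => li; last by rewrite mul0r.
have rr : rinj r != 0 :> C by rewrite fmorph_eq0 gt_eqF.
rewrite rmorphXn mulrCA -exprD addnC subnK // -mulrA -exprMn mulrCA divff // mulr1 //.
Qed.

(** Taylor coefficients at 0 are limits of combinations of values near 0. *)
Lemma jets_approx (A : set C) (e : R) j : 0 < e -> (forall z, nc z < e -> A z) ->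
  approximable A pt_x (pt_y F) (jet_x j) (jet_y a j).
Proof.
move=> e0 hA; have hr0 := r0; have hr1 := r1.
pose rho := Num.min e r / 2.
have min0 : 0 < Num.min e r by rewrite lt_min e0.
have rho_0 : 0 < rho by rewrite divr_gt0.
have rho1 : rho < e.
  by apply: lt_le_trans (_ : Num.min e r <= _); [rewrite /rho; lra|rewrite ge_min lexx].
have rho2 : rho < r.
  by apply: lt_le_trans (_ : Num.min e r <= _); [rewrite /rho; lra|rewrite ge_min lexx orbT].
have hrho : 0 < rho < r by rewrite rho_0.
have rl l : 0 <= r ^+ l by rewrite exprn_ge0 // ltW.
have rlM l : 0 <= r ^+ l * M by rewrite mulr_ge0.
have [hq _] := jet_limit hrho rl a_rep_X 0 0.
have q1 : 0 < 1 - rho / r by case/andP: hq => _; rewrite subr_gt0.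
have rj : 0 <= rho ^- j by rewrite invr_ge0 exprn_ge0 // ltW.
have rr n : rinj (r ^+ n) * rinj (r ^- n) = 1 :> C.
  by rewrite -rmorphM divff ?rmorph1 // expf_neq0 // gt_eqF.
exists ((1 + M) * rho ^- j / (1 - rho / r)), r, (fun N => 2 ^ N)%N,
   (fun N k => fourier N (fun i => (i == j)%:R * rinj (rho ^- j)) k), (fun N k => 0 + rinj rho * omega N ^+ k).
split=> //.
- by rewrite (ltW r0).
- by rewrite divr_ge0 ?(ltW q1) // mulr_ge0 // addr_ge0.
- move=> N k _; apply: hA; rewrite add0r ncM ncX nc_omega expr1n mulr1.
  by rewrite nc_real gtr0_norm.
- move=> l; have [_ [h1 h2]] := jet_limit hrho rl a_rep_X j l; split=> [N|].
    apply: le_trans (h1 N) _; rewrite [leRHS]mulrAC ler_wpM2r ?invr_ge0 ?(ltW q1) //.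
    rewrite mulrAC ler_wpM2r // mulrDl mul1r lerDl mulr_ge0 //.
  move: h2; rewrite /jet_x; case: eqP => [->|_]; last by rewrite !mul0r.
  by rewrite mul1r rr.
- move=> l; have [_ [h1 h2]] := jet_limit hrho rlM a_rep_Y j l; split=> [N|].
    apply: le_trans (h1 N) _; rewrite [leRHS]mulrAC ler_wpM2r ?invr_ge0 ?(ltW q1) //.
    by rewrite [leRHS]mulrAC ler_wpM2r // mulrDl mul1r mulrC lerDr.
  move: h2; rewrite /jet_y; case: leqP => _; last by rewrite mul0r.
  by rewrite -mulrA rr mulr1.
Qed.

(** Values near 0 are sums of Taylor series, that is, limits of combinations
    of jets. *)
Lemma points_approx w : nc w < r ->
  approximable setT jet_x (jet_y a) (pt_x w) (pt_y F w).
Proof.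
move=> wr; have hr0 := r0; have hr1 := r1.
pose q := nc w / r.
have hq : 0 <= q < 1 by rewrite divr_ge0 ?nc_ge0 ?(ltW r0) //= ltr_pdivrMr // mul1r.
have q1 : 0 < 1 - q by case/andP: hq => _; rewrite subr_gt0.
have qq : 1 <= (1 - q)^-1 by rewrite invf_ge1 // gerBl; case/andP: hq.
exists ((1 + M) / (1 - q)), r, id, (fun N k => w ^+ k), (fun N k => k); split=> //.
- by rewrite (ltW r0).
- by rewrite divr_ge0 ?(ltW q1) // addr_ge0.
- move=> l.
  have E N : \sum_(k < N) w ^+ k * jet_x k l = if (l < N)%N then w ^+ l else 0.
    case: ltnP => h.
      rewrite (bigD1 (Ordinal h)) //= /jet_x eqxx mulr1 big1 ?addr0 //.
      by move=> k; rewrite -val_eqE /= => /negbTE ->; rewrite mulr0.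
    by rewrite big1 // => k _; rewrite /jet_x ltn_eqF ?mulr0 // (leq_trans (ltn_ord k)).
  split=> [N|]; last first.
    apply: (@cvgc_near R C (fun=> pt_x w l) _ _ l.+1); last exact: cvgc_cst.
    by move=> N hN; rewrite E hN.
  rewrite E; apply: le_trans (_ : _ <= 1 * r ^+ l) _.
    rewrite mul1r; case: ifP => _; rewrite ?nc0 ?exprn_ge0 ?(ltW r0) //.
    by rewrite ncX; apply: lerXn2r; rewrite ?nnegrE ?nc_ge0 ?(ltW r0) ?(ltW wr).
  apply: ler_wpM2r; first by rewrite exprn_ge0 // ltW.
  rewrite -[leLHS]mulr1; apply: ler_pM => //.
  by rewrite lerDl.
- move=> l.
  have hsum := has_sum_shift l (has_sumM (c := w ^+ l) (a_sum wr)).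
  have E k : (if (l <= k)%N then w ^+ l * (a (k - l)%N * w ^+ (k - l)) else 0) = w ^+ k * jet_y a k l.
    rewrite /jet_y; case: leqP => lk; last by rewrite mulr0.
    by rewrite mulrCA -exprD addnC subnK // mulrC.
  rewrite (funext E) in hsum; split=> [N|]; last exact: hsum.
  have hb k : nc (w ^+ k * jet_y a k l) <= M * r ^+ l * q ^+ k.
    rewrite /jet_y; case: leqP => lk; last first.
      by rewrite mulr0 nc0 !mulr_ge0 ?exprn_ge0 ?(ltW r0) //; case/andP: hq.
    rewrite ncM ncX; apply: le_trans (ler_wpM2l _ (a_bound _)) _; first by rewrite exprn_ge0 ?nc_ge0.
    have rk : r ^+ k = r ^+ (k - l) * r ^+ l by rewrite -exprD subnK.
    rewrite /q expr_div_n rk.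
    rewrite le_eqVlt; apply/orP; left; apply/eqP.
    by field; rewrite !expf_neq0 ?gt_eqF.
  have Mr : 0 <= M * r ^+ l by rewrite mulr_ge0 // exprn_ge0 // ltW.
  have := sum_tail_le hq Mr hb (leq0n N).
  rewrite big_ord0 subr0 expr0 mulr1 => h; apply: le_trans h _.
  rewrite mulrAC; apply: ler_wpM2r; first by rewrite exprn_ge0 // ltW.
  by apply: ler_wpM2r; rewrite ?invr_ge0 ?(ltW q1) // lerDr.
Qed.

End Jets.

End Feature.

(** * Squares on an open subset of a domain *)

Section Region.
Variables (R : realType) (C : complex_plane R).

Lemma opencP (A : set C) : open A <->
  forall z, A z -> exists2 e : R, 0 < e & forall w, nc (w - z) < e -> A w.
Proof.
rewrite openE; split=> h z Az.
  by apply/nbhscP; apply: h.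
by apply/nbhscP; apply: h.
Qed.

Lemma open_nc_ball (z : C) (r : R) : open [set w | nc (w - z) < r].
Proof.
apply/opencP => w /= hw; exists (r - nc (w - z)); first by rewrite subr_gt0.
move=> v hv; have -> : v - z = (v - w) + (w - z) by ring.
by apply: le_lt_trans (ler_ncD _ _) _; lra.
Qed.

Lemma has_form_sub (T : Type) (A A' : set T) X Y (B : T -> T -> C) :
  A' `<=` A -> has_form A X Y B -> has_form A' X Y B.
Proof. by move=> h hf s t hs ht; apply: hf; apply: h. Qed.

Lemma negsq_sub (T : Type) (A A' : set T) (B : T -> T -> C) k :
  A `<=` A' -> negsq A B k -> negsq A' B k.
Proof. by move=> h [I [w [wA hw]]]; exists I, w; split=> // a; apply: h. Qed.

Section Chain.
Variables (F : C -> C) (Om A : set C).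
Hypotheses (Om_open : open Om) (Om_conn : connected Om).
Hypothesis Om_disc : forall z, Om z -> nc z < 1.
Hypothesis F_diff : forall z, Om z -> cdiffable F z.
Hypotheses (A_open : open A) (A0 : A !=set0) (AOm : A `<=` Om).

(** Continuation by discs from A. The discs are required to stay not only in
    Om but also inside the unit disc, where the features of points decay
    geometrically. *)
Fixpoint chain n : set C := if n is m.+1 then
    [set w | exists z1, exists R1 : R, [/\ chain m z1, nc z1 + R1 <= 1,
       (forall z, nc (z - z1) < R1 -> Om z) & nc (w - z1) < R1]]
  else A.

Lemma chain_Om n : chain n `<=` Om.
Proof. by case: n => [//|n] w [z1 [R1 [_ _ h1 h2]]]; apply: h1. Qed.

Lemma chain_open n : open (chain n).
Proof.
case: n => [//|n]; apply/opencP => w [z1 [R1 [h1 h2 h3 h4]]].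
have [e e0 he] := (opencP _).1 (@open_nc_ball z1 R1) _ h4.
by exists e => // v /he hv; exists z1, R1.
Qed.

Lemma chainS n : chain n `<=` chain n.+1.
Proof.
move=> w hw; have Omw := chain_Om hw.
have [e e0 he] := (opencP _).1 Om_open _ Omw.
have w1 := Om_disc Omw.
exists w, (Num.min e (1 - nc w)); split=> //.
- by rewrite -lerBrDl ge_min lexx orbT.
- by move=> z; rewrite lt_min => /andP[/he].
- by rewrite subrr nc0 lt_min e0 subr_gt0.
Qed.

Lemma chain_mono m n : (m <= n)%N -> chain m `<=` chain n.
Proof.
move=> /subnKC <-; elim: (n - m)%N => [|d IH]; first by rewrite addn0.
by rewrite addnS; apply: subset_trans IH _; apply: chainS.
Qed.

(** The set of points that can be reached is open, and closed in Om: near a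
    limit point w the discs centred at nearby reachable points have radii
    bounded below, so that one of them contains w. *)
Lemma chain_cover z : Om z -> exists n, chain n z.
Proof.
pose U := [set z | exists n, chain n z].
suff -> : Om = U by [].
apply/esym/Om_conn.
- by have [a Aa] := A0; exists a, 0%N.
- exists U; last first.
    by rewrite setIidr // => w [n hn]; apply: chain_Om hn.
  apply/opencP => w [n hn]; have [e e0 he] := (opencP _).1 (chain_open (n := n)) _ hn.
  by exists e => // v /he; exists n.
exists (closure U); first exact: closed_closure.
rewrite eqEsubset; split=> [w [n hn]|w [Omw clw]].
  by split; [apply: chain_Om hn|apply: subset_closure; exists n].
have [e e0 he] := (opencP _).1 Om_open _ Omw.
have w1 := Om_disc Omw.
pose d := Num.min (e / 2) ((1 - nc w) / 2).
have d0 : 0 < d by rewrite lt_min !divr_gt0 // subr_gt0.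
have d1 : d <= e / 2 by rewrite ge_min lexx.
have d2 : d <= (1 - nc w) / 2 by rewrite ge_min lexx orbT.
have /clw [v [[n hn] /= hv]] : nbhs w [set v | nc (v - w) < d].
  by apply/nbhscP; exists d.
exists n.+1, v, d; split=> //.
- have := ler_ncD (v - w) w; rewrite subrK; lra.
- move=> y hy; apply: he; have -> : y - w = (y - v) + (v - w) by ring.
  by apply: le_lt_trans (ler_ncD _ _) _; lra.
- by rewrite nc_sym.
Qed.

Let B : C -> C -> C := fun s t => schur_kernel F t s.

Lemma schur_herm (G : C -> C) : herm_kernel (fun s t => schur_kernel G t s).
Proof. by move=> s t; apply: (schur_kernel_hermitian G t s). Qed.

Lemma chain_form n : has_form (chain n) (@pt_x R C) (pt_y F) B.
Proof.
refine (has_form_sub _ (@points_form R C F)) => w /chain_Om; exact: Om_disc.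
Qed.

Lemma chain_approx n w : chain n.+1 w ->
  approximable (chain n) (@pt_x R C) (pt_y F) (pt_x w) (pt_y F w).
Proof.
move=> [z1 [R1 [h1 h2 h3 h4]]].
have [e e0 he] := (opencP _).1 (chain_open (n := n)) _ h1.
have -> : w = z1 + (w - z1) by ring.
by apply: (@ext_approx R C F (chain n) z1 (w - z1) R1 e) => // z /h3; apply: F_diff.
Qed.

Lemma negsq_chain_cover (G : C -> C -> C) k : negsq Om G k -> exists n, negsq (chain n) G k.
Proof.
move=> [I [w [wOm hw]]].
have /choice[m hm] : forall a, exists n, chain n (w a) by move=> a; apply: chain_cover.
exists (\max_a m a), I, w; split=> // a.
by apply: (chain_mono (m := m a)) => //; apply: (leq_bigmax a).
Qed.

(** A finite family of points lies in one stage of the chain, and the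
    approximation brings it back to A one disc at a time. *)
Lemma negsq_continuation k : negsq Om B k -> negsq A B k.
Proof.
move=> /negsq_chain_cover[n]; elim: n => // n IH h; apply: IH.
apply: (negsq_approx (schur_herm F) (schur_herm F) (chain_form (n := n)) (chain_form (n := n.+1)) _ h).
exact: chain_approx.
Qed.

Lemma negsq_continuationN k :
  negsq Om (fun s t => - B s t) k -> negsq A (fun s t => - B s t) k.
Proof.
move=> /negsq_chain_cover[n]; elim: n => // n IH h; apply: IH.
apply: (negsq_approxN (schur_herm F) (schur_herm F) (chain_form (n := n)) (chain_form (n := n.+1)) _ h).
exact: chain_approx.
Qed.

End Chain.

(** A, a small disc D about 0 and Om have the same number of squares, by
    continuation inside Om; and D is compared with the jets in both
    directions. *)
Lemma squares_at_origin (F : C -> C) (Om A : set C) (a : nat -> C) (r M : R) :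
  open Om -> connected Om -> (forall z, Om z -> nc z < 1) ->
  (forall z, Om z -> cdiffable F z) -> open A -> A !=set0 -> A `<=` Om -> Om 0 ->
  0 < r < 1 -> 0 <= M -> (forall j, nc (a j) <= M / r ^+ j) ->
  (forall t, nc t < r -> has_sum (fun j => a j * t ^+ j) (F t)) ->
  forall k, (negsq A (fun s t => schur_kernel F t s) k <-> negsq setT (jet_kernel a) k) /\
    (negsq A (fun s t => - schur_kernel F t s) k <-> negsq setT (fun i j => - jet_kernel a i j) k).
Proof.
move=> Om_open Om_conn Om_disc F_diff A_open A0 AOm Om0 /andP[r0 r1] M0 ha hs k.
have [e e0 he] := (opencP _).1 Om_open _ Om0.
pose r' := Num.min r e; have r'0 : 0 < r' by rewrite lt_min r0.
pose D := [set w : C | nc (w - 0) < r'].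
have D_open : open D by apply: open_nc_ball.
have D0 : D !=set0 by exists 0; rewrite /D /= subrr nc0.
have DOm : D `<=` Om by move=> w; rewrite /D /= lt_min => /andP[_ /he].
have Dr w : D w -> nc w < r by rewrite /D /= subr0 lt_min => /andP[].
have fD : has_form D (@pt_x R C) (pt_y F) (fun s t => schur_kernel F t s).
  by refine (has_form_sub _ (@points_form R C F)) => w /DOm /Om_disc.
have aD j : approximable D (@pt_x R C) (pt_y F) (@jet_x R C j) (jet_y a j).
  by apply: (jets_approx r0 r1 M0 ha hs j r'0) => z hz; rewrite /D /= subr0.
have aJ w : D w -> approximable setT (@jet_x R C) (jet_y a) (pt_x w) (pt_y F w).
  by move=> /Dr wr; apply: (points_approx r0 r1 M0 ha hs wr).
split; split=> h.
- apply: (negsq_approx (jet_kernel_herm a) (schur_herm F) (@jets_form R C a) fD aJ).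
  apply: (negsq_continuation (Om := Om)) => //.
  exact: negsq_sub h.
- apply: (negsq_continuation (Om := Om)) => //; apply: negsq_sub DOm _.
  exact: (negsq_approx (schur_herm F) (jet_kernel_herm a) fD (@jets_form R C a) (fun j _ => aD j)).
- apply: (negsq_approxN (jet_kernel_herm a) (schur_herm F) (@jets_form R C a) fD aJ).
  apply: (negsq_continuationN (Om := Om)) => //.
  exact: negsq_sub h.
- apply: (negsq_continuationN (Om := Om)) => //; apply: negsq_sub DOm _.
  exact: (negsq_approxN (schur_herm F) (jet_kernel_herm a) fD (@jets_form R C a) (fun j _ => aD j)).
Qed.

End Region.

(** * Vectors orthogonal to a maximal negative subspace *)

Section Kernel.
Variables (R : realType) (C : complex_plane R).

Variables (K : nat -> nat -> C) (kap : nat).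
Hypothesis K_herm : herm_kernel K.
Hypothesis K_squares : forall k, negsq setT K k <-> (k <= kap)%N.

(** The form of K on sequences, restricted to the first n entries. For
    sequences of finite support the value does not depend on n as soon as n is
    large. *)
Definition bform n (x y : nat -> C) : C := \sum_(i < n) \sum_(j < n) x i * K i j * (y j)^*.

Lemma bform_conj n x y : (bform n x y)^* = bform n y x.
Proof. by apply: hform_conj => i j; apply: K_herm. Qed.

Lemma frame_ex : exists r0 (u : 'I_kap -> nat -> C), (forall p j, (r0 <= j)%N -> u p j = 0) /\
  forall p q, bform r0 (u p) (u q) = - (p == q)%:R.
Proof.
have [_ /(_ (leqnn kap)) [I [w [_ hw]]]] := K_squares kap.
pose r0 := (\max_i w i).+1.
have wr i : (w i < r0)%N by rewrite ltnS; apply: leq_bigmax.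
have hr : negsub (fun i j : 'I_r0 => K i j) kap.
  exact: (@negsub_map _ _ _ _ (fun i => Ordinal (wr i))).
have hK : herm_kernel (fun i j : 'I_r0 => K i j) by move=> i j; apply: K_herm.
have [W hW] := negsub_negframe hK hr.
exists r0, (fun p j => if insub j is Some j' then W p j' else 0); split=> [p j hj|p q].
  by rewrite insubF // ltnNge hj.
rewrite -hW; apply: eq_bigr => i _; apply: eq_bigr => j _.
by rewrite !valK.
Qed.

Section Frame.
Variables (r0 : nat) (u : 'I_kap -> nat -> C).
Hypothesis u_supp : forall p j, (r0 <= j)%N -> u p j = 0.
Hypothesis u_frame : forall p q, bform r0 (u p) (u q) = - (p == q)%:R.

Definition pairing i q : C := \sum_(j < r0) K i j * (u q j)^*.

Lemma sum_supp n (f : nat -> C) q : (r0 <= n)%N ->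
  \sum_(j < n) u q j * f j = \sum_(j < r0) u q j * f j.
Proof.
move=> hn; rewrite [RHS](big_ord_widen n (fun j => u q j * f j)) // [RHS]big_mkcond.
by apply: eq_bigr => j _; case: ltnP => // /u_supp ->; rewrite mul0r.
Qed.

Lemma bform_frame n x q : (r0 <= n)%N ->
  bform n x (u q) = \sum_(i < n) x i * pairing i q.
Proof.
move=> hn; apply: eq_bigr => i _.
transitivity (x i * (\sum_(j < n) u q j * (K i j)^* )^* ).
  rewrite rmorph_sum mulr_sumr; apply: eq_bigr => j _.
  by rewrite rmorphM /= conjCK; ring.
rewrite (sum_supp (fun j => (K i j)^* )) //; congr (_ * _); rewrite rmorph_sum; apply: eq_bigr => j _.
by rewrite rmorphM /= conjCK mulrC.
Qed.

Lemma bform_frame_frame n p q : (r0 <= n)%N -> bform n (u p) (u q) = - (p == q)%:R.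
Proof.
by move=> hn; rewrite -u_frame !bform_frame // (sum_supp (fun i => pairing i q)).
Qed.

(** A vector y of negative square, K-orthogonal to the kap vectors of a
    maximal negative frame, would enlarge it. *)
Lemma bform_ge0 n y : (r0 <= n)%N -> (forall q, bform n y (u q) = 0) -> 0 <= bform n y y.
Proof.
move=> hn hy.
have yr : bform n y y \is Num.real by rewrite CrealE bform_conj.
rewrite -[0 <= _]negbK -real_ltNge ?real0 //; apply/negP => y0.
suff : (kap.+1 <= kap)%N by rewrite ltnn.
apply/K_squares; exists ('I_n : finType), (fun i => val i); split=> //.
pose W (p : 'I_kap.+1) (i : 'I_n) : C := if unlift ord0 p is Some q then u q i else y i.
have W0 : W ord0 = (fun i : 'I_n => y i) by rewrite /W unlift_none.
have WS q : W (lift ord0 q) = (fun i : 'I_n => u q i) by rewrite /W liftK.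
exists W => x [p xp] /=; rewrite hform_comb.
pose H p q := hform (fun a0 b : 'I_n => K a0 b) (W p) (W q).
have H00 : H ord0 ord0 = bform n y y by rewrite /H W0.
have H0S q : H ord0 (lift ord0 q) = 0 by rewrite /H W0 WS -[RHS](hy q).
have HS0 q : H (lift ord0 q) ord0 = 0.
  by rewrite /H W0 WS -[RHS](conjC0 C) -(hy q) bform_conj.
have HSS p' q : H (lift ord0 p') (lift ord0 q) = - (p' == q)%:R.
  by rewrite /H !WS -(bform_frame_frame _ _ hn).
rewrite -/(hform H x x).
have -> : hform H x x =
   bform n y y * (x ord0 * (x ord0)^* ) - \sum_q x (lift ord0 q) * (x (lift ord0 q))^*.
  rewrite /hform big_ord_recl big_ord_recl /=; congr (_ + _).
    rewrite big1 => [|q _]; last by rewrite H0S mulr0 mul0r.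
    by rewrite addr0 H00; ring.
  rewrite -sumrN; apply: eq_bigr => q _; rewrite big_ord_recl HS0 mulr0 mul0r add0r.
  rewrite (bigD1 q) //= big1 ?addr0 => [|q' q'q].
    by rewrite HSS eqxx mulrN1 mulNr.
  by rewrite HSS eq_sym (negbTE q'q) oppr0 mulr0 mul0r.
have S0 : 0 <= \sum_q x (lift ord0 q) * (x (lift ord0 q))^*.
  by apply: sumr_ge0 => q _; rewrite mul_conjC_ge0.
have [x0|x0] := eqVneq (x ord0) 0.
  rewrite x0 mul0r mulr0 sub0r oppr_lt0; apply: sum_norm2_gt0.
  case: (unliftP ord0 p) xp => [q ->|->]; first by exists q.
  by rewrite x0 eqxx.
rewrite subr_lt0; apply: lt_le_trans S0.
by rewrite nmulr_rlt0 // mul_conjC_gt0.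
Qed.

(** Adding such a combination to a vector is a way to make it orthogonal to
    the frame; the coefficient to use is the value of the form, by
    [bform_comb_frame], because the frame vectors have square -1. *)
Definition frame_comb (x : 'I_kap -> C) i : C := \sum_p x p * u p i.
Local Notation comb := frame_comb.

Lemma bform_comb_frame n (y : nat -> C) (x : 'I_kap -> C) q : (r0 <= n)%N ->
  bform n (fun i => y i + comb x i) (u q) = bform n y (u q) - x q.
Proof.
move=> hn.
rewrite !bform_frame //.
transitivity (\sum_(i < n) y i * pairing i q + \sum_p x p * \sum_(i < n) u p i * pairing i q).
  under [X in _ + X]eq_bigr do rewrite mulr_sumr.
  rewrite exchange_big -big_split; apply: eq_bigr => i _ /=.
  by rewrite mulrDl mulr_suml; congr (_ + _); apply: eq_bigr => p _; rewrite mulrA.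
congr (_ + _); under eq_bigr do rewrite -bform_frame // bform_frame_frame //.
rewrite (bigD1 q) //= eqxx mulrN1 big1 ?addr0 // => p pq.
by rewrite (negbTE pq) oppr0 mulr0.
Qed.

Lemma bform_comb n (y : nat -> C) (x : 'I_kap -> C) : (r0 <= n)%N ->
  let z := fun i => y i + comb x i in
  bform n z z = bform n y y + \sum_p (x p * (bform n y (u p))^* + (x p)^* * bform n y (u p))
   - \sum_p x p * (x p)^*.
Proof.
move=> hn z.
have zu q : bform n z (u q) = bform n y (u q) - x q by apply: bform_comb_frame.
have zy (v : nat -> C) : bform n v z = bform n v y + \sum_p (x p)^* * bform n v (u p).
  under [X in _ + X]eq_bigr do rewrite mulr_sumr.
  rewrite exchange_big -big_split; apply: eq_bigr => i _ /=.
  under [X in _ + X]eq_bigr do rewrite mulr_sumr.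
  rewrite exchange_big -big_split; apply: eq_bigr => j _ /=.
  rewrite /z rmorphD mulrDr rmorph_sum mulr_sumr; congr (_ + _).
  by apply: eq_bigr => p _; rewrite rmorphM /=; ring.
rewrite zy -[bform n z y]bform_conj zy rmorphD /= bform_conj -!addrA; congr (_ + _).
rewrite rmorph_sum -big_split -sumrB /=; apply: eq_bigr => p _.
by rewrite zu rmorphM /= conjCK; ring.
Qed.

Lemma bform_delta n i q : (r0 <= n)%N -> (i < n)%N ->
  bform n (fun j => (j == i)%:R) (u q) = pairing i q.
Proof.
move=> hn hi; rewrite bform_frame // (bigD1 (Ordinal hi)) //= eqxx mul1r big1 ?addr0 //.
by move=> j; rewrite -val_eqE /= => /negbTE ->; rewrite mul0r.
Qed.

Lemma bform_delta2 n i : (i < n)%N ->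
  bform n (fun j => (j == i)%:R) (fun j => (j == i)%:R) = K i i.
Proof.
move=> hi; rewrite /bform (bigD1 (Ordinal hi)) //= [X in _ + X]big1 ?addr0; last first.
  by move=> j; rewrite -val_eqE /= => /negbTE ->; apply: big1 => l _; rewrite !mul0r.
rewrite (bigD1 (Ordinal hi)) //= eqxx big1 ?addr0; first by rewrite conjC1 mulr1 mul1r.
by move=> j; rewrite -val_eqE /= => /negbTE ->; rewrite conjC0 mulr0.
Qed.

End Frame.

End Kernel.

(** * Geometric growth of the coefficients *)

Section Growth.
Variables (R : realType) (C : complex_plane R).
Variables (a : nat -> C) (kap : nat).
Hypothesis a_squares : forall k, negsq setT (jet_kernel a) k <-> (k <= kap)%N.
Local Notation K := (jet_kernel a).
Local Notation bform := (bform K).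
Let K_herm := jet_kernel_herm a.

Lemma jet_kernelS i j : K i.+1 j.+1 = K i j - a i.+1 * (a j.+1)^*.
Proof.
rewrite /jet_kernel eqSS minnSS big_ord_recl /= !subn0 opprD addrA addrAC.
by congr (_ - _ - _); apply: eq_bigr => l _.
Qed.

Definition shift (x : nat -> C) i : C := if i is i'.+1 then x i' else 0.

(** The index shift corresponds to multiplication by z. Since K(i+1, j+1) =
    K(i, j) - a_(i+1) conj a_(j+1), it subtracts a square. *)
Lemma bform_shift n x : bform n.+1 (shift x) (shift x) =
  bform n x x - (\sum_(i < n) x i * a i.+1) * (\sum_(i < n) x i * a i.+1)^*.
Proof.
rewrite /bform big_ord_recl /= [X in X + _]big1 ?add0r; last by move=> j _; rewrite !mul0r.
rewrite mulr_suml -sumrB; apply: eq_bigr => i _.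
rewrite big_ord_recl /= conjC0 mulr0 add0r rmorph_sum mulr_sumr -sumrB.
by apply: eq_bigr => j _; rewrite jet_kernelS rmorphM /=; ring.
Qed.

Lemma bform_shift_le n x : bform n.+1 (shift x) (shift x) <= bform n x x.
Proof. by rewrite bform_shift gerBl mul_conjC_ge0. Qed.

Section Frame.
Variables (r0 : nat) (u : 'I_kap -> nat -> C).
Hypothesis u_supp : forall p j, (r0 <= j)%N -> u p j = 0.
Hypothesis u_frame : forall p q, bform r0 (u p) (u q) = - (p == q)%:R.
Local Notation pairing := (pairing K r0 u).
Local Notation comb := (frame_comb u).
Let bform_frame := bform_frame K u_supp.
Let bform_frame_frame := bform_frame_frame u_supp u_frame.
Let bform_ge0 := bform_ge0 K_herm a_squares u_supp u_frame.
Let bform_comb := bform_comb K_herm u_supp u_frame.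
Let bform_delta := bform_delta K u_supp.
Let sum_supp := sum_supp u_supp.

(** The matrix of the shift on the frame, read through the pairings with the
    frame. *)
Definition transfer : 'M[C]_kap := \matrix_(p, q) \sum_(i < r0) u p i * pairing i.+1 q.

Lemma bform_shift_comb n i (h : 'rV[C]_kap) q : (r0 <= n)%N -> (i < n)%N ->
  bform n.+1 (shift (fun j => (j == i)%:R + comb (fun p => h 0 p) j)) (u q) =
  pairing i.+1 q + (h *m transfer) 0 q.
Proof.
move=> hn hi; rewrite bform_frame; last by rewrite leqW.
rewrite big_ord_recl /= mul0r add0r.
under eq_bigr do rewrite mulrDl.
rewrite big_split /= (bigD1 (Ordinal hi)) //= eqxx mul1r big1 ?addr0; last first.
  by move=> j; rewrite -val_eqE /= => /negbTE ->; rewrite mul0r.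
congr (_ + _); rewrite mxE /comb.
under eq_bigr do rewrite mulr_suml.
rewrite exchange_big /=; apply: eq_bigr => p _; rewrite mxE -(sum_supp (fun i => pairing i.+1 q) p hn).
by rewrite mulr_sumr; apply: eq_bigr => j _; rewrite mulrA.
Qed.

(** If a combination y of the frame had its shift orthogonal to the frame, the
    square of the shift would be nonnegative, hence so would that of y; but
    the form is negative definite on the span of the frame. *)
Lemma transfer_unit : transfer \in unitmx.
Proof.
rewrite -row_free_unit -kermx_eq0; apply/rowV0P => x /sub_kermxP hx.
apply/eqP/negPn/negP => x0.
have [p xp] := rV0Pn _ x0.
pose y := comb (fun p => x 0 p).
have hy q : bform r0.+1 (shift y) (u q) = 0.
  have /rowP/(_ q) := hx; rewrite !mxE => {1}<-; rewrite bform_frame //.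
  rewrite big_ord_recl /= mul0r add0r /y /comb.
  under eq_bigr do rewrite mulr_suml.
  rewrite exchange_big /=; apply: eq_bigr => p' _; rewrite mxE.
  by rewrite mulr_sumr; apply: eq_bigr => j _; rewrite mulrA.
have h1 : 0 <= bform r0 y y.
  by apply: le_trans (bform_shift_le r0 y); apply: bform_ge0; rewrite // leqW.
have h2 : bform r0 y y = - \sum_p x 0 p * (x 0 p)^*.
  have e : y = (fun i => 0 + comb (fun p => x 0 p) i) by apply/funext => i; rewrite add0r.
  rewrite e bform_comb //.
  have b0 v : bform r0 (fun=> 0) v = 0.
    by rewrite /bform big1 // => i _; rewrite big1 // => j _; rewrite !mul0r.
  by rewrite b0 add0r [X in X - _]big1 ?sub0r // => q _; rewrite b0 conjC0 !mulr0 addr0.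
have := sum_norm2_gt0 (ex_intro _ p xp : exists p, (fun p => x 0 p) p != 0).
by rewrite h2 oppr_ge0 in h1 => /(le_lt_trans h1); rewrite ltxx.
Qed.

Let G i : R := \sum_p nc (pairing i p) ^+ 2.

Lemma diag_kernel i : K i i = rinj (1 - \sum_(l < i.+1) nc (a l) ^+ 2).
Proof.
have -> : \sum_(l < i.+1) nc (a l) ^+ 2 = \sum_(l < i.+1) nc (a (i - l)%N) ^+ 2.
  by rewrite (reindex_inj rev_ord_inj) /=; apply: eq_bigr => l _; rewrite subSS.
have E : \sum_(l < i.+1) a (i - l)%N * (a (i - l)%N)^* =
    rinj (\sum_(l < i.+1) nc (a (i - l)%N) ^+ 2).
  by rewrite rmorph_sum; apply: eq_bigr => l _; rewrite mul_conj_nc.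
by rewrite /jet_kernel eqxx minnn E rmorphB (rmorph1 (@rinj R C)).
Qed.

Lemma sum_conj_nc (x : 'I_kap -> C) : \sum_p x p * (x p)^* = rinj (\sum_p nc (x p) ^+ 2).
Proof. by rewrite rmorph_sum; apply: eq_bigr => p _; rewrite mul_conj_nc. Qed.

(** Make the i-th basis vector orthogonal to the frame; the square of the
    result is 1 - sum_(l <= i) |a_l|^2 + G i, where G i is the sum of the
    squares of the pairings, and it is nonnegative. *)
Lemma coef_le_pairing i : nc (a i) ^+ 2 <= 1 + G i.
Proof.
pose n := (r0 + i).+1.
have hn : (r0 <= n)%N by rewrite /n; lia.
have hi : (i < n)%N by rewrite /n; lia.
pose y j : C := (j == i)%:R; pose z j := y j + comb (pairing i) j.
have hz : 0 <= bform n z z.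
  apply: bform_ge0 => // q; rewrite bform_frame // /z.
  under eq_bigr do rewrite mulrDl.
  rewrite big_split /= -!bform_frame // bform_delta //.
  rewrite bform_frame //; under [X in _ + X]eq_bigr do rewrite /comb mulr_suml.
  rewrite exchange_big /=.
  have e p : \sum_(j < n) pairing i p * u p j * pairing j q = pairing i p * - (p == q)%:R.
    rewrite -(bform_frame_frame _ _ hn) bform_frame // mulr_sumr.
    by apply: eq_bigr => j _; rewrite mulrA.
  under eq_bigr do rewrite e.
  rewrite (bigD1 q) //= eqxx mulrN1 big1 ?addr0 ?subrr // => p pq.
  by rewrite (negbTE pq) oppr0 mulr0.
move: hz; rewrite bform_comb // bform_delta2 // diag_kernel.
have -> : \sum_p (pairing i p * (bform n y (u p))^* + (pairing i p)^* * bform n y (u p)) =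
   rinj (G i + G i).
  rewrite rmorphD -sum_conj_nc -big_split; apply: eq_bigr => p _.
  by rewrite bform_delta // [(pairing i p)^* * _]mulrC.
rewrite sum_conj_nc -/(G i) -rmorphD -rmorphB /= rinj_ge0.
rewrite big_ord_recr /= => h.
have h0 : 0 <= \sum_(l < i) nc (a l) ^+ 2 by apply: sumr_ge0 => l _; rewrite exprn_ge0 ?nc_ge0.
by lra.
Qed.

(** Since the transfer matrix is invertible, the i-th basis vector can be
    corrected by a combination h of the frame so that its shift is orthogonal
    to the frame. The square of the shift is then nonnegative, and a fortiori
    that of the corrected vector, which bounds h by the pairings of the i-th
    basis vector; and h determines the pairings of the next basis vector. *)
Lemma pairing_step : exists2 D : R, 1 <= D & forall i, 1 + G i.+1 <= D * (1 + G i).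
Proof.
pose tau : R := 1 + \sum_p \sum_q nc (transfer p q).
have tau1 : 1 <= tau by rewrite lerDl; apply: sumr_ge0 => p _; apply: sumr_ge0 => q _; apply: nc_ge0.
have htau p q : nc (transfer p q) <= tau.
  rewrite /tau (bigD1 p) //= (bigD1 q) //=.
  have h1 : 0 <= \sum_(i | i != q) nc (transfer p i) by apply: sumr_ge0 => ? _; apply: nc_ge0.
  have h2 : 0 <= \sum_(i | i != p) \sum_q nc (transfer i q).
    by apply: sumr_ge0 => ? _; apply: sumr_ge0 => ? _; apply: nc_ge0.
  by lra.
pose c : R := kap%:R * (kap%:R * tau ^+ 2).
have c0 : 0 <= c by rewrite !mulr_ge0 ?ler0n ?exprn_ge0 //; lra.
exists (1 + 4 * c); first by lra.
move=> i; pose n := (r0 + i).+1.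
have hn : (r0 <= n)%N by rewrite /n; lia.
have hi : (i < n)%N by rewrite /n; lia.
pose gS : 'rV[C]_kap := \row_q pairing i.+1 q.
pose h := - (gS *m invmx transfer).
have hT : h *m transfer = - gS by rewrite mulNmx mulmxKV // transfer_unit.
pose y j : C := (j == i)%:R; pose z j := y j + comb (fun p => h 0 p) j.
have hz : 0 <= bform n z z.
  apply: le_trans (bform_shift_le n z); apply: bform_ge0; first by rewrite leqW.
  move=> q; rewrite bform_shift_comb // hT !mxE subrr //.
pose H : R := \sum_p nc (h 0 p) ^+ 2.
have HG : H <= 2 + 4 * G i.
  have hcross p : h 0 p * (pairing i p)^* + (h 0 p)^* * pairing i p <=
      rinj (nc (h 0 p) ^+ 2 / 2 + 2 * nc (pairing i p) ^+ 2).
    have := mul_conjC_ge0 (h 0 p - 2 * pairing i p).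
    rewrite rmorphB rmorphM /= conjC_nat => h1.
    have -> : rinj (nc (h 0 p) ^+ 2 / 2 + 2 * nc (pairing i p) ^+ 2) =
        h 0 p * (h 0 p)^* / 2 + 2 * (pairing i p * (pairing i p)^* ).
      rewrite !mul_conj_nc; move: (nc (h 0 p) ^+ 2) (nc (pairing i p) ^+ 2) => A B.
      by rewrite rmorphD !rmorphM fmorphV /= rmorph_nat.
    rewrite -subr_ge0; have -> : h 0 p * (h 0 p)^* / 2 + 2 * (pairing i p * (pairing i p)^* ) -
       (h 0 p * (pairing i p)^* + (h 0 p)^* * pairing i p) =
      (h 0 p - 2 * pairing i p) * ((h 0 p)^* - 2 * (pairing i p)^* ) / 2.
      by field.
    by rewrite divr_ge0 ?ler0n.
  have : bform n z z <= rinj (1 - \sum_(l < i.+1) nc (a l) ^+ 2 + \sum_p (nc (h 0 p) ^+ 2 / 2 + 2 * nc (pairing i p) ^+ 2) - H).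
    rewrite bform_comb // bform_delta2 // diag_kernel sum_conj_nc !(rmorphB, rmorphD) /=.
    rewrite lerD2r lerD2l rmorph_sum; apply: ler_sum => p _.
    by rewrite bform_delta // hcross.
  move=> /(le_trans hz); rewrite rinj_ge0 big_split /= -mulr_suml -mulr_sumr -/H -/(G i) => h1.
  have h0 : 0 <= \sum_(l < i.+1) nc (a l) ^+ 2 by apply: sumr_ge0 => l _; rewrite exprn_ge0 ?nc_ge0.
  by lra.
have GS : G i.+1 <= c * H.
  rewrite /G; have hq q : nc (pairing i.+1 q) ^+ 2 <= kap%:R * (tau ^+ 2 * H).
    have -> : pairing i.+1 q = - (h *m transfer) 0 q by rewrite hT !mxE opprK.
    rewrite ncN mxE.
    have h1 : nc (\sum_p h 0 p * transfer p q) <= \sum_p nc (h 0 p) * tau.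
      apply: le_trans (nc_sum _ _ _) _; apply: ler_sum => p _.
      by rewrite ncM; apply: ler_wpM2l; rewrite ?nc_ge0 ?htau.
    have h2 := lerXn2r 2 (nc_ge0 _) (le_trans (nc_ge0 _) h1) h1.
    apply: le_trans h2 _; apply: le_trans (sqr_sum_le _) _.
    rewrite ler_wpM2l // mulr_sumr; apply: ler_sum => p _.
    by rewrite exprMn mulrC.
  apply: le_trans (ler_sum _ (fun q _ => hq q)) _.
  by rewrite sumr_const card_ord -[_ *+ kap]mulr_natl /c !mulrA.
have G0 : 0 <= G i by apply: sumr_ge0 => p _; rewrite exprn_ge0 ?nc_ge0.
have h1 : c * H <= c * (2 + 4 * G i) by rewrite ler_wpM2l.
nra.
Qed.

End Frame.

(** The pairings with the frame dominate the coefficients and grow at most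
    geometrically. *)
Lemma coefficients_geometric : exists r M : R, [/\ 0 < r < 1, 0 <= M &
  forall j, nc (a j) <= M / r ^+ j].
Proof.
have [r0 [u [us uf]]] := frame_ex K_herm a_squares.
have [D D1 hD] := pairing_step us uf.
pose G i : R := \sum_p nc (pairing (jet_kernel a) r0 u i p) ^+ 2.
have G0 i : 0 <= G i by apply: sumr_ge0 => p _; rewrite exprn_ge0 ?nc_ge0.
have D0 : 0 < D by lra.
exists ((D + 1)^-1), (1 + G 0%N); split.
- by rewrite invr_gt0 invf_lt1; lra.
- by rewrite addr_ge0.
have hG i : 1 + G i <= (1 + G 0%N) * D ^+ i.
  elim: i => [|i IH]; first by rewrite expr0 mulr1.
  apply: le_trans (hD i) _; rewrite exprS mulrCA; apply: ler_wpM2l => //.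
  exact: ltW.
move=> j; rewrite exprVn invrK.
have h1 := coef_le_pairing us uf j; rewrite -/(G j) in h1.
have h2 : nc (a j) <= 1 + G j.
  rewrite -(@ler_pXn2r R 2) ?nnegrE ?nc_ge0 ?addr_ge0 //; apply: le_trans h1 _.
  rewrite expr2 ler_peMr ?addr_ge0 //.
  by rewrite lerDl.
apply: le_trans h2 _; apply: le_trans (hG j) _.
apply: ler_wpM2l; first by rewrite addr_ge0.
by apply: lerXn2r; rewrite ?nnegrE; lra.
Qed.

End Growth.

(** * Sums of power series *)

Section Series.
Variables (R : realType) (C : complex_plane R).

(** A single term of the binomial expansion, all of whose terms are
    nonnegative. *)
Lemma expr_linear_le (x h : R) j : 0 <= x -> 0 <= h -> j%:R * x ^+ j.-1 * h <= (x + h) ^+ j.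
Proof.
move=> x0 h0; elim: j => [|j IH]; first by rewrite !mul0r expr0 ler01.
have h1 : x ^+ j <= (x + h) ^+ j by apply: lerXn2r; rewrite ?nnegrE ?addr_ge0 // lerDl.
rewrite exprSr mulrDr.
have h2 : j%:R * x ^+ j * h <= (x + h) ^+ j * x.
  case: j IH {h1} => [|j] IH; first by rewrite !mul0r expr0 mul1r.
  apply: le_trans (ler_wpM2r x0 IH); rewrite /= exprSr.
  by rewrite le_eqVlt; apply/orP; left; apply/eqP; ring.
have h3 : x ^+ j * h <= (x + h) ^+ j * h by apply: ler_wpM2r.
by apply: le_trans (lerD h2 h3); rewrite -natr1 /= mulrDl mul1r mulrDl.
Qed.

(** The remainder consists of the terms of degree at least 2 in h, and in each
    of them |h|^i is at most (|h| / eta)^2 eta^i. *)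
Lemma expr_second_order (z h : C) (eta : R) j : 0 < eta -> nc h <= eta ->
  nc ((z + h) ^+ j - z ^+ j - j%:R * z ^+ j.-1 * h) <= (nc h / eta) ^+ 2 * (nc z + eta) ^+ j.
Proof.
move=> eta0 hh.
have q0 : 0 <= nc h / eta by rewrite divr_ge0 ?nc_ge0 // ltW.
have rhs0 i : 0 <= (nc h / eta) ^+ 2 * (nc z + eta) ^+ i.
  by rewrite mulr_ge0 ?exprn_ge0 // addr_ge0 ?nc_ge0 // ltW.
case: j => [|[|n]].
- have -> : (z + h) ^+ 0 - z ^+ 0 - 0%:R * z ^+ 0.-1 * h = 0.
    by rewrite !expr0 subrr !mul0r subrr.
  by rewrite nc0.
- have -> : (z + h) ^+ 1 - z ^+ 1 - 1%:R * z ^+ 1.-1 * h = 0.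
    by rewrite /= expr0; ring.
  by rewrite nc0.
have expand (K : comPzRingType) (x y : K) : (x + y) ^+ n.+2 =
    x ^+ n.+2 + n.+2%:R * x ^+ n.+1 * y + \sum_(i < n.+1) (x ^+ (n - i) * y ^+ i.+2) *+ 'C(n.+2, i.+2).
  rewrite exprDn !big_ord_recl /= bin0 bin1 !mulr1n subn0 expr0 mulr1 subn1 /= expr1.
  by rewrite addrA -mulr_natl mulrA.
rewrite /= expand.
have -> : forall u v w : C, u + v + w - u - v = w by move=> u v w; ring.
have x0 := nc_ge0 z.
apply: le_trans (_ : (nc h / eta) ^+ 2 *
   \sum_(i < n.+1) (nc z ^+ (n - i) * eta ^+ i.+2) *+ 'C(n.+2, i.+2) <= _); last first.
  apply: ler_wpM2l; first by rewrite exprn_ge0.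
  rewrite expand lerDr; apply: addr_ge0; first exact: exprn_ge0.
  by apply: mulr_ge0; [apply: mulr_ge0; [apply: ler0n|apply: exprn_ge0]|apply: ltW].
rewrite mulr_sumr; apply: le_trans (nc_sum _ _ _) _; apply: ler_sum => i _.
rewrite -mulr_natl ncM nc_nat -[X in _ <= _ * X]mulr_natl [leRHS]mulrCA.
apply: ler_wpM2l; first exact: ler0n.
rewrite ncM !ncX [leRHS]mulrCA; apply: ler_wpM2l; first by rewrite exprn_ge0.
have -> : (nc h / eta) ^+ 2 * eta ^+ i.+2 = nc h ^+ 2 * eta ^+ i.
  have -> : eta ^+ i.+2 = eta ^+ 2 * eta ^+ i by rewrite -exprD.
  by field; rewrite gt_eqF.
have -> : nc h ^+ i.+2 = nc h ^+ 2 * nc h ^+ i by rewrite -exprD.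
apply: ler_wpM2l; first by rewrite exprn_ge0 ?nc_ge0.
by apply: lerXn2r; rewrite ?nnegrE ?nc_ge0 // ltW.
Qed.

Section Sum.
Variables (S : C -> C) (a : nat -> C) (r M : R).
Hypotheses (r0 : 0 < r) (M0 : 0 <= M).
Hypothesis a_bound : forall j, nc (a j) <= M / r ^+ j.
Hypothesis a_sum : forall t, nc t < r -> has_sum (fun j => a j * t ^+ j) (S t).

Lemma term_le (x : R) j : 0 <= x -> nc (a j) * x ^+ j <= M * (x / r) ^+ j.
Proof.
move=> x0; apply: le_trans (ler_wpM2r (exprn_ge0 _ x0) (a_bound j)) _.
by rewrite expr_div_n mulrAC mulrA.
Qed.

(** The second-order estimate of the powers, summed against the coefficients
    on a radius s strictly between |z| and r, bounds the remainder by a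
    multiple of |h|^2. *)
Lemma cdiffable_series z : nc z < r -> cdiffable S z.
Proof.
move=> zr; have hr0 := r0; pose eta := (r - nc z) / 2.
have eta0 : 0 < eta by rewrite /eta; lra.
pose s := nc z + eta.
have s0 : 0 <= s by rewrite addr_ge0 ?nc_ge0 // ltW.
have sr : s < r by rewrite /s /eta; lra.
pose q := s / r.
have hq : 0 <= q < 1 by rewrite divr_ge0 ?(ltW r0) //= ltr_pdivrMr // mul1r.
have q1 : 0 < 1 - q by case/andP: hq => _; rewrite subr_gt0.
have dbound j : nc (a j * (j%:R * z ^+ j.-1)) <= M / eta * q ^+ j.
  rewrite mulrAC ler_pdivlMr // !ncM nc_nat ncX -mulrA.
  have h1 := expr_linear_le j (nc_ge0 z) (ltW eta0).
  by apply: le_trans (ler_wpM2l (nc_ge0 _) h1) _; apply: term_le.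
have Me : 0 <= M / eta by rewrite divr_ge0 // ltW.
have [d hd] := has_sum_ex hq Me dbound.
exists d => e e0.
pose K := M / (1 - q) / eta ^+ 2.
have K0 : 0 <= K by rewrite !divr_ge0 ?exprn_ge0 // ltW.
exists (Num.min eta (e / (K + 1))).
  by rewrite lt_min eta0 divr_gt0 // ltr_wpDl.
move=> w; rewrite lt_min => /andP[hw1 hw2].
set h := w - z in hw1 hw2 *.
have wE : w = z + h by rewrite /h; ring.
have wr : nc w < r.
  by rewrite wE; apply: le_lt_trans (ler_ncD _ _) _; rewrite /s in sr; lra.
have hs : has_sum (fun j => a j * ((z + h) ^+ j - z ^+ j - j%:R * z ^+ j.-1 * h)) (S w - S z - d * h).
  have := has_sumB (has_sumB (a_sum wr) (a_sum zr)) (has_sumM (c := h) hd).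
  rewrite [h * d]mulrC; congr has_sum; apply/funext => j; rewrite wE; ring.
have Kh : 0 <= M * (nc h / eta) ^+ 2.
  by rewrite mulr_ge0 // exprn_ge0 // divr_ge0 ?nc_ge0 // ltW.
have hb j : nc (a j * ((z + h) ^+ j - z ^+ j - j%:R * z ^+ j.-1 * h)) <= M * (nc h / eta) ^+ 2 * q ^+ j.
  rewrite ncM; have h1 := expr_second_order z j eta0 (ltW hw1).
  apply: le_trans (ler_wpM2l (nc_ge0 _) h1) _.
  rewrite mulrCA [leRHS]mulrAC [leRHS]mulrC; apply: ler_wpM2l; last exact: term_le.
  by rewrite exprn_ge0 // divr_ge0 ?nc_ge0 // ltW.
apply: le_trans (has_sum_le hq Kh hb hs) _.
have -> : M * (nc h / eta) ^+ 2 / (1 - q) = K * nc h * nc h.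
  by rewrite /K expr_div_n; field; rewrite !gt_eqF.
apply: ler_wpM2r; first exact: nc_ge0.
have K1 : 0 < K + 1 by rewrite ltr_wpDl.
have := nc_ge0 h; move: hw2; rewrite ltr_pdivlMr //; nra.
Qed.

Lemma series_taylor_le n : exists K : R, forall z, nc z < r / 2 ->
  nc (S z - \sum_(k < n) a k * z ^+ k) <= K * nc z ^+ n.
Proof.
have hr0 := r0; exists (2 * M / r ^+ n) => z zr.
pose q := nc z / r.
have q2 : q <= 1 / 2 by rewrite ler_pdivrMr //; lra.
have hq : 0 <= q < 1 by rewrite divr_ge0 ?nc_ge0 ?(ltW r0) //=; lra.
have hb j : nc (a j * z ^+ j) <= M * q ^+ j by rewrite ncM ncX; apply: term_le; apply: nc_ge0.
have zr' : nc z < r by lra.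
apply: le_trans (has_sum_tail n hq M0 hb (a_sum zr')) _.
have -> : 2 * M / r ^+ n * nc z ^+ n = 2 * M * q ^+ n by rewrite /q expr_div_n; ring.
apply: ler_wpM2r; first by rewrite exprn_ge0 //; case/andP: hq.
by rewrite ler_pdivrMr; [have := M0; nra|lra].
Qed.

End Sum.

Lemma series_function (a : nat -> C) (r M : R) : 0 < r -> 0 <= M ->
  (forall j, nc (a j) <= M / r ^+ j) ->
  exists S : C -> C, forall t, nc t < r -> has_sum (fun j => a j * t ^+ j) (S t).
Proof.
move=> r0 M0 ha.
have h t : exists s, nc t < r -> has_sum (fun j => a j * t ^+ j) s.
  have [tr|_] := ltP (nc t) r; last by exists 0.
  have hq : 0 <= nc t / r < 1 by rewrite divr_ge0 ?nc_ge0 ?(ltW r0) //= ltr_pdivrMr // mul1r.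
  have hb j : nc (a j * t ^+ j) <= M * (nc t / r) ^+ j.
    by rewrite ncM ncX; apply: term_le => //; apply: nc_ge0.
  by have [s hs] := has_sum_ex hq M0 hb; exists s.
by have [S hS] := choice h; exists S.
Qed.

Lemma taylor_dataP n (a : nat -> C) (S : C -> C) : taylor_data n a S <->
  exists K : R, exists2 e : R, 0 < e & forall z, nc z < e ->
    nc (S z - \sum_(k < n) a k * z ^+ k) <= K * nc z ^+ n.
Proof.
rewrite /taylor_data; split.
  move=> /eqO_exP[K /pos_realc[K' K'0 ->] /nbhscP[e e0 he]].
  exists K', e => // z hz; have := he z; rewrite subr0 => /(_ hz) /=.
  by rewrite normrX !normE -rmorphXn -rmorphM ler_rinj.
move=> [K [e e0 he]]; apply/eqO_exP; exists (rinj (Num.max K 1)).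
  by rewrite ltc0_real lt_max ltr01 orbT.
apply/nbhscP; exists e => // z; rewrite subr0 => /he h /=.
rewrite normrX !normE -rmorphXn -rmorphM ler_rinj; apply: le_trans h _.
by apply: ler_wpM2r; rewrite ?exprn_ge0 ?nc_ge0 // le_max lexx.
Qed.

(** A polynomial of degree less than n that is O(z^n) vanishes: the nonzero
    term of lowest degree k would be O(z^(k+1)). *)
Lemma poly_flat_eq0 n (c : nat -> C) (K e : R) : 0 < e ->
  (forall z : C, nc z < e -> nc (\sum_(k < n) c k * z ^+ k) <= K * nc z ^+ n) ->
  forall k, (k < n)%N -> c k = 0.
Proof.
move=> e0 hK; elim/ltn_ind => k IH kn.
pose B := `|K| + \sum_(i < n) nc (c i).
have B0 : 0 <= B by rewrite addr_ge0 //; apply: sumr_ge0 => i _; apply: nc_ge0.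
have hB (x : R) : 0 < x -> x < e -> x <= 1 -> nc (c k) <= B * x.
  move=> x0 xe x1.
  have := hK (rinj x); rewrite nc_real gtr0_norm // => /(_ xe).
  rewrite -(big_mkord xpredT (fun i => c i * rinj x ^+ i)) (@big_cat_nat _ _ _ k) //=; last exact: ltnW.
  rewrite big_nat big1 ?add0r; last by move=> i /andP[_ ik]; rewrite IH ?mul0r // (ltn_trans ik).
  rewrite big_ltn // => h1.
  have h2 : nc (\sum_(k.+1 <= i < n) c i * rinj x ^+ i) <= (\sum_(i < n) nc (c i)) * x ^+ k.+1.
    apply: le_trans (nc_sum _ _ _) _.
    rewrite mulr_suml -(big_mkord xpredT (fun i => nc (c i) * x ^+ k.+1)).
    rewrite [leRHS](@big_cat_nat _ _ _ k.+1) //=; last first.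
    apply: le_trans (_ : \sum_(k.+1 <= i < n) nc (c i) * x ^+ k.+1 <= _); last first.
      by rewrite lerDr; apply: sumr_ge0 => i _; rewrite mulr_ge0 ?nc_ge0 ?exprn_ge0 ?(ltW x0).
    rewrite big_nat [leRHS]big_nat; apply: ler_sum => i /andP[ki _].
    rewrite ncM ncX nc_real gtr0_norm //; apply: ler_wpM2l; first exact: nc_ge0.
    by apply: ler_wiXn2l => //; apply: ltW.
  have h3 : K * x ^+ n <= `|K| * x ^+ k.+1.
    apply: le_trans (_ : `|K| * x ^+ n <= _).
      by apply: ler_wpM2r; rewrite ?exprn_ge0 ?(ltW x0) // ler_norm.
    by apply: ler_wpM2l => //; apply: ler_wiXn2l => //; apply: ltW.
  have h4 : nc (c k * rinj x ^+ k) <= B * x ^+ k.+1.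
    rewrite -[c k * _](addrK (\sum_(k.+1 <= i < n) c i * rinj x ^+ i)).
    apply: le_trans (ler_ncB _ _) _; rewrite /B mulrDl.
    by apply: lerD => //; apply: le_trans h3.
  move: h4; rewrite ncM ncX nc_real gtr0_norm // exprS mulrA ler_pM2r //.
  by rewrite exprn_gt0.
apply/eqP; rewrite -nc_eq0 -[_ == 0]negbK; apply/negP => ck.
have c0 : 0 < nc (c k) by rewrite lt_def ck nc_ge0.
pose x := Num.min (e / 2) (Num.min 1 (nc (c k) / (2 * (B + 1)))).
have B1 : 0 < 2 * (B + 1) by lra.
have x0 : 0 < x by rewrite !lt_min ltr01 !divr_gt0.
have x1 : x <= e / 2 by rewrite ge_min lexx.
have x2 : x <= 1 by rewrite !ge_min lexx orbT.
have x3 : x <= nc (c k) / (2 * (B + 1)) by rewrite !ge_min lexx !orbT.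
have xe : x < e by lra.
have := hB x x0 xe x2; move: x3; rewrite ler_pdivlMr //; nra.
Qed.

Lemma series_taylor_unique n (S : C -> C) (a b : nat -> C) (r M : R) : 0 < r -> 0 <= M ->
  (forall j, nc (b j) <= M / r ^+ j) ->
  (forall t, nc t < r -> has_sum (fun j => b j * t ^+ j) (S t)) ->
  taylor_data n a S -> forall k, (k < n)%N -> b k = a k.
Proof.
move=> r0 M0 hb hs /taylor_dataP[K [e e0 hK]] k kn.
have [K' hK'] := series_taylor_le r0 M0 hb hs n.
apply/eqP; rewrite -subr_eq0; apply/eqP.
have e'0 : 0 < Num.min e (r / 2) by rewrite lt_min e0 divr_gt0.
apply: (@poly_flat_eq0 n (fun k => b k - a k) (K + K') _ e'0 _ k kn) => z.
rewrite lt_min => /andP[/hK h1 /hK' h2].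
have -> : \sum_(i < n) (b i - a i) * z ^+ i =
   (S z - \sum_(i < n) a i * z ^+ i) - (S z - \sum_(i < n) b i * z ^+ i).
  under eq_bigr do rewrite mulrBl.
  by rewrite sumrB; ring.
by apply: le_trans (ler_ncB _ _) _; rewrite mulrDl lerD.
Qed.

Lemma series_taylor n (S : C -> C) (a b : nat -> C) (r M : R) : 0 < r -> 0 <= M ->
  (forall j, nc (b j) <= M / r ^+ j) ->
  (forall t, nc t < r -> has_sum (fun j => b j * t ^+ j) (S t)) ->
  (forall k, (k < n)%N -> b k = a k) -> taylor_data n a S.
Proof.
move=> r0 M0 hb hs hab; apply/taylor_dataP.
have [K hK] := series_taylor_le r0 M0 hb hs n.
exists K, (r / 2); first by rewrite divr_gt0.
move=> z /hK; congr (nc (_ - _) <= _); apply: eq_bigr => k _; rewrite hab //.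
Qed.

Lemma series_at_origin (F : C -> C) (Om : set C) : open Om -> Om 0 ->
  (forall z, Om z -> cdiffable F z) ->
  exists r M (b : nat -> C), [/\ 0 < r < 1, 0 <= M, forall j, nc (b j) <= M / r ^+ j &
    forall t, nc t < r -> has_sum (fun j => b j * t ^+ j) (F t)].
Proof.
move=> /opencP hOm Om0 hF; have [e e0 he] := hOm _ Om0.
pose R0 := Num.min e 1; have R00 : 0 < R0 by rewrite lt_min e0 ltr01.
pose r := R0 / 2; have r0 : 0 < r by rewrite divr_gt0.
have R1 : R0 <= 1 by rewrite ge_min lexx orbT.
have rR : r < R0 by rewrite /r; lra.
have fd z : nc (z - 0) < R0 -> cdiffable F z.
  by rewrite lt_min => /andP[/he Omz _]; apply: hF.
have on x : nc (0 + rinj r * cis C x - 0) < R0.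
  by rewrite add0r subr0 ncM nc_cis mulr1 nc_real gtr0_norm.
have [M hM] := circle_bounded (fun x => fd _ (on x)).
have [b [hb hs]] := power_series r0 rR fd hM.
have M0 : 0 <= M by apply: le_trans (nc_ge0 _) (hb 0%N).
exists r, M, (fun j => b j * rinj (r ^- j)); split=> //.
- by rewrite r0 /=; lra.
- move=> j; rewrite ncM nc_real ger0_norm; last by rewrite invr_ge0 exprn_ge0 // ltW.
  by apply: ler_wpM2r; rewrite // invr_ge0 exprn_ge0 // ltW.
move=> t /hs; rewrite add0r; congr has_sum; apply/funext => j.
by rewrite expr_div_n -mulrA fmorphV rmorphXn [t ^+ j / _]mulrC.
Qed.

End Series.

(** * Connectedness of the domain of holomorphy *)

Section Connected.
Variables (R : realType) (C : complex_plane R).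

Definition seg (x y : C) (t : R) : C := x + rinj t * (y - x).

Lemma seg_continuous x y : continuous (seg x y : R^o -> C).
Proof.
move=> t A /nbhscP[e e0 he].
have d0 : 0 < e / (nc (y - x) + 1) by rewrite divr_gt0 // ltr_wpDl ?nc_ge0.
apply/(@nbhs_ballP _ R^o); exists (e / (nc (y - x) + 1)) => //= s; rewrite /ball /= => hs.
apply: he; have -> : seg x y s - seg x y t = rinj (s - t) * (y - x).
  by rewrite /seg rmorphB; ring.
rewrite ncM nc_real distrC; move: hs; rewrite ltr_pdivlMr; last by rewrite ltr_wpDl ?nc_ge0.
by apply: le_lt_trans; apply: ler_wpM2l; rewrite // lerDl.
Qed.

Lemma seg_connected x y : connected (seg x y @` `[0, 1]).
Proof.
apply: connected_continuous_connected; first exact: segment_connected.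
exact/continuous_subspaceT/seg_continuous.
Qed.

(** Segments are connected, so a subset of A that is open and closed in A
    contains the other end of any segment of A that starts in it. *)
Lemma polygonally_connected (A : set C) :
  (forall x y, A x -> A y -> exists m, forall t : R, 0 <= t <= 1 -> A (seg x m t) /\ A (seg m y t)) ->
  connected A.
Proof.
move=> hA B [b Bb] [P Po BO] [F Fc BF].
have BA : B `<=` A by rewrite BO; apply: subIsetl.
have step x y : B x -> (forall t : R, 0 <= t <= 1 -> A (seg x y t)) -> B y.
  move=> Bx h; pose S := seg x y @` `[0, 1].
  have SA : S `<=` A by move=> w [t]; rewrite /= in_itv /= => ht <-; apply: h.
  have Sx : S x by exists 0; rewrite /= ?in_itv /= ?lexx ?ler01 // /seg rmorph0 mul0r addr0.
  have Sy : S y.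
    by exists 1; rewrite /= ?in_itv /= ?lexx ?ler01 // /seg rmorph1 mul1r addrCA subrr addr0.
  suff e : S `&` B = S.
    by have [] : (S `&` B) y by rewrite e.
  apply: (@seg_connected x y); first by exists x.
    by exists P => //; rewrite BO setIA (setIidl SA).
  by exists F => //; rewrite BF setIA (setIidl SA).
rewrite eqEsubset; split=> // y Ay.
have [m hm] := hA b y (BA _ Bb) Ay.
have Bm : B m by apply: (step b) => // t /hm[].
by apply: (step m) => // t /hm[].
Qed.

Lemma nc_seg x y p t e : 0 <= t <= 1 -> nc (x - p) < e -> nc (y - p) < e -> nc (seg x y t - p) < e.
Proof.
move=> /andP[t0 t1] hx hy.
have -> : seg x y t - p = rinj (1 - t) * (x - p) + rinj t * (y - p).
  by rewrite /seg rmorphB rmorph1; ring.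
apply: le_lt_trans (ler_ncD _ _) _; rewrite !ncM !nc_real !ger0_norm ?subr_ge0 //.
have [->|tn] := eqVneq t 0; first by rewrite subr0 mul1r mul0r addr0.
have tp : 0 < t by rewrite lt_def tn.
have h1 : (1 - t) * nc (x - p) <= (1 - t) * e by apply: ler_wpM2l; [rewrite subr_ge0|apply: ltW].
have h2 : t * nc (y - p) < t * e by rewrite ltr_pM2l.
by lra.
Qed.

Lemma ball_connected (p : C) (e : R) : connected [set w : C | nc (w - p) < e].
Proof.
apply: polygonally_connected => x y /= hx hy; exists y => t ht.
by split; apply: nc_seg.
Qed.

Lemma rect_eq0 (u v : R) : rinj u + 'i * rinj v = 0 :> C -> u = 0 /\ v = 0.
Proof.
move=> h.
have h2 : u ^+ 2 + v ^+ 2 = 0.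
  apply: (fmorph_inj (@rinj R C)); rewrite rmorph0 rmorphD !rmorphXn /=.
  have -> : rinj u = - ('i * rinj v) :> C by apply/eqP; rewrite -addr_eq0 h.
  by rewrite sqrrN exprMn sqrCi mulN1r addNr.
have := h2 => /eqP; rewrite paddr_eq0 ?sqr_ge0 // !sqrf_eq0.
by move=> /andP[/eqP -> /eqP ->].
Qed.

(** If the segment from x to y meets the centre p, go through a point of the
    line through p perpendicular to it. The point obtained from x by a quarter
    turn is in the ball, and both segments avoid p: their points are p + (x -
    p) (s + i t) with s and t real and not both zero. *)
Lemma punctured_ball_connected (p : C) (e : R) :
  connected [set w : C | w != p /\ nc (w - p) < e].
Proof.
apply: polygonally_connected => x y /= [xp hx] [yp hy].
have xp0 : x - p != 0 by rewrite subr_eq0.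
have yp0 : y - p != 0 by rewrite subr_eq0.
have [h|] := pselect (forall t : R, 0 <= t <= 1 -> seg x y t != p).
  exists y => t ht; split; split; try by apply: nc_seg.
    exact: h.
  by rewrite /seg subrr mulr0 addr0.
move=> /existsNP[t0 /not_implyP[/andP[t00 t01] /negP]]; rewrite negbK => /eqP ht0.
have ht0' : rinj (1 - t0) * (x - p) = - (rinj t0 * (y - p)).
  apply/eqP; rewrite -addr_eq0; apply/eqP.
  rewrite -[RHS](subrr p) -{3}ht0 /seg rmorphB rmorph1; ring.
have t0n : t0 != 0.
  apply/eqP => e0; move: ht0'; rewrite e0 subr0 rmorph1 mul1r rmorph0 mul0r oppr0 => /eqP.
  by rewrite (negbTE xp0).
have t1n : 1 - t0 != 0.
  apply/eqP => e0; move: ht0'; rewrite e0 rmorph0 mul0r => /esym/eqP.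
  by rewrite oppr_eq0 mulf_eq0 fmorph_eq0 (negbTE t0n) (negbTE yp0).
have yE : y - p = - rinj ((1 - t0) / t0) * (x - p).
  apply: (@mulfI _ (rinj t0 : C)); first by rewrite fmorph_eq0.
  rewrite mulNr mulrN mulrA -rmorphM [t0 * _]mulrC divfK // ht0' opprK //.
have c0 : (1 - t0) / t0 != 0 by rewrite mulf_neq0 // invr_eq0.
pose m := p + 'i * (x - p).
have mp : m - p = 'i * (x - p) by rewrite /m; ring.
have hm : nc (m - p) < e by rewrite mp ncM nc_i mul1r.
exists m => t ht; split; split; try by apply: nc_seg.
- rewrite -subr_eq0.
  have -> : seg x m t - p = (x - p) * (rinj (1 - t) + 'i * rinj t).
    by rewrite /seg /m rmorphB rmorph1; ring.
  rewrite mulf_eq0 negb_or xp0 /=; apply/eqP => /rect_eq0[] h1 h2.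
  by move: h1; rewrite h2; lra.
- rewrite -subr_eq0.
  have -> : seg m y t - p = (x - p) * (rinj (- (t * ((1 - t0) / t0))) + 'i * rinj (1 - t)).
    have -> : seg m y t - p = rinj (1 - t) * (m - p) + rinj t * (y - p).
      by rewrite /seg rmorphB rmorph1; ring.
    by rewrite mp yE !rmorphN rmorphB rmorph1 (rmorphM _ t) /=; ring.
  rewrite mulf_eq0 negb_or xp0 /=; apply/eqP => /rect_eq0[] /eqP; rewrite oppr_eq0 mulf_eq0 (negbTE c0) orbF.
  by move=> /eqP -> ; lra.
Qed.

Lemma holomorphic_atP (S : C -> C) z : holomorphic_at S z <->
  exists2 e : R, 0 < e & forall w, nc (w - z) < e -> cdiffable S w.
Proof.
rewrite /holomorphic_at; split.
  by move=> /nbhscP[e e0 he]; exists e => // w /he /cdiff_derivable.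
by move=> [e e0 he]; apply/nbhscP; exists e => // w /he /cdiff_derivable.
Qed.

Definition holo_dom (S : C -> C) := [set z : C | unit_disk z /\ holomorphic_at S z].

Lemma disc_ball (z : C) : unit_disk z <-> nc (z - 0) < 1.
Proof. by rewrite /unit_disk /= norm_lt1_nc subr0. Qed.

Lemma holo_dom_open S : open (holo_dom S).
Proof.
apply/opencP => z [/disc_ball dz /holomorphic_atP[e e0 he]].
have [d d0 hd] := (opencP _).1 (@open_nc_ball R C 0 1) _ dz.
exists (Num.min (e / 2) d); first by rewrite lt_min d0 divr_gt0.
move=> w; rewrite lt_min => /andP[w1 w2]; split; first by apply/disc_ball; apply: hd.
apply/holomorphic_atP; exists (e / 2); first by rewrite divr_gt0.
move=> v hv; apply: he; have -> : v - z = (v - w) + (w - z) by ring.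
by apply: le_lt_trans (ler_ncD _ _) _; lra.
Qed.

Lemma holo_dom_diff S z : holo_dom S z -> cdiffable S z.
Proof. by move=> [_ /holomorphic_atP[e e0]]; apply; rewrite subrr nc0. Qed.

Lemma meromorphic_punctured S p : meromorphic_on (@unit_disk C) S -> unit_disk p ->
  exists2 e : R, 0 < e & forall w, w != p -> nc (w - p) < e -> holo_dom S w.
Proof.
move=> hS dp; have [k /holomorphic_atP[e e0 he]] := hS p dp.
have [d d0 hd] := (opencP _).1 (@open_nc_ball R C 0 1) _ ((disc_ball p).1 dp).
exists (Num.min e d); first by rewrite lt_min e0.
have diff w : w != p -> nc (w - p) < e -> cdiffable S w.
  move=> wp we; have wp0 : 0 < nc (w - p) by rewrite nc_gt0 subr_eq0.
  apply: (@cdiffable_near R C (fun z => ((z - p) ^+ k)^-1 * ((z - p) ^+ k * S z)) _ _ (nc (w - p)) wp0).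
    move=> z hz; rewrite mulKf // expf_neq0 // -nc_gt0.
    have hz' : nc (w - z) < nc (w - p) by rewrite [nc (w - z)]nc_sym.
    have h1 := ler_ncD_sub (w - p) (w - z).
    have h2 : w - p - (w - z) = z - p by ring.
    by rewrite h2 in h1; lra.
  apply: cdiffableM; last exact: he.
  apply: cdiffableV; first by rewrite expf_neq0 // -nc_gt0.
  by apply: cdiffableX; apply: cdiffableB; [apply: cdiffable_id|apply: cdiffable_cst].
move=> w wp; rewrite lt_min => /andP[w1 w2]; split; first by apply/disc_ball; apply: hd.
have wp0 : 0 < nc (w - p) by rewrite nc_gt0 subr_eq0.
apply/holomorphic_atP; exists (Num.min (nc (w - p)) (e - nc (w - p))).
  by rewrite lt_min wp0 subr_gt0.
move=> v; rewrite lt_min => /andP[v1 v2]; apply: diff.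
  apply/eqP => vp; move: v1; rewrite vp nc_sym ltxx //.
have -> : v - p = (v - w) + (w - p) by ring.
by apply: le_lt_trans (ler_ncD _ _) _; lra.
Qed.

(** Let B be nonempty, open and closed in the domain of holomorphy. The points
    of the disc near which B contains all points except perhaps the centre
    form an open and closed subset U of the disc: a point p has a punctured
    neighbourhood inside the domain, which is connected, and B contains either
    all of it or nothing. As the disc is connected, U is the whole disc; so
    every point of the domain is a limit of points of B, and belongs to B. *)
Lemma holo_dom_connected S : meromorphic_on (@unit_disk C) S -> connected (holo_dom S).
Proof.
move=> hS B [b Bb] [P Po BO] [F Fc BF].
set D := holo_dom S in BO BF *.
have BD : B `<=` D by rewrite BO; apply: subIsetl.
pose U := [set p : C | unit_disk p /\ exists2 e : R, 0 < e & forall w, w != p -> nc (w - p) < e -> B w].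
have near_in (p : C) (e : R) : 0 < e -> exists2 w : C, w != p & nc (w - p) < e.
  move=> e0; exists (p + rinj (e / 2)).
    by rewrite -subr_eq0 addrC addKr fmorph_eq0; apply/eqP; lra.
  by rewrite addrC addKr nc_real ger0_norm; lra.
have B_open : open B by rewrite BO; apply: openI => //; apply: holo_dom_open.
have closedB p : D p -> closure B p -> B p.
  move=> Dp clp; rewrite BF; split=> //; apply: Fc; apply: closureS clp.
  by rewrite BF; apply: subIsetr.
have BU : B `<=` U.
  move=> p Bp; split; first by case: (BD _ Bp).
  by have [e e0 he] := (opencP _).1 B_open _ Bp; exists e => // w _; apply: he.
suff UD : U = [set w : C | nc (w - 0) < 1].
  rewrite eqEsubset; split=> // p Dp; apply: closedB => // V /nbhscP[d d0 hd].
  have [_ [e e0 he]] : U p by rewrite UD /=; apply/disc_ball; case: Dp.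
  have [w wp] := near_in p (Num.min d e) (etrans (lt_min _ _ _) (introT andP (conj d0 e0))).
  by rewrite lt_min => /andP[w1 w2]; exists w; split; [apply: he|apply: hd].
have Udisc : U `<=` [set w : C | nc (w - 0) < 1] by move=> p [/disc_ball].
apply: (@ball_connected 0 1).
- by exists b; apply: BU.
- exists U; last by rewrite setIidr.
  apply/opencP => p [dp [e e0 he]].
  have [d d0 hd] := (opencP _).1 (@open_nc_ball R C 0 1) _ ((disc_ball p).1 dp).
  exists (Num.min d e); first by rewrite lt_min d0.
  move=> q; rewrite lt_min => /andP[q1 q2].
  have [->|qp] := eqVneq q p; first by split=> //; exists e.
  by apply: BU; apply: he.
exists (closure U); first exact: closed_closure.
rewrite eqEsubset; split=> [p Up|p [dp clp]].
  by split; [apply: Udisc|apply: subset_closure].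
have dp' : unit_disk p by apply/disc_ball.
split=> //.
have [e e0 he] := meromorphic_punctured hS dp'.
exists e => // w wp we.
pose N := [set w : C | w != p /\ nc (w - p) < e].
have ND : N `<=` D by move=> v [v1 v2]; apply: he.
suff : N `&` B = N by move=> h; have [] : (N `&` B) w by rewrite h.
apply: (@punctured_ball_connected p e).
- have /clp[q [[dq [e' e'0 hq]] /= qe]] : nbhs p [set v | nc (v - p) < e].
    by apply/nbhscP; exists e.
  have [qp|qp] := eqVneq q p.
    rewrite qp in hq.
    have [v vp] := near_in p (Num.min e e') (etrans (lt_min _ _ _) (introT andP (conj e0 e'0))).
    by rewrite lt_min => /andP[v1 v2]; exists v; split; [split|apply: hq].
  have qp0 : 0 < nc (q - p) by rewrite nc_gt0 subr_eq0.
  pose d := Num.min e' (Num.min (nc (q - p)) (e - nc (q - p))).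
  have d0 : 0 < d by rewrite !lt_min e'0 qp0 subr_gt0.
  have [v vq] := near_in q d d0; rewrite !lt_min => /and3P[v1 v2 v3].
  exists v; split; last exact: hq.
  split; first by apply/eqP => vp; move: v2; rewrite vp nc_sym ltxx.
  have -> : v - p = (v - q) + (q - p) by ring.
  by apply: le_lt_trans (ler_ncD _ _) _; lra.
- by exists P => //; rewrite BO setIA (setIidl ND).
by exists F => //; rewrite BF setIA (setIidl ND).
Qed.

End Connected.

(** * Rationality when both numbers of squares are finite *)

Section Null.
Variables (R : realType) (C : complex_plane R).

Lemma bform_addl (K : nat -> nat -> C) n (z y w : nat -> C) (s : C) :
  bform K n (fun i => z i + s * y i) w = bform K n z w + s * bform K n y w.
Proof.
rewrite /bform mulr_sumr -big_split; apply: eq_bigr => i _.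
by rewrite mulr_sumr -big_split; apply: eq_bigr => j _ /=; ring.
Qed.

Lemma bform_opp (K : nat -> nat -> C) n (x y : nat -> C) :
  bform (fun i j => - K i j) n x y = - bform K n x y.
Proof.
rewrite /bform -sumrN; apply: eq_bigr => i _; rewrite -sumrN.
by apply: eq_bigr => j _; ring.
Qed.

Section Kernel.
Variables (K : nat -> nat -> C) (nu pi : nat).
Hypothesis K_herm : herm_kernel K.
Hypothesis K_neg : forall k, negsq setT K k <-> (k <= nu)%N.
Hypothesis K_pos : forall k, negsq setT (fun i j => - K i j) k <-> (k <= pi)%N.

(** The form is nonnegative on the orthogonal of the negative frame, so that
    the Cauchy-Schwarz inequality holds there: an isotropic vector y is
    orthogonal to all of this subspace. It is also orthogonal to the frame. *)
Lemma isotropic_null r0 (u : 'I_nu -> nat -> C) (y : nat -> C) n (z : nat -> C) :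
  (forall p j, (r0 <= j)%N -> u p j = 0) ->
  (forall p q, bform K r0 (u p) (u q) = - (p == q)%:R) -> (r0 <= n)%N ->
  (forall q, bform K n y (u q) = 0) -> bform K n y y = 0 -> bform K n z y = 0.
Proof.
move=> us uf hn yu yy.
pose c p := bform K n z (u p); pose z' i := z i + frame_comb u c i.
have z'u q : bform K n z' (u q) = 0 by rewrite (bform_comb_frame us uf) // subrr.
have uy p : bform K n (u p) y = 0 by rewrite -bform_conj // yu conjC0.
have z'y : bform K n z' y = bform K n z y.
  have e0 : \sum_p c p * bform K n (u p) y = 0 by apply: big1 => p _; rewrite uy mulr0.
  rewrite -[RHS]addr0 -e0 /bform.
  under [X in _ = _ + X]eq_bigr do rewrite mulr_sumr.
  rewrite [X in _ = _ + X]exchange_big -big_split; apply: eq_bigr => i _ /=.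
  under [X in _ = _ + X]eq_bigr do rewrite mulr_sumr.
  rewrite [X in _ = _ + X]exchange_big -big_split; apply: eq_bigr => j _ /=.
  rewrite /z' /frame_comb 2!mulrDl 2!mulr_suml; congr (_ + _).
  by apply: eq_bigr => p _; ring.
rewrite -z'y; set b := bform K n z' y.
have main (s : C) : 0 <= bform K n z' z' + s * b^* + s^* * b.
  have h : 0 <= bform K n (fun i => z' i + s * y i) (fun i => z' i + s * y i).
    apply: (bform_ge0 K_herm K_neg us uf hn) => q.
    by rewrite bform_addl z'u yu mulr0 addr0.
  move: h; rewrite bform_addl.
  rewrite -[bform K n z' (fun i => _)]bform_conj // -[bform K n y (fun i => _)]bform_conj //.
  rewrite !bform_addl yy mulr0 addr0 !rmorphD !rmorphM /= !bform_conj //.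
  by rewrite addrAC.
apply/eqP; rewrite -nc_eq0 -[_ == 0]negbK; apply/negP => b0.
have bp : 0 < nc b ^+ 2 by rewrite exprn_gt0 // lt_def b0 nc_ge0.
have hz : bform K n z' z' = rinj (nc (bform K n z' z')).
  by rewrite -normE ger0_norm //; have := main 0; rewrite !mul0r conjC0 mul0r !addr0.
set beta := nc _ in hz.
have be0 : 0 <= beta by apply: nc_ge0.
(* With this t the quadratic polynomial, here affine in t since y is
   isotropic, takes the value - beta - 2. *)
pose t := (beta + 1) / nc b ^+ 2.
have := main (- rinj t * b).
have -> : bform K n z' z' + - rinj t * b * b^* + (- rinj t * b)^* * b = rinj (beta - 2 * t * nc b ^+ 2).
  have tc : (rinj t : C)^* = rinj t.
    by apply: conj_Creal; rewrite realE -(rmorph0 (@rinj R C)) !ler_rinj; apply: num_real.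
  have -> : (- rinj t * b)^* = - rinj t * b^* by rewrite rmorphM rmorphN /= tc.
  rewrite hz [in RHS]rmorphB [in RHS]rmorphM -mul_conj_nc [in RHS]rmorphM rmorph_nat.
  by ring.
rewrite rinj_ge0 /t -!mulrA mulVf ?gt_eqF //; lra.
Qed.

(** Take maximal negative frames for K and for -K. Among nu + pi + 1
    coordinates there is a nonzero vector orthogonal to both; its square is
    nonnegative and nonpositive, so it is isotropic, and orthogonal to
    everything. *)
Lemma null_vector : exists n (y : nat -> C), [/\ (exists2 i, (i < n)%N & y i != 0),
  (forall i, (n <= i)%N -> y i = 0) & forall j, \sum_(i < n) y i * K i j = 0].
Proof.
have NK_herm : herm_kernel (fun i j => - K i j) by move=> i j; rewrite K_herm rmorphN.
have [r0 [u [us uf]]] := frame_ex K_herm K_neg.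
have [r1 [v [vs vf]]] := frame_ex NK_herm K_pos.
pose m := (nu + pi).+1.
pose Q : 'M[C]_(m, nu + pi) := \matrix_(i, j) match fintype.split j with
  inl q => pairing K r0 u i q | inr q => pairing (fun i j => - K i j) r1 v i q end.
have : kermx Q != 0.
  rewrite -mxrank_eq0 mxrank_ker -lt0n subn_gt0.
  by apply: leq_ltn_trans (rank_leq_col _) _.
move=> /rowV0Pn [x /sub_kermxP xQ x0].
have /rV0Pn[i0 xi0] := x0.
pose y n := if insub n is Some i then x 0 i else 0.
have yE (i : 'I_m) : y i = x 0 i by rewrite /y valK.
have ys i : (m <= i)%N -> y i = 0 by move=> hi; rewrite /y insubF // ltnNge hi.
have ysum n (f : nat -> C) : (m <= n)%N -> \sum_(i < n) y i * f i = \sum_(i < m) y i * f i.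
  move=> hn; rewrite [RHS](big_ord_widen n (fun j => y j * f j)) // [RHS]big_mkcond.
  by apply: eq_bigr => j _; case: ltnP => // /ys ->; rewrite mul0r.
exists m, y; split=> //; first by exists i0; rewrite ?yE.
move=> j; pose n := (m + r0 + r1 + j).+1.
have hm : (m <= n)%N by rewrite /n; lia.
have h0 : (r0 <= n)%N by rewrite /n; lia.
have h1 : (r1 <= n)%N by rewrite /n; lia.
have hj : (j < n)%N by rewrite /n; lia.
have yu q : bform K n y (u q) = 0.
  rewrite (bform_frame K us) // (ysum n (fun i => pairing K r0 u i q)) //.
  have /matrixP/(_ 0 (lshift pi q)) := xQ; rewrite !mxE => h; rewrite -[RHS]h.
  by apply: eq_bigr => i _; rewrite yE mxE (unsplitK (inl q)).
have yv q : bform (fun i j => - K i j) n y (v q) = 0.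
  rewrite (bform_frame (fun i j => - K i j) vs) // (ysum n (fun i => pairing (fun i j => - K i j) r1 v i q)) //.
  have /matrixP/(_ 0 (rshift nu q)) := xQ; rewrite !mxE => h; rewrite -[RHS]h.
  by apply: eq_bigr => i _; rewrite yE mxE (unsplitK (inr q)).
have yy : bform K n y y = 0.
  apply/eqP; rewrite eq_le; apply/andP; split.
    have := bform_ge0 NK_herm K_pos vs vf h1 yv.
    by rewrite bform_opp oppr_ge0.
  exact: (bform_ge0 K_herm K_neg us uf h0 yu).
have := isotropic_null (fun i => (i == j)%:R) us uf h0 yu yy.
rewrite /bform (bigD1 (Ordinal hj)) //= [X in _ + X]big1 ?addr0; last first.
  by move=> i; rewrite -val_eqE /= => /negbTE ->; apply: big1 => l _; rewrite !mul0r.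
move=> /(congr1 Num.conj); rewrite conjC0 rmorph_sum => h; rewrite -[RHS]h -(ysum n (fun i => K i j)) //.
by apply: eq_bigr => i _; rewrite eqxx mul1r rmorphM /= conjCK -K_herm mulrC.
Qed.

End Kernel.

(** Written out, the equation sum_i y_i K(i, j) = 0 says that y_j = sum_(l <=
    j) q_l conj a_(j-l) with q_l = sum_(i >= l) y_i a_(i-l). After conjugation
    this is P = Q S for the polynomials with coefficients conj y and conj q,
    and Q is nonzero since y is. *)
Lemma formal_rational (a : nat -> C) (nu pi : nat) :
  (forall k, negsq setT (jet_kernel a) k <-> (k <= nu)%N) ->
  (forall k, negsq setT (fun i j => - jet_kernel a i j) k <-> (k <= pi)%N) ->
  exists P Q : {poly C}, Q != 0 /\
    forall j, P`_j = \sum_(l < j.+1) Q`_l * a (j - l)%N.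
Proof.
move=> h1 h2.
have [n [y [[i0 i0n yi0] ys hy]]] := null_vector (jet_kernel_herm a) h1 h2.
pose q l := \sum_(i < n) if (l <= i)%N then y i * a (i - l)%N else 0.
have q0 l : (n <= l)%N -> q l = 0.
  by move=> hl; apply: big1 => i _; rewrite leqNgt (leq_trans (ltn_ord i) hl).
have hyq j : y j = \sum_(l < j.+1) q l * (a (j - l)%N)^*.
  have e1 : \sum_(i < n) y i * (i == j :> nat)%:R = y j.
    have [jn|nj] := ltnP j n.
      rewrite (bigD1 (Ordinal jn)) //= eqxx mulr1 big1 ?addr0 //.
      by move=> i; rewrite -val_eqE /= => /negbTE ->; rewrite mulr0.
    rewrite ys // big1 // => i _; rewrite ltn_eqF ?mulr0 //.
    exact: leq_trans (ltn_ord i) nj.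
  rewrite -e1; have := hy j; rewrite /jet_kernel.
  under eq_bigr do rewrite mulrBr.
  rewrite sumrB => /eqP; rewrite subr_eq0 => /eqP ->.
  under [RHS]eq_bigr do rewrite mulr_suml.
  rewrite [RHS]exchange_big; apply: eq_bigr => i _ /=.
  rewrite mulr_sumr (big_ord_widen j.+1 (fun l => y i * (a (i - l)%N * (a (j - l)%N)^* ))); last by rewrite ltnS geq_minr.
  rewrite big_mkcond; apply: eq_bigr => l _; rewrite ltnS leq_min.
  have -> : (l <= j)%N by rewrite -ltnS.
  by rewrite andbT; case: ifP => _; rewrite ?mul0r // mulrA.
exists (\poly_(i < n) (y i)^* ), (\poly_(i < n) (q i)^* ); split.
  apply/eqP => Q0; move: yi0; rewrite hyq big1 ?eqxx // => l _.
  have [ln|nl] := ltnP l n; last by rewrite q0 // mul0r.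
  have := coef_poly n (fun i => (q i)^* ) l; rewrite Q0 coef0 ln => /esym/eqP.
  by rewrite conjC_eq0 => /eqP ->; rewrite mul0r.
move=> j; rewrite coef_poly.
have -> : (if (j < n)%N then (y j)^* else 0) = (y j)^*.
  by case: ltnP => // /ys ->; rewrite conjC0.
rewrite hyq rmorph_sum; apply: eq_bigr => l _; rewrite rmorphM /= conjCK; congr (_ * _).
by rewrite coef_poly; case: ltnP => // /q0 ->; rewrite conjC0.
Qed.

Lemma cdiffable_poly (p : {poly C}) z : cdiffable (fun w => p.[w]) z.
Proof.
elim/poly_ind: p => [|p c IH].
  by under eq_fun do rewrite horner0; apply: cdiffable_cst.
have -> : (fun w => (p * 'X + c%:P).[w]) = (fun w => p.[w] * w - (- c)).
  by apply/funext => w; rewrite hornerMXaddC opprK.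
apply: (@cdiffableB _ _ (fun w => p.[w] * w) (fun=> - c)); last exact: cdiffable_cst.
exact: (cdiffableM IH (cdiffable_id z)).
Qed.

Lemma cdiffable_neq0 (f : C -> C) z : cdiffable f z -> f z != 0 ->
  exists2 e : R, 0 < e & forall w, nc (w - z) < e -> f w != 0.
Proof.
move=> /cdiffable_bounded[e e0 [K K0 hK]] fz.
have fp : 0 < nc (f z) by rewrite nc_gt0.
have K1 : 0 < K + 1 by rewrite ltr_wpDl.
exists (Num.min e (nc (f z) / (K + 1))); first by rewrite lt_min e0 divr_gt0.
move=> w; rewrite lt_min ltr_pdivlMr // => /andP[/hK h1 h2].
apply/eqP => fw; move: h1; rewrite fw sub0r ncN.
have := nc_ge0 (w - z); nra.
Qed.

(** Splits off the zero of Q at p, which may have order m = 0. *)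
Lemma poly_near (Q : {poly C}) p : Q != 0 -> exists (m : nat) (q : {poly C}) (e : R),
  [/\ Q = q * ('X - p%:P) ^+ m, 0 < e & forall w, nc (w - p) < e -> q.[w] != 0].
Proof.
move=> Q0; have [m [q hq Qq]] := multiplicity_XsubC Q p.
rewrite Q0 /= in hq.
have [e e0 he] := cdiffable_neq0 (cdiffable_poly q p) hq.
by exists m, q, e.
Qed.

(** The quotient P / Q, except at 0, where Q may vanish although S is
    holomorphic; there the value of S is taken. At a zero of Q of order m the
    function becomes holomorphic after multiplication by (z - p)^(m+1). The
    exponent m + 1 rather than m makes the product vanish at p, whatever value
    the quotient was given there. *)
Lemma rational_function (a : nat -> C) (P Q : {poly C}) (S : C -> C) (r M : R) :
  0 < r -> 0 <= M -> (forall j, nc (a j) <= M / r ^+ j) ->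
  (forall t, nc t < r -> has_sum (fun j => a j * t ^+ j) (S t)) -> Q != 0 ->
  (forall j, P`_j = \sum_(l < j.+1) Q`_l * a (j - l)%N) ->
  exists F : C -> C, meromorphic_on (@unit_disk C) F /\
    exists2 e : R, 0 < e & forall z, nc z < e -> F z = S z.
Proof.
move=> r0 M0 ha hs Q0 hPQ.
have QS z : nc z < r -> Q.[z] * S z = P.[z].
  move=> zr.
  have h1 : has_sum (fun j => P`_j * z ^+ j) (P.[z]).
    apply: (@has_sum_near _ _ _ _ (size P)) => n hn.
    by rewrite (horner_coef_wide z hn).
  apply: (has_sum_unique _ h1).
  have h2 (l : 'I_(size Q)) := has_sum_shift l (has_sumM (c := Q`_l * z ^+ l) (hs z zr)).
  have := has_sum_sum (r := index_enum _) h2.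
  rewrite -mulr_suml -horner_coef; congr has_sum; apply/funext => j.
  rewrite hPQ mulr_suml.
  transitivity (\sum_(l < size Q) if (l <= j)%N then Q`_l * a (j - l)%N * z ^+ j else 0).
    apply: eq_bigr => l _; case: leqP => // lj.
    by rewrite mulrACA -exprD subnKC.
  pose g l := if (l <= j)%N then Q`_l * a (j - l)%N * z ^+ j else 0.
  rewrite -(big_mkord xpredT g) -[RHS](big_mkord xpredT (fun l => Q`_l * a (j - l)%N * z ^+ j)).
  have -> : \sum_(0 <= i < j.+1) Q`_i * a (j - i)%N * z ^+ j = \sum_(0 <= i < j.+1) g i.
    by rewrite !big_nat; apply: eq_bigr => i /andP[_]; rewrite ltnS /g => ->.
  have wide n : (size Q <= n)%N -> \sum_(0 <= i < n) g i = \sum_(0 <= i < size Q) g i.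
    move=> hn; rewrite (@big_cat_nat _ _ _ (size Q)) //= -[RHS]addr0; congr (_ + _); rewrite big_nat; apply: big1 => i.
    by move=> /andP[hi _]; rewrite /g nth_default // !mul0r if_same.
  have wide2 n : (j.+1 <= n)%N -> \sum_(0 <= i < n) g i = \sum_(0 <= i < j.+1) g i.
    move=> hn; rewrite (@big_cat_nat _ _ _ j.+1) //= -[RHS]addr0; congr (_ + _); rewrite big_nat; apply: big1 => i.
    by move=> /andP[hi _]; rewrite /g leqNgt hi.
  by rewrite -(wide (size Q + j.+1)%N) ?leq_addr // wide2 // leq_addl.
pose F z := if z == 0 then S 0 else P.[z] / Q.[z].
have FS : exists2 e : R, 0 < e & forall z, nc z < e -> F z = S z.
  have [m [q [e [Qq e0 he]]]] := poly_near 0 Q0.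
  exists (Num.min e r); first by rewrite lt_min e0.
  move=> z; rewrite lt_min => /andP[ze zr]; rewrite /F; case: eqP => [->//|/eqP z0].
  rewrite -QS // mulrC mulKf // Qq hornerM mulf_neq0 //; first by apply: he; rewrite subr0.
  by rewrite horner_exp hornerXsubC subr0 expf_neq0.
exists F; split=> // p _.
have [->|p0] := eqVneq p 0.
  have [e e0 he] := FS; exists 0%N; apply/holomorphic_atP.
  exists (Num.min (e / 2) (r / 2)); first by rewrite lt_min !divr_gt0.
  move=> w; rewrite subr0 lt_min => /andP[w1 w2].
  have e2 : 0 < e / 2 by rewrite divr_gt0.
  apply: (@cdiffable_near _ _ S _ _ (e / 2) e2).
    move=> v hv; rewrite expr0 mul1r he //.
    by rewrite -[v](subrK w); apply: le_lt_trans (ler_ncD _ _) _; lra.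
  by apply: (cdiffable_series r0 M0 ha hs); lra.
have [m [q [e [Qq e0 he]]]] := poly_near p Q0.
have p0' : 0 < nc p by rewrite nc_gt0.
exists m.+1; apply/holomorphic_atP; exists (Num.min (e / 2) (nc p / 2)).
  by rewrite lt_min !divr_gt0.
move=> w; rewrite lt_min => /andP[w1 w2].
have d0 : 0 < Num.min (e / 2) (nc p / 2) by rewrite lt_min !divr_gt0.
apply: (@cdiffable_near _ _ (fun z => (z - p) * P.[z] * (q.[z])^-1) _ _ _ d0).
  move=> v; rewrite lt_min => /andP[v1 v2].
  have ve : nc (v - p) < e.
    have -> : v - p = (v - w) + (w - p) by ring.
    by apply: le_lt_trans (ler_ncD _ _) _; lra.
  have v0 : v != 0.
    apply/eqP => v0; have e1 : nc p = nc ((v - w) + (w - p)).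
      by rewrite -ncN; congr nc; rewrite v0; ring.
    have := ler_ncD (v - w) (w - p); rewrite -e1; lra.
  rewrite /F (negbTE v0) Qq hornerM horner_exp hornerXsubC.
  have [->|vp] := eqVneq v p; first by rewrite subrr expr0n /= !mul0r.
  have vp0 : v - p != 0 by rewrite subr_eq0.
  have qv := he v ve.
  by rewrite exprS; field; rewrite qv expf_neq0.
apply: cdiffableM.
  apply: cdiffableM; last exact: cdiffable_poly.
  by apply: cdiffableB; [apply: cdiffable_id|apply: cdiffable_cst].
apply: cdiffableV; last exact: cdiffable_poly.
by apply: he; lra.
Qed.

End Null.

(** * The two problems as conditions on Taylor coefficients *)

Section Sequences.
Variables (C : numClosedFieldType).

Definition cf_data (a c : nat -> C) k := c k.+1 = \sum_(j < k.+1) c j * a (k - j)%N.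

Lemma moments_of_coefficients (a : nat -> C) :
  exists c : nat -> C, c 0%N = 1 /\ forall k, cf_data a c k.
Proof.
pose F n (f : nat -> C) := if n is k.+1 then \sum_(j < k.+1) f j * a (k - j)%N else 1.
have [//|c hc] := @course_of_values C 0 F.
  by move=> [|k] f g fg //=; apply: eq_bigr => j _; rewrite fg.
by exists c; split=> [|k]; [rewrite hc|rewrite /cf_data hc].
Qed.

Lemma coefficients_of_moments (c : nat -> C) : c 0%N = 1 ->
  exists a : nat -> C, forall k, cf_data a c k.
Proof.
move=> c0; pose F n (f : nat -> C) := c n.+1 - \sum_(j < n) c j.+1 * f (n - j.+1)%N.
have [//|a ha] := @course_of_values C 0 F.
  move=> n f g fg; rewrite /F; congr (_ - _); apply: eq_bigr => j _; rewrite fg //.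
  by have := ltn_ord j; lia.
exists a => k; rewrite /cf_data big_ord_recl c0 mul1r subn0 (ha k) /F.
by under [X in _ = _ + X]eq_bigr do rewrite lift0; rewrite subrK.
Qed.

Lemma cf_data_moments n (a a' c c' : nat -> C) : c 0%N = 1 -> c' 0%N = 1 ->
  (forall k, (k < n)%N -> cf_data a c k) -> (forall k, (k < n)%N -> cf_data a' c' k) ->
  (forall k, (k < n)%N -> a' k = a k) -> extends_data n c c'.
Proof.
move=> c0 c0' h h' aa; elim/ltn_ind => -[|k] IH kn; first by rewrite c0 c0'.
rewrite h // h' //; apply: eq_bigr => j _; rewrite IH ?aa //; have := ltn_ord j; lia.
Qed.

Lemma cf_data_coefficients n (a a' c c' : nat -> C) : c 0%N = 1 ->
  (forall k, (k < n)%N -> cf_data a c k) -> (forall k, (k < n)%N -> cf_data a' c' k) ->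
  extends_data n c c' -> forall k, (k < n)%N -> a' k = a k.
Proof.
move=> c0 h h' cc; elim/ltn_ind => k IH kn.
have := h' k kn; rewrite /cf_data cc // h // !big_ord_recl !subn0 cc // c0 !mul1r => /eqP.
rewrite (eq_bigr (fun j : 'I_k => c j.+1 * a (k - j.+1)%N)); last by move=> j _; rewrite lift0.
rewrite [X in _ == _ + X](eq_bigr (fun j : 'I_k => c j.+1 * a (k - j.+1)%N)).
  by rewrite (inj_eq (addIr _)) => /eqP.
move=> j _; rewrite lift0 cc; last by have := ltn_ord j; lia.
by rewrite IH //; have := ltn_ord j; lia.
Qed.

End Sequences.

Section Main.
Variables (R : realType) (C : complex_plane R).

Lemma negsq_congr (T : Type) (A : set T) (B B' : T -> T -> C) k :
  (forall s t, A s -> A t -> B s t = B' s t) -> negsq A B k <-> negsq A B' k.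
Proof.
move=> h; split=> -[I [w [wA hw]]]; exists I, w; split=> //.
  by rewrite (_ : (fun i j => _) = (fun i j => B (w i) (w j))) //; apply/funext => i; apply/funext => j; rewrite h.
by rewrite (_ : (fun i j => _) = (fun i j => B' (w i) (w j))) //; apply/funext => i; apply/funext => j; rewrite h.
Qed.

Lemma shrink_radius (a : nat -> C) (r r' M : R) : 0 < r' <= r -> 0 <= M ->
  (forall j, nc (a j) <= M / r ^+ j) -> forall j, nc (a j) <= M / r' ^+ j.
Proof.
move=> /andP[r'0 r'r] M0 h j; apply: le_trans (h j) _.
have r0 : 0 < r by apply: lt_le_trans r'r.
by rewrite ler_wpM2l // lef_pV2 ?posrE ?exprn_gt0 // lerXn2r // nnegrE ltW.
Qed.

(** From the function to its Taylor series at 0 the number of negative squares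
    is preserved; conversely, finitely many negative squares of the kernel of
    the coefficients make the power series converge in a small disc, which
    serves at the same time as domain of the function and as domain of its
    continuation. *)
Lemma schur_kappa_coefficients n (a : nat -> C) kappa : cf_solvable_kappa n a kappa <->
  exists b : nat -> C, (forall k, (k < n)%N -> b k = a k) /\
    forall k, negsq setT (jet_kernel b) k <-> (k <= kappa)%N.
Proof.
split.
  move=> [Om [S [[[Omo _ Omn] OmD Sh /(negative_squaresE _ _ (schur_kernel_hermitian S)) hneg]
    [Om' [F [[[Om'o Om'c Om'n] OmOm' Fh FS] Om'D Om'0 hT]]]]]].
  have Fd z : Om' z -> cdiffable F z by move=> /Fh; apply: (cdiff_derivable _ _).2.
  have [r [M [b [r01 M0 hb hs]]]] := series_at_origin Om'o Om'0 Fd.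
  have r0 : 0 < r by case/andP: r01.
  exists b; split; first exact: (series_taylor_unique r0 M0 hb hs hT).
  have Om'nc z : Om' z -> nc z < 1 by move=> /Om'D; rewrite disc_ball subr0.
  move=> k; have [<- _] := squares_at_origin Om'o Om'c Om'nc Fd Omo Omn OmOm' Om'0 r01 M0 hb hs k.
  rewrite -hneg; apply: negsq_congr => s t hs' ht'.
  by rewrite /schur_kernel !FS.
move=> [b [ba hk]].
have [r [M [r01 M0 hb]]] := coefficients_geometric hk.
have [r0 r1] := andP r01.
have [S hs] := series_function r0 M0 hb.
pose Om : set C := [set w | nc (w - 0) < r].
have Omo : open Om := @open_nc_ball R C 0 r.
have Omc : connected Om := @ball_connected R C 0 r.
have Om0 : Om 0 by rewrite /Om /= subr0 nc0.
have Om1 z : Om z -> nc z < 1 by rewrite /Om /= subr0 => h; apply: lt_trans r1.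
have OmD : Om `<=` @unit_disk C by move=> z /Om1; rewrite disc_ball subr0.
have Sd z : Om z -> cdiffable S z.
  by rewrite /Om /= subr0 => h; apply: (cdiffable_series r0 M0 hb hs).
have Sh : holomorphic_on Om S by move=> z /Sd; apply: (cdiff_derivable _ _).1.
have Omr : region Om by split=> //; exists 0.
exists Om, S; split.
  split=> //; apply/(negative_squaresE _ _ (schur_kernel_hermitian S)) => k; rewrite -hk.
  have [h _] := squares_at_origin Omo Omc Om1 Sd Omo (ex_intro _ 0 Om0) (@subset_refl _ Om) Om0 r01 M0 hb hs k.
  exact: h.
exists Om, S; split=> [|//|//|]; first by split.
exact: (series_taylor r0 M0 hb hs ba).
Qed.

(** The domain of holomorphy of a meromorphic function on the disc is open and
    connected, so the squares on it are those of the Taylor coefficients;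
    conversely, the power series is the expansion of a rational function. *)
Lemma schur_nu_pi_coefficients n (a : nat -> C) nu pi : cf_solvable_nu_pi n a nu pi <->
  exists b : nat -> C, (forall k, (k < n)%N -> b k = a k) /\
    ((forall k, negsq setT (jet_kernel b) k <-> (k <= nu)%N) /\
     (forall k, negsq setT (fun i j => - jet_kernel b i j) k <-> (k <= pi)%N)).
Proof.
split.
  move=> [S [[Sm /(negative_squaresE _ _ (schur_kernel_hermitian S)) hneg
    /(positive_squaresE _ _ (schur_kernel_hermitian S)) hpos] S0 hT]].
  have Do := @holo_dom_open R C S; have Dc := holo_dom_connected Sm.
  have D0 : holo_dom S 0 by split=> //; rewrite disc_ball subr0 nc0.
  have D1 z : holo_dom S z -> nc z < 1 by move=> [/disc_ball]; rewrite subr0.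
  have Dd := @holo_dom_diff _ _ S.
  have [r [M [b [r01 M0 hb hs]]]] := series_at_origin Do D0 Dd.
  have r0 : 0 < r by case/andP: r01.
  have sq := squares_at_origin Do Dc D1 Dd Do (ex_intro _ 0 D0) (@subset_refl _ _) D0 r01 M0 hb hs.
  exists b; split; first exact: (series_taylor_unique r0 M0 hb hs hT).
  by split=> k; have [h1 h2] := sq k; [rewrite -h1; apply: hneg|rewrite -h2; apply: hpos].
move=> [b [ba [hnu hpi]]].
have [r [M [r01 M0 hb]]] := coefficients_geometric hnu.
have [r0 r1] := andP r01.
have [S hs] := series_function r0 M0 hb.
have [P [Q [Q0 hPQ]]] := formal_rational hnu hpi.
have [F [Fm [e e0 FS]]] := rational_function r0 M0 hb hs Q0 hPQ.
pose r' := Num.min e r.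
have r'0 : 0 < r' by rewrite lt_min e0.
have r'r : r' <= r by rewrite ge_min lexx orbT.
have r'e : r' <= e by rewrite ge_min lexx.
have r'01 : 0 < r' < 1 by rewrite r'0 (le_lt_trans r'r).
have hb' := shrink_radius (a := b) (r := r) (r' := r') (introT andP (conj r'0 r'r)) M0 hb.
have hs' t : nc t < r' -> has_sum (fun j => b j * t ^+ j) (F t).
  by move=> ht; rewrite FS ?(lt_le_trans ht) //; apply: hs; apply: lt_le_trans r'r.
have F0 : holomorphic_at F 0.
  apply/holomorphic_atP; exists r' => // w; rewrite subr0 => hw.
  exact: (cdiffable_series r'0 M0 hb' hs').
have Do := @holo_dom_open R C F; have Dc := holo_dom_connected Fm.
have D0 : holo_dom F 0 by split=> //; rewrite disc_ball subr0 nc0.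
have D1 z : holo_dom F z -> nc z < 1 by move=> [/disc_ball]; rewrite subr0.
have Dd := @holo_dom_diff _ _ F.
have sq := squares_at_origin Do Dc D1 Dd Do (ex_intro _ 0 D0) (@subset_refl _ _) D0 r'01 M0 hb' hs'.
exists F; split=> //; last exact: (series_taylor r'0 M0 hb' hs' ba).
split=> //.
  by apply/(negative_squaresE _ _ (schur_kernel_hermitian F)) => k; rewrite -hnu; have [h _] := sq k.
by apply/(positive_squaresE _ _ (schur_kernel_hermitian F)) => k; rewrite -hpi; have [_ h] := sq k.
Qed.

(** Both problems ask for a sequence b that agrees with a below n and has the
    prescribed squares: the relation between coefficients and moments can be
    solved in both directions, and agreement of the coefficients below n is
    agreement of the moments up to n. *)
Lemma caratheodory_fejer (n : nat) (a c : nat -> C) (hc0 : c 0%N = 1)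
    (hc : forall k : nat, (1 <= k <= n)%N ->
       c k = \sum_(j < k) c j * a (k.-1 - j)%N) :
  (forall kappa : nat,
     cf_solvable_kappa n a kappa <->
     exists c' : nat -> C, P_kappa kappa c' /\ extends_data n c c') /\
  (forall nu pi : nat,
     cf_solvable_nu_pi n a nu pi <->
     exists c' : nat -> C, P_nu_pi nu pi.+1 c' /\ extends_data n c c').
Proof.
have hac k : (k < n)%N -> cf_data a c k by move=> kn; rewrite /cf_data hc.
split=> [kappa|nu pi].
  rewrite schur_kappa_coefficients; split=> [[b [ba hk]]|[c' [hP cc]]].
    have [c' [c0' hc']] := moments_of_coefficients b.
    exists c'; split; first exact/(P_kappaE c0' hc').
    exact: (cf_data_moments hc0 c0' hac).
  have c0' : c' 0%N = 1 by rewrite cc.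
  have [b hb] := coefficients_of_moments c0'.
  exists b; split; first exact: (cf_data_coefficients hc0 hac _ cc).
  exact/(P_kappaE c0' hb).
rewrite schur_nu_pi_coefficients; split=> [[b [ba hk]]|[c' [hP cc]]].
  have [c' [c0' hc']] := moments_of_coefficients b.
  exists c'; split; first exact/(P_nu_piE c0' hc').
  exact: (cf_data_moments hc0 c0' hac).
have c0' : c' 0%N = 1 by rewrite cc.
have [b hb] := coefficients_of_moments c0'.
exists b; split; first exact: (cf_data_coefficients hc0 hac _ cc).
exact/(P_nu_piE c0' hb).
Qed.

End Main.

(** * The complex numbers *)

Lemma complex_normE (R : realType) (z : R[i]) : `|z| = real_complex R (ComplexField.Normc.normc z).
Proof. by []. Qed.

Lemma real_complex_ge0 (R : realType) (x : R) : 0 <= x -> 0 <= real_complex R x.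
Proof. by move=> x0; rewrite ler0c. Qed.

(** The numbers R[i] with their norm; here the norm is by definition the
    embedding of a real number. *)
Definition complex_numbers (R : realType) : complex_plane R :=
  @ComplexPlane R R[i] (real_complex R) _ (@complex_normE R) (@real_complex_ge0 R).

Theorem theorem3p5 (R : realType) (n : nat) (a c : nat -> R[i])
    (hc0 : c 0%N = 1)
    (hc : forall k : nat, (1 <= k <= n)%N ->
       c k = \sum_(j < k) c j * a (k.-1 - j)%N) :
  (forall kappa : nat,
     cf_solvable_kappa n a kappa <->
     exists c' : nat -> R[i], P_kappa kappa c' /\ extends_data n c c') /\
  (forall nu pi : nat,
     cf_solvable_nu_pi n a nu pi <->
     exists c' : nat -> R[i], P_nu_pi nu pi.+1 c' /\ extends_data n c c').
Proof. exact: (@caratheodory_fejer R (complex_numbers R) n a c hc0 hc). Qed.
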